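(* Fix $\beta>0$ and $\varepsilon\in(0,\tfrac12)$. The sequence of random variables $\{X^{(N)}(\infty)\}_{N\ge1}$ converges weakly, as $N\to\infty$, to the $\mathrm{Gamma}(2,\beta)$ distribution, whose probability density function is $f(x)=\beta^2xe^{-\beta x}$, $x\in(0,\infty)$. Moreover, for any $p>0$, $$\mathbb{E}\big[\big(X^{(N)}(\infty)\big)^p\big]\to\frac{\Gamma(p+2)}{\beta^p}\quad\text{as }N\to\infty,$$ where $\Gamma$ denotes the standard Gamma function.
   Context: Model (Join-the-Shortest-Queue, JSQ). For each integer $N$ consider $N$ parallel identical single-server queues with unlimited buffers. Tasks arrive as a Poisson process of rate $N\lambda_N$, where $\lambda_N=1-\beta N^{-\frac12-\varepsilon}$ (only $N$ with $\lambda_N>0$ are considered). Service times are i.i.d. exponential with mean 1, service at each server is FCFS. Each arriving task is immediately and irrevocably assigned to a server with the currently shortest queue (ties broken arbitrarily). $Q_i^{(N)}(t)$ is the number of servers whose queue length (including the task in service) at time $t$ is at least $i$, $i\ge1$, and $S^{(N)}(t)=\sum_{i\ge1}Q_i^{(N)}(t)$ is the total number of tasks. The Markov chain $(Q_1^{(N)},Q_2^{(N)},\ldots)$ is positive recurrent and ergodic for each $N$; $S^{(N)}(\infty)$ denotes the total number of tasks under its unique stationary distribution, and $X^{(N)}(\infty)=N^{-\frac12-\varepsilon}\big(S^{(N)}(\infty)-N\big)$. Convention: for a negative number $x$ and non-integer $p>0$, $x^p$ is read as $0$. *)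

(* Defs.v *)
From HB Require Import structures.
From mathcomp Require Import all_boot all_order all_algebra.
From mathcomp Require Import all_classical all_reals all_analysis.
From mathcomp Require Import measurable_realfun ring lra.

Set Implicit Arguments.
Unset Strict Implicit.
Unset Printing Implicit Defensive.

Import Order.TTheory GRing.Theory Num.Theory.
Import numFieldNormedType.Exports.

Local Open Scope classical_set_scope.
Local Open Scope ring_scope.

(** * Continuous-time Markov chains on a discrete state space *)

(* [q x y], for [x != y], is the rate of jumps from [x] to [y]; the diagonal
   values of [q] are irrelevant.  [P] is a standard stochastic transition
   function whose right derivative at time 0 is the conservative Q-matrix with
   off-diagonal entries [q x y].  Only nonnegative times matter. *)
Definition ctmc_semigroup (R : realType) d (T : measurableType d)
    (q : T -> T -> R) (P : R -> R.-pker T ~> T) : Prop :=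
  [/\ forall x A, measurable A -> P 0 x A = (\d_x A : \bar R),
      forall s t : R, 0 <= s -> 0 <= t -> forall x A, measurable A ->
        P (s + t) x A = (\int[P s x]_y P t y A)%E,
      forall x y, x <> y -> fine (P h x [set y]) / h @[h --> 0^'+] --> q x y
    & forall x, (1 - fine (P h x [set x])) / h @[h --> 0^'+] -->
        fine (\esum_(y in [set y | y <> x]) (q x y)%:E)%E].

Definition ctmc_stationary (R : realType) d (T : measurableType d)
    (P : R -> R.-pker T ~> T) (pi : probability T R) : Prop :=
  forall (t : R) A, 0 <= t -> measurable A -> (\int[pi]_x P t x A = pi A)%E.

(** * The Join-the-Shortest-Queue occupancy chain *)

(* The occupancy process (Q_1, Q_2, ...) takes its values in the nonincreasing
   sequences of naturals bounded by [N] that are eventually 0; such a sequence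
   is encoded by the list of its positive terms. *)
Definition jsq_wf (N : nat) (s : seq nat) : bool :=
  sorted geq s && all (fun q => 0 < q <= N)%N s.

Record jsq_state (N : nat) := JsqState {
  jsq_seq :> seq nat;
  jsq_seqP : jsq_wf N jsq_seq }.

HB.instance Definition _ N := [isSub for @jsq_seq N].
HB.instance Definition _ N := [Countable of jsq_state N by <:].

Lemma jsq_wf_nil N : jsq_wf N [::]. Proof. by []. Qed.

HB.instance Definition _ N := isPointed.Build (jsq_state N)
  (JsqState (jsq_wf_nil N)).

(* every set of states is measurable *)
HB.instance Definition _ N := @isMeasurable.Build default_measure_display
  (jsq_state N) discrete_measurable discrete_measurable0
  discrete_measurableC discrete_measurableU.

(* Q_i for i >= 1: the number of servers with at least [i] tasks *)
Definition jsq_Q (N : nat) (s : jsq_state N) (i : nat) : nat := nth 0 s i.-1.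

(* S = \sum_(i >= 1) Q_i *)
Definition jsq_S (N : nat) (s : jsq_state N) : nat := sumn s.

(* the length m of the shortest queue, i.e. the least m with Q_{m+1} < N *)
Definition jsq_shortest (N : nat) (s : jsq_state N) : nat :=
  find (fun q => q < N)%N s.

(* Arrivals (total rate [N * lambda]) join a queue of minimal length m,
   whichever one, so that Q_{m+1} increases by 1.  Each of the
   Q_i - Q_{i+1} servers with exactly [i >= 1] tasks completes a service at
   rate 1, upon which Q_i decreases by 1: the state before the departure is
   the state after it with Q_i incremented.  In [incr_nth] positions start
   at 0, so that Q_i has position [i.-1]. *)
Definition jsq_rate (R : realType) (N : nat) (lambda : R)
    (s t : jsq_state N) : R :=
  N%:R * lambda * (t == incr_nth s (jsq_shortest s) :> seq nat)%:R +
  \sum_(1 <= i < (size s).+1)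
    (jsq_Q s i - jsq_Q s i.+1)%:R * (s == incr_nth t i.-1 :> seq nat)%:R.

Definition jsq_lambda (R : realType) (beta eps : R) (N : nat) : R :=
  1 - beta * N%:R `^ (- 2^-1 - eps).

Definition jsq_X (R : realType) (eps : R) (N : nat) (s : jsq_state N) : R :=
  N%:R `^ (- 2^-1 - eps) * ((jsq_S s)%:R - N%:R).

Lemma measurable_jsq_X (R : realType) (eps : R) (N : nat) :
  measurable_fun [set: jsq_state N] (@jsq_X R eps N).
Proof. by []. Qed.

HB.instance Definition _ (R : realType) (eps : R) (N : nat) :=
  @isMeasurableFun.Build _ _ (jsq_state N) R (@jsq_X R eps N)
    (@measurable_jsq_X R eps N).

(** * Weak convergence, powers, and the Gamma function and law *)

Definition weak_cvg (R : realType)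
    (mu : nat -> probability R R) (nu : probability R R) : Prop :=
  forall f : R -> R, continuous f -> (exists M : R, forall x, `|f x| <= M) ->
    (\int[mu n]_x (f x)%:E)%E @[n --> \oo] --> (\int[nu]_x (f x)%:E)%E.

(* x^p for p > 0, read as 0 if x < 0 and p is not an integer; the library's
   x `^ p is 1 for x < 0. *)
Definition real_pow (R : realType) (x p : R) : R :=
  if 0 <= x then x `^ p
  else if p == (Num.truncn p)%:R then x ^+ Num.truncn p else 0.

Definition Gamma_fun (R : realType) (s : R) : R :=
  (\int[lebesgue_measure]_(x in `]0%R, +oo[) (x `^ (s - 1) * expR (- x)))%R.

Section gamma2.
Context {R : realType}.
Notation mu := (@lebesgue_measure R).
Variable beta : R.

Definition gamma2_pdf (x : R) : R :=
  if 0 < x then beta ^+ 2 * x * expR (- beta * x) else 0.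

Definition gamma2_prob (A : set R) : \bar R :=
  (\int[mu]_(x in A) (gamma2_pdf x)%:E)%E.

Lemma gamma2_pdf_ge0 x : 0 <= gamma2_pdf x.
Proof.
rewrite /gamma2_pdf; case: ifPn => // x0.
by rewrite mulr_ge0 ?expR_ge0// mulr_ge0 ?sqr_ge0 ?ltW.
Qed.

Let gT (x : R) : R := beta ^+ 2 * x * expR (- beta * x).

Let continuous_gT : continuous gT.
Proof.
move=> x; apply: (@continuousM _ R^o (fun x => beta ^+ 2 * x)
  (fun x => expR (- beta * x))).
  by apply: continuousM => //; exact: cst_continuous.
apply: continuous_comp; last exact: continuous_expR.
by apply: continuousM => //; exact: cst_continuous.
Qed.

Let gamma2_pdfE : gamma2_pdf = gT \_ `[0, +oo[.
Proof.
apply/funext => x; rewrite /gamma2_pdf patchE mem_setE in_itv/= andbT le_eqVlt.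
case: (ltrgtP 0 x) => // <-.
by rewrite /gT mulr0 mul0r.
Qed.

Lemma measurable_gamma2_pdf : measurable_fun [set: R] gamma2_pdf.
Proof.
rewrite gamma2_pdfE; apply/measurable_restrict => //; apply: measurable_funTS.
exact: continuous_measurable_fun.
Qed.

Let gamma2_prob0 : gamma2_prob set0 = 0%E.
Proof. by rewrite /gamma2_prob integral_set0. Qed.

Let gamma2_prob_ge0 A : (0 <= gamma2_prob A)%E.
Proof. by apply: integral_ge0 => x _; rewrite lee_fin gamma2_pdf_ge0. Qed.

Let gamma2_prob_sigma_additive : semi_sigma_additive gamma2_prob.
Proof.
move=> /= F mF tF mUF; rewrite /gamma2_prob; apply: cvg_toP.
  apply: ereal_nondecreasing_is_cvgn => m n mn.
  apply: lee_sum_nneg_natr => // k _ _.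
  by apply: integral_ge0 => x _; rewrite lee_fin gamma2_pdf_ge0.
have mf : measurable_fun [set: R] (fun x => (gamma2_pdf x)%:E).
  by apply/measurable_EFinP; exact: measurable_gamma2_pdf.
apply/esym/(@ge0_integral_bigcup _ _ _ mu) => //.
- exact: (measurable_funS measurableT (@subsetT _ _) mf).
- by move=> x _; rewrite lee_fin gamma2_pdf_ge0.
Qed.

HB.instance Definition _ := isMeasure.Build _ _ _
  gamma2_prob gamma2_prob0 gamma2_prob_ge0 gamma2_prob_sigma_additive.

Hypothesis beta_gt0 : 0 < beta.

Let F (x : R) : R := - ((1 + beta * x) * expR (- beta * x)).

Let is_derive_F (x : R) : is_derive x 1 F (gT x).
Proof.
have h : is_derive x 1 (fun y : R => beta * y) beta.
  by apply: is_derive_eq; rewrite /GRing.scale/= ?mulr1 ?mulr0 ?addr0 ?add0r.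
have h' : is_derive x 1 (fun y : R => - beta * y) (- beta).
  by apply: is_derive_eq; rewrite /GRing.scale/= ?mulr1 ?mulr0 ?addr0 ?add0r.
have he : is_derive x 1 (fun y : R => expR (- beta * y))
    (- beta * expR (- beta * x)).
  rewrite mulrC.
  exact: (@is_derive1_comp R expR (fun y => - beta * y) x _ _
    (is_derive_expR _) h').
by apply: is_derive_eq; rewrite /gT /GRing.scale/=; ring.
Qed.

Let cvg_F : F x @[x --> +oo] --> (0 : R).
Proof.
have lim2 : - (2 * expR (- (2^-1 * beta * x))) @[x --> +oo] --> (0 : R).
  rewrite -oppr0; apply: cvgN; rewrite -[X in _ --> X](mulr0 2).
  apply: cvgMr; apply: (@cvg_comp _ _ _ (fun x => 2^-1 * beta * x)
    (fun x => expR (- x)) _ (pinfty_nbhs R)); last exact: cvgr_expR.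
  by apply: gt0_cvgMry; rewrite ?mulr_gt0 ?invr_gt0.
apply: (squeeze_cvgr _ lim2 (cvg_cst _)); near=> x.
have x0 : 0 <= x by near: x; apply: nbhs_pinfty_ge; rewrite num_real.
have bx0 : 0 <= beta * x by rewrite mulr_ge0// ltW.
rewrite /F oppr_le0 mulr_ge0 ?expR_ge0 ?addr_ge0// andbT lerN2.
have -> : expR (- (2^-1 * beta * x)) =
    expR (2^-1 * (beta * x)) * expR (- beta * x).
  by rewrite -expRD; congr expR; field.
rewrite mulrA ler_wpM2r ?expR_ge0//.
by have := expR_ge1Dx (2^-1 * (beta * x)); lra.
Unshelve. all: by end_near. Qed.

Let gamma2_prob_setT : gamma2_prob setT = 1%E.
Proof.
rewrite /gamma2_prob gamma2_pdfE.
transitivity (\int[mu]_(x in `[0%R, +oo[) (gT x)%:E)%E.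
  by rewrite [RHS]integral_mkcond restrict_EFin.
rewrite (@ge0_continuous_FTC2y _ _ F _ 0).
- by rewrite /F !mulr0 expR0 addr0 mulr1 EFinN oppeK add0e.
- move=> x x0; rewrite /gT mulr_ge0 ?expR_ge0// mulr_ge0 ?sqr_ge0//.
- exact/continuous_subspaceT.
- exact: cvg_F.
- by move=> x _; case: (is_derive_F x).
- apply: cvg_at_right_filter; apply: differentiable_continuous.
  by apply/derivable1_diffP; case: (is_derive_F 0).
- by move=> x _; rewrite derive1E; case: (is_derive_F x).
Qed.

HB.instance Definition _ :=
  @Measure_isProbability.Build _ _ R gamma2_prob gamma2_prob_setT.

(* the Gamma(2, beta) distribution (shape 2, rate beta) *)
Definition gamma2_distribution : probability R R := gamma2_prob.

End gamma2.

(* Main.v *)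
From HB Require Import structures.
Require Import Defs.
From mathcomp Require Import all_boot all_order all_algebra.
From mathcomp Require Import all_classical all_reals all_analysis.
From mathcomp Require Import measurable_realfun ring lra zify.

(** Write [I = N - Q_1] for the number of idle servers, [Y = Q_2 + Q_3 + ...]
    for the number of waiting tasks, [tau = 1 - lambda] and [b = N * tau], so
    that [S - N = Y - I].  Each arrival takes an idle server if there is one
    and waits otherwise.

    A stationary law integrates the generator of suitable functions to 0.
    Applied to functions of [I] and [Y], this gives two exact families of
    identities ([excess_balance], [idle_balance]).  If no queue has three or
    more tasks, then [Y = Q_2], and combining them for the rising factorials
    [y_k = Y (Y + 1) ... (Y + k - 1)] yields, up to lower order terms,
    [b * E y_(k+1) = (k + 2) * N * E y_k] ([excess_moment_rec]).  The errors
    are controlled because [E (I * h (Y)) <= b * E (h (Y))] for nondecreasing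
    [h >= 0], while [I] is at most of the order of the square root of [N].
    With [kap = N^(-1/2-eps)] one has [b = beta * N * kap], so that
    [m_k = lim kap^k * E y_k] satisfies [beta * m_(k+1) = (k + 2) * m_k], that
    is, [m_k = (k + 1)! / beta^k]: these are the moments of Gamma(2, beta).
    Since [sqrt N * kap] tends to 0, neither the idle servers nor the
    difference between [y_k] and [Y^k] matters, the positive part of [X] has
    the same limiting moments, and every moment of its negative part tends to
    0 ([cvg_pos_moment], [cvg_neg_moment]).

    Two points remain.  First, queues of length at least three must be shown
    to be negligible: a Lyapunov function, exponential in [Y] and in the
    lengths of the long queues, bounds every moment of
    [Q_3 + Q_4 + ...] by any given negative power of [N] ([lyap_drift],
    [above2_moment]); this also provides the integrability that the
    identities need.  The passage from a transition semigroup to its generator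
    rests on the inequality between the flows into and out of a state
    ([inflow_le]), which holds by Fatou's lemma and becomes an equality for
    bounded functions because the jump rates are bounded ([expect_gen]).

    Second, convergence of moments must be turned into convergence of the
    expectations of continuous functions of polynomial growth
    ([moments_cvg]).  The limit has an exponential moment, so that the
    expectations of [exp (- n d x)] are recovered from the moments by finitely
    many Taylor expansions of fixed step [d], and Bernstein polynomials in
    [exp (- d x)] approximate the continuous functions that vanish far away.
    Bounded continuous functions give the weak convergence, and the powers
    [real_pow x p] give the moments of order [p]. *)

Set Implicit Arguments.
Unset Strict Implicit.
Unset Printing Implicit Defensive.

Import Order.TTheory GRing.Theory Num.Theory.
Import numFieldNormedType.Exports.

Local Open Scope classical_set_scope.
Local Open Scope ring_scope.

(** * Elementary inequalities *)

Lemma bernoulli (R : realType) (x : R) n : 0 <= x -> 1 + n%:R * x <= (1 + x) ^+ n.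
Proof.
move=> x0; elim: n => [|n IH]; first by rewrite mul0r addr0 expr0.
rewrite exprS (@le_trans _ _ ((1 + x) * (1 + n%:R * x)))//.
  rewrite -natr1; have : 0 <= n%:R * x * x by rewrite !mulr_ge0.
  by nra.
by rewrite ler_wpM2l// addr_ge0.
Qed.

(** Cut the exponent into [q] blocks of length [z %/ q] and apply
    Bernoulli's inequality to each of them: an exponential beats any power,
    with an explicit constant. *)
Lemma expr_ge_polynomial (R : realType) (x : R) (z q : nat) : 0 <= x <= 2 -> (0 < q)%N ->
  (x * z%:R / (2 * q%:R)) ^+ q <= (1 + x) ^+ z.
Proof.
move=> /andP[x0 x2] q0; have qR : 0 < q%:R :> R by rewrite ltr0n.
have r1 : 1 <= 1 + x by rewrite lerDl.
apply: (@le_trans _ _ ((1 + x) ^+ ((z %/ q) * q))); last first.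
  by rewrite ler_weXn2l// leq_divM.
rewrite exprM lerXn2r// ?nnegrE ?divr_ge0 ?mulr_ge0 ?exprn_ge0 ?addr_ge0//.
apply: le_trans (bernoulli _ x0).
have zq : z%:R <= ((z %/ q)%:R + 1) * q%:R :> R.
  by rewrite natr1 -natrM ler_nat ltnW// ltn_ceil.
rewrite ler_pdivrMr ?mulr_gt0//.
have := ler_wpM2l x0 zq; set i : R := (z %/ q)%:R.
have : 0 <= q%:R * (2 - x + i * x) by rewrite mulr_ge0// addr_ge0 ?subr_ge0// mulr_ge0.
by lra.
Qed.

(** The mean value inequality for powers, with the increment [x - z]
    replaced by an upper bound of it. *)
Lemma expr_sub_le (R : realType) (x z c : R) k : 0 <= c -> 0 <= z -> z <= x -> x - z <= c ->
  x ^+ k.+1 - z ^+ k.+1 <= k.+1%:R * x ^+ k * c.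
Proof.
move=> c0 z0 zx xzc; have x0 := le_trans z0 zx.
elim: k => [|k IH]; first by rewrite !expr1 expr0 !mul1r.
have -> : x ^+ k.+2 - z ^+ k.+2 = x * (x ^+ k.+1 - z ^+ k.+1) + z ^+ k.+1 * (x - z).
  by rewrite !(exprS _ k.+1); ring.
have h1 : z ^+ k.+1 * (x - z) <= x ^+ k.+1 * c.
  by rewrite ler_pM ?exprn_ge0 ?subr_ge0// lerXn2r.
apply: (le_trans (lerD (ler_wpM2l x0 IH) h1)).
by rewrite -[k.+2%:R]natr1 exprS; lra.
Qed.

Lemma cvg0_near_le (R : realType) (u : nat -> R) (c : R) :
  u N @[N --> \oo] --> (0 : R) -> 0 < c -> \forall N \near \oo, u N <= c.
Proof.
move=> /cvgrPdist_le/(_ c) h /h; apply: filterS => N /=.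
by rewrite sub0r normrN; apply: le_trans; exact: ler_norm.
Qed.

(** * Random variables dominated by powers of a weight *)

Section tame.
Context d (T : measurableType d) (R : realType) (P : probability T R).
Variable W : T -> R.

(** Every integrand of the proof is bounded by a power of one weight [W]
    all of whose moments are finite. This class is closed under the
    algebraic operations, so that integrability is settled by the shape of
    an expression and expectations become linear and monotone real
    functionals. *)
Definition tame (f : T -> R) : Prop :=
  measurable_fun setT f /\ exists C k, forall x, `|f x| <= C * W x ^+ k.

Definition expect (f : T -> R) : R := \int[P]_x f x.

Hypothesis W_ge1 : forall x, 1 <= W x.
Hypothesis W_measurable : measurable_fun setT W.
Hypothesis W_moments : forall k, P.-integrable setT (EFin \o (fun x => W x ^+ k)).

Lemma tame_bound f : tame f ->
  exists C k, 0 <= C /\ forall x, `|f x| <= C * W x ^+ k.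
Proof.
move=> [_ [C [k fC]]]; exists `|C|, k; split => // x.
apply: (le_trans (fC x)); rewrite ler_wpM2r ?ler_norm//.
by rewrite exprn_ge0// (le_trans ler01).
Qed.

Lemma tame_bounded (f : T -> R) C : measurable_fun setT f -> (forall x, `|f x| <= C) ->
  tame f.
Proof. by move=> mf fC; split => //; exists C, 0%N => x; rewrite expr0 mulr1. Qed.

Lemma tame_cst c : tame (fun=> c).
Proof. by apply: (@tame_bounded _ `|c|). Qed.

Lemma tameW : tame W.
Proof.
split => //; exists 1, 1%N => x.
by rewrite mul1r expr1 ger0_norm// (le_trans ler01).
Qed.

Lemma tame_le (f g : T -> R) : measurable_fun setT f -> tame g ->
  (forall x, `|f x| <= `|g x|) -> tame f.
Proof.
move=> mf [_ [C [k gC]]] fg; split => //; exists C, k => x.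
exact: le_trans (fg x) (gC x).
Qed.

Lemma tameD f g : tame f -> tame g -> tame (fun x => f x + g x).
Proof.
move=> tf tg; split; first by apply: measurable_funD; [case: tf | case: tg].
have [C [k [C0 fC]]] := tame_bound tf.
have [D [l [D0 gD]]] := tame_bound tg.
exists (C + D), (k + l)%N => x; have W1 := W_ge1 x.
rewrite (le_trans (ler_normD _ _))// mulrDl lerD//.
- by rewrite (le_trans (fC x))// ler_wpM2l// ler_weXn2l// leq_addr.
- by rewrite (le_trans (gD x))// ler_wpM2l// ler_weXn2l// leq_addl.
Qed.

Lemma tameM f g : tame f -> tame g -> tame (fun x => f x * g x).
Proof.
move=> tf tg; split; first by apply: measurable_funM; [case: tf | case: tg].
have [C [k [C0 fC]]] := tame_bound tf.
have [D [l [D0 gD]]] := tame_bound tg.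
exists (C * D), (k + l)%N => x.
by rewrite normrM exprD mulrACA ler_pM.
Qed.

Lemma tameN f : tame f -> tame (fun x => - f x).
Proof.
move=> [mf [C [k fC]]]; split; first exact: measurable_funN.
by exists C, k => x; rewrite normrN.
Qed.

Lemma tameB f g : tame f -> tame g -> tame (fun x => f x - g x).
Proof. by move=> tf tg; apply: tameD => //; apply: tameN. Qed.

Lemma tameX f n : tame f -> tame (fun x => f x ^+ n).
Proof.
move=> tf; elim: n => [|n IH].
  by rewrite (_ : (fun x => _) = fun=> 1) ?[LHS]funeqE//; exact: tame_cst.
rewrite (_ : (fun x => _) = fun x => f x * f x ^+ n); first exact: tameM.
by apply/funext => x; rewrite exprS.
Qed.

Lemma tame_norm f : tame f -> tame (fun x => `|f x|).
Proof.
move=> tf; apply: (tame_le _ tf) => [|x]; last by rewrite normr_id.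
by apply: measurableT_comp => //; case: tf.
Qed.

Lemma tame_sum (I : Type) (r : seq I) (f : I -> T -> R) :
  (forall i, tame (f i)) -> tame (fun x => \sum_(i <- r) f i x).
Proof.
move=> tf; elim: r => [|i r IH].
  rewrite (_ : (fun x => _) = fun=> 0); first exact: tame_cst.
  by apply/funext => x; rewrite big_nil.
rewrite (_ : (fun x => _) = fun x => f i x + \sum_(j <- r) f j x).
  exact: tameD.
by apply/funext => x; rewrite big_cons.
Qed.

Lemma tame_integrable f : tame f -> P.-integrable setT (EFin \o f).
Proof.
move=> tf; have [C [k [C0 fC]]] := tame_bound tf.
apply: (@le_integrable _ _ _ P setT measurableT _
  (fun x => (C * W x ^+ k)%:E)).
- by apply/measurable_EFinP; case: tf.
- move=> x _ /=; rewrite lee_fin (le_trans (fC x))//.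
  by rewrite (le_trans (ler_norm _)).
- exact: integrableZl (W_moments k).
Qed.

Lemma expectD f g : tame f -> tame g ->
  expect (fun x => f x + g x) = expect f + expect g.
Proof. by move=> tf tg; apply: RintegralD => //; exact: tame_integrable. Qed.

Lemma expectZ c f : tame f -> expect (fun x => c * f x) = c * expect f.
Proof. by move=> tf; apply: RintegralZl => //; exact: tame_integrable. Qed.

Lemma expectB f g : tame f -> tame g ->
  expect (fun x => f x - g x) = expect f - expect g.
Proof. by move=> tf tg; apply: RintegralB => //; exact: tame_integrable. Qed.

Lemma expect_cst c : expect (fun=> c) = c.
Proof.
rewrite /expect Rintegral_cst// -[RHS]mulr1; congr (_ * _).
by rewrite [X in fine X](@probability_setT _ _ _ P).
Qed.

Lemma expect_le f g : tame f -> tame g -> (forall x, f x <= g x) ->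
  expect f <= expect g.
Proof.
by move=> tf tg fg; apply: le_Rintegral => //; exact: tame_integrable.
Qed.

Lemma expect_ge0 (f : T -> R) : (forall x, 0 <= f x) -> 0 <= expect f.
Proof. by move=> f0; apply: Rintegral_ge0. Qed.

Lemma expect_norm f : tame f -> `|expect f| <= expect (fun x => `|f x|).
Proof. by move=> tf; apply: le_normr_Rintegral => //; exact: tame_integrable. Qed.

Lemma expectE f : tame f -> (\int[P]_x (f x)%:E)%E = (expect f)%:E.
Proof.
by move=> tf; rewrite fineK//; apply: integrable_fin_num => //;
  exact: tame_integrable.
Qed.

End tame.

(** * Exponential remainders and Bernstein approximation *)

Section exp_remainder.
Context {R : realType}.
Implicit Types t : R.

(** The Taylor remainder of [expR (- t)] of order [J], stripped of its
    alternating sign; with this recursion [expN_rem J.+1] is a primitive of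
    [expN_rem J]. *)
Fixpoint expN_rem (J : nat) t : R :=
  if J is J'.+1 then t ^+ J' / J'`!%:R - expN_rem J' t else expR (- t).

Lemma expN_remE J t :
  expR (- t) = \sum_(j < J) (- t) ^+ j / j`!%:R + (-1) ^+ J * expN_rem J t.
Proof.
elim: J => [|J IH]; first by rewrite big_ord0 add0r expr0 mul1r.
rewrite IH big_ord_recr/= [(- t) ^+ J]exprNn exprS; ring.
Qed.

Lemma is_derive_expN_rem J t : is_derive t 1 (expN_rem J.+1) (expN_rem J t).
Proof.
elim: J => [|J IH].
  have h : is_derive t 1 (fun y : R => expR (- y)) (- expR (- t)).
    have h1 : is_derive t 1 (fun y : R => - y) (-1) by apply: is_derive_eq.
    rewrite -mulrN1.
    exact: (@is_derive1_comp R expR (fun y => - y) t _ _ (is_derive_expR _) h1).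
  rewrite (_ : expN_rem 1 = fun y => 1 - expR (- y)); last first.
    by apply/funext => y /=; rewrite expr0 divr1.
  by apply: is_derive_eq; rewrite add0r mul1r opprK.
have hX : is_derive t 1 (fun y : R => y ^+ J.+1) (J.+1%:R * t ^+ J).
  have := derivableP (@exprn_derivable R J.+1 t 1).
  by rewrite exp_derive /GRing.scale/= mulr1.
rewrite (_ : expN_rem J.+2 =
    J.+1`!%:R^-1 \*: (fun y : R => y ^+ J.+1) - expN_rem J.+1); last first.
  by apply/funext => y; rewrite /= mulrC.
apply: is_derive_eq; rewrite /GRing.scale/= factS natrM.
by field; rewrite nat1r !pnatr_eq0 -lt0n fact_gt0.
Qed.

Lemma expN_rem0 J : expN_rem J.+1 0 = 0.
Proof.
elim: J => [|J IH]; first by rewrite /= expr0 divr1 oppr0 expR0 subrr.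
by rewrite -[LHS]/(0 ^+ J.+1 / _ - expN_rem J.+1 0) IH expr0n mul0r subr0.
Qed.

(** By induction, since a function that vanishes at 0 and has a nonnegative
    derivative is nonnegative on the right of 0. *)
Lemma expN_rem_ge0 J t : 0 <= t -> 0 <= expN_rem J t.
Proof.
elim: J t => [|J IH] t t0; first exact: expR_ge0.
have dr y : derivable (expN_rem J.+1) y 1 by case: (is_derive_expN_rem J y).
rewrite -(expN_rem0 J).
apply: (@ger0_derive1_le_cc _ _ 0 t) => //; rewrite ?in_itv/= ?lexx ?t0//.
- by move=> y; rewrite in_itv/= derive1E => /andP[y0 _];
    rewrite (@derive_val _ _ _ _ _ _ _ (is_derive_expN_rem J y)) IH// ltW.
- apply: continuous_subspaceT => y; apply: differentiable_continuous.
  by apply/derivable1_diffP.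
Qed.

Lemma expN_rem_le J t : 0 <= t -> expN_rem J t <= t ^+ J / J`!%:R.
Proof. by move=> t0; have := expN_rem_ge0 J.+1 t0; rewrite /= subr_ge0. Qed.

End exp_remainder.

Section bernstein.
Context {R : realType}.

(** Uniform continuity handles the points at distance less than some [d];
    for the others [(u - v)^2 / d^2 >= 1] absorbs the oscillation of [f]. A
    quadratic modulus is the form that a variance controls. *)
Lemma continuous_quadratic_modulus (f : R -> R) (e : R) : continuous f -> 0 < e ->
  exists2 C, 0 <= C & forall u v, u \in `[0, 1] -> v \in `[0, 1] ->
    `|f u - f v| <= e + C * (u - v) ^+ 2.
Proof.
move=> cf e0.
have cpt := @segment_compact R 0 1.
have near0 : \forall d \near (0 : R)^'+, `[0, 1] `<=`
    [set x | forall y, `|x - y| < d -> `|f x - f y| < e].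
  move: cpt => /compact_near_coveringP; apply => x _ /=.
  have /cvgrPdist_lt/(_ (e / 2)) := cf x.
  rewrite divr_gt0// => /(_ isT)[d /= d0 fd].
  exists (ball x (d / 2), [set t | t < d / 2]) => /=.
    split; first by apply: nbhsx_ballx; rewrite divr_gt0.
    by apply: nbhs_right_lt; rewrite divr_gt0.
  move=> [x' t] /= [xx' td] y x'y.
  have h1 : `|f x - f x'| < e / 2.
    by apply: fd; move: xx'; rewrite /ball/= => h; rewrite (lt_trans h)//; lra.
  have h2 : `|f x - f y| < e / 2.
    apply: fd; rewrite /ball_/= -(subrKA x') (le_lt_trans (ler_normD _ _))//.
    by move: xx' x'y td; rewrite /ball/=; lra.
  rewrite -(subrKA (f x)) (le_lt_trans (ler_normD _ _))//.
  by rewrite [`|f x' - f x|]distrC; lra.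
have [d [d0 unif]] : exists d, 0 < d /\ `[0, 1] `<=`
    [set x | forall y, `|x - y| < d -> `|f x - f y| < e].
  near (0 : R)^'+ => d; exists d; split; near: d; [exact: nbhs_right_gt|exact: near0].
have [M M0 fM] : exists2 M, 0 <= M & forall u, u \in `[0, 1] -> `|f u| <= M.
  have cw : {within `[0, 1], continuous f} by exact: continuous_subspaceT.
  have [a _ fa] := EVT_max ler01 cw.
  have [b _ fb] := EVT_min ler01 cw.
  exists (Num.max `|f a| `|f b|); first by rewrite le_max normr_ge0.
  move=> u u01; rewrite ler_norml; apply/andP; split.
    rewrite lerNl (le_trans _ (_ : `|f b| <= _))// ?le_max ?lexx ?orbT//.
    by rewrite -normrN (le_trans _ (ler_norm _))// lerN2 fb.
  by rewrite (le_trans (fa _ u01))// (le_trans (ler_norm _))// le_max lexx.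
exists (2 * M / d ^+ 2); first by rewrite divr_ge0 ?sqr_ge0// mulr_ge0.
move=> u v u01 v01; have [uv|uv] := ltP `|u - v| d.
  rewrite (@le_trans _ _ e)//; first by apply/ltW/unif => //; rewrite inE in u01 *.
  by rewrite lerDl mulr_ge0 ?sqr_ge0// divr_ge0 ?sqr_ge0// mulr_ge0.
rewrite (@le_trans _ _ (2 * M))//.
  by rewrite (le_trans (ler_normB _ _))// mulr_natl mulr2n lerD// fM.
rewrite (@le_trans _ _ (2 * M / d ^+ 2 * (u - v) ^+ 2))//; last by rewrite lerDr ltW.
rewrite -mulrA -[leLHS]mulr1 ler_wpM2l ?mulr_ge0//.
rewrite ler_pdivlMl ?exprn_gt0// mulr1 -[leRHS]real_normK ?num_real//.
by rewrite lerXn2r ?nnegrE// ltW.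
Unshelve. all: by end_near. Qed.

(** The mean of [g] under the binomial law with parameters [n] and [u], by
    conditioning on the first trial: [bern n (fun i => f (i / n)) u] is the
    Bernstein polynomial of [f]. In this form linearity, monotonicity and
    the variance are inductions without binomial coefficients. *)
Fixpoint bern (n : nat) (g : nat -> R) (u : R) : R :=
  if n is n'.+1 then u * bern n' (g \o S) u + (1 - u) * bern n' g u else g 0%N.

Variable u : R.
Hypothesis u01 : 0 <= u <= 1.

Lemma bern_cst n c : bern n (fun=> c) u = c.
Proof. by elim: n => //= n IH; rewrite IH; ring. Qed.

Lemma bernD n f g : bern n (fun i => f i + g i) u = bern n f u + bern n g u.
Proof.
elim: n f g => //= n IH f g.
by rewrite (IH (f \o S) (g \o S)) IH; ring.
Qed.

Lemma bernZ n c f : bern n (fun i => c * f i) u = c * bern n f u.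
Proof. by elim: n f => //= n IH f; rewrite (IH (f \o S)) IH; ring. Qed.

Lemma bern_le n f g : (forall i, (i <= n)%N -> f i <= g i) ->
  bern n f u <= bern n g u.
Proof.
have /andP[u0 u1] := u01.
elim: n f g => /= [|n IH] f g fg; first exact: fg.
apply: lerD; apply: ler_wpM2l; rewrite ?subr_ge0//; apply: IH => i ni.
  exact: (fg i.+1).
by apply: fg; rewrite leqW.
Qed.

(** The centre [c] is arbitrary because conditioning on the first trial
    moves it by one. *)
Lemma bern_variance n c : bern n (fun i => (i%:R - c) ^+ 2) u =
  n%:R * u * (1 - u) + (n%:R * u - c) ^+ 2.
Proof.
elim: n c => [|n IH] c /=; first by ring.
rewrite (_ : _ \o S = fun i => (i%:R - (c - 1)) ^+ 2); last first.
  by apply/funext => i /=; congr (_ ^+ 2); rewrite -natr1; ring.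
by rewrite !IH -natr1; ring.
Qed.

End bernstein.

(** Chebyshev's argument: by the quadratic modulus the error is at most [e
    / 2] plus [C / n^2] times the binomial variance, which is at most [n]. *)
Lemma bern_approx (R : realType) (f : R -> R) (e : R) : continuous f -> 0 < e ->
  exists n, forall u, 0 <= u <= 1 -> `|f u - bern n (fun i => f (i%:R / n%:R)) u| <= e.
Proof.
move=> cf e0.
have [C C0 fC] := continuous_quadratic_modulus cf (divr_gt0 e0 (ltr0n R 2)).
have [n [n0 nC]] : exists n : nat, (0 < n)%N /\ 2 * C / e <= n%:R.
  exists (Num.truncn (2 * C / e)).+1; split=> //.
  by rewrite ltW// truncnS_gt.
exists n => u u01; have n1 : 0 < n%:R :> R by rewrite ltr0n.
have bnd : bern n (fun i => e / 2 + C / n%:R ^+ 2 * (i%:R - n%:R * u) ^+ 2) u <= e.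
  rewrite bernD bern_cst bernZ bern_variance subrr expr0n addr0.
  have u1 : u * (1 - u) <= 1.
    by case/andP: u01 => *; have := sqr_ge0 u; lra.
  rewrite (_ : _ / _ * _ = C / n%:R * (u * (1 - u))); last first.
    by field; rewrite gt_eqF.
  have : C / n%:R * (u * (1 - u)) <= C / n%:R.
    by rewrite ler_piMr// divr_ge0.
  have : C / n%:R <= e / 2.
    by move: nC; rewrite !ler_pdivrMr//; lra.
  lra.
have bi i : (i <= n)%N -> `|f u - f (i%:R / n%:R)| <=
    e / 2 + C / n%:R ^+ 2 * (i%:R - n%:R * u) ^+ 2.
  move=> ni; apply: (le_trans (fC _ _ _ _)).
  - by rewrite in_itv/=.
  - by rewrite in_itv/= divr_ge0//= ler_pdivrMr// mul1r ler_nat.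
  - rewrite lerD2l (_ : C / _ * _ = C * (u - i%:R / n%:R) ^+ 2)//.
    by field; rewrite gt_eqF.
rewrite ler_norml; apply/andP; split.
  rewrite lerNl opprB lerBlDr (le_trans _ (lerD bnd (lexx _)))//.
  rewrite -[f u in leRHS](bern_cst u n) -bernD; apply: (bern_le u01) => i /bi.
  by rewrite ler_norml; lra.
rewrite lerBlDr (le_trans _ (lerD bnd (lexx _)))//.
rewrite -bernD -[f u](bern_cst u n); apply: (bern_le u01) => i /bi.
by rewrite ler_norml; lra.
Qed.

(** * A method of moments on the real line *)

Section method_of_moments.
Context {R : realType}.
Variables (mu : nat -> probability R R) (nu : probability R R).

Definition abs_weight (x : R) : R := 1 + `|x|.
Local Notation W := abs_weight.
Definition pos_part (x : R) : R := Num.max x 0.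
Definition neg_part (x : R) : R := Num.max (- x) 0.
Local Notation pos := pos_part.
Local Notation neg := neg_part.

Hypothesis mu_int : forall n k,
  (mu n).-integrable setT (EFin \o (fun x => W x ^+ k)).
Hypothesis nu_int : forall k, nu.-integrable setT (EFin \o (fun x => W x ^+ k)).

Local Notation cvgE f := (expect (mu n) f @[n --> \oo] --> expect nu f).

Lemma abs_weight_ge1 x : 1 <= W x. Proof. by rewrite lerDl. Qed.
Local Notation W1 := abs_weight_ge1.
Let W0 x : 0 <= W x. Proof. exact: le_trans (W1 x). Qed.

Lemma pos_ge0 x : 0 <= pos x. Proof. by rewrite le_max lexx orbT. Qed.
Lemma neg_ge0 x : 0 <= neg x. Proof. by rewrite le_max lexx orbT. Qed.

Lemma continuous_pos : continuous pos.
Proof. by move=> x; apply: continuous_max => //; exact: cvg_cst. Qed.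

Lemma continuous_neg : continuous neg.
Proof.
move=> x; apply: continuous_max; first exact: continuousN.
exact: cvg_cst.
Qed.

Lemma tame_continuous f C k : continuous f -> (forall x, `|f x| <= C * W x ^+ k) ->
  tame W f.
Proof.
by move=> cf fC; split; [exact: continuous_measurable_fun|exists C, k].
Qed.

Lemma tame_pos : tame W pos.
Proof.
apply: (@tame_continuous _ 1 1%N continuous_pos) => x.
rewrite mul1r expr1 ger0_norm ?pos_ge0// ge_max (W0 x) andbT /W.
by rewrite (le_trans (ler_norm x))// lerDr.
Qed.

Lemma tame_neg : tame W neg.
Proof.
apply: (@tame_continuous _ 1 1%N continuous_neg) => x.
rewrite mul1r expr1 ger0_norm ?neg_ge0// ge_max (W0 x) andbT /W.
by rewrite -normrN (le_trans (ler_norm (- x)))// lerDr.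
Qed.

Lemma tame_posX k : tame W (fun x => pos x ^+ k).
Proof. exact: (tameX W1 k tame_pos). Qed.

Lemma cvgED f g : tame W f -> tame W g -> cvgE f -> cvgE g ->
  cvgE (fun x => f x + g x).
Proof.
move=> tf tg cf cg; rewrite (expectD W1 nu_int)//.
under eq_fun do rewrite (expectD W1 (mu_int _))//.
exact: cvgD.
Qed.

Lemma cvgEZ c f : tame W f -> cvgE f -> cvgE (fun x => c * f x).
Proof.
move=> tf cf; rewrite (expectZ W1 nu_int)//.
under eq_fun do rewrite (expectZ W1 (mu_int _))//.
exact: cvgMr.
Qed.

Lemma cvgE_sum n (f : nat -> R -> R) : (forall i, tame W (f i)) ->
  (forall i, cvgE (f i)) -> cvgE (fun x => \sum_(i < n) f i x).
Proof.
move=> tf cf; elim: n => [|n IH].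
  have e0 : (fun x => \sum_(i < 0) f i x) = fun=> 0.
    by apply/funext => x; rewrite big_ord0.
  by rewrite e0 expect_cst; under eq_fun do rewrite expect_cst; exact: cvg_cst.
have eqS : (fun x => \sum_(i < n.+1) f i x) = fun x => \sum_(i < n) f i x + f n x.
  by apply/funext => x; rewrite big_ord_recr.
rewrite eqS; apply: cvgED => //.
exact: (tame_sum W1 (index_enum 'I_n) (fun i => tf i)).
Qed.

(** The three epsilon argument: exchanging [f] for [g] costs at most [e]
    under [nu] and, for large [n], under [mu n]. *)
Lemma cvgE_approx f : tame W f ->
  (forall e, 0 < e -> exists g, [/\ tame W g, cvgE g,
     expect nu (fun x => `|f x - g x|) <= e &
     \forall n \near \oo, expect (mu n) (fun x => `|f x - g x|) <= e]) ->
  cvgE f.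
Proof.
move=> tf approx; apply/cvgrPdist_le => e e0.
have [g [tg cg nug mug]] := approx (e / 3) (divr_gt0 e0 (ltr0n R 3)).
have e30 : 0 < e / 3 by rewrite divr_gt0.
have /cvgrPdist_le/(_ _ e30) cg' := cg.
have dist (P : probability R R) :
    (forall k, P.-integrable setT (EFin \o (fun x => W x ^+ k))) ->
    `|expect P f - expect P g| <= expect P (fun x => `|f x - g x|).
  move=> iP; rewrite -(expectB W1 iP)//; apply: (expect_norm W1 iP).
  exact: (tameB W1).
apply: filterS2 mug cg' => n h1 h2.
have d1 := dist _ (mu_int n); have d2 := dist _ nu_int.
rewrite -(subrKA (expect nu g)) (le_trans (ler_normD _ _))//.
rewrite -[X in _ + `|X|](subrKA (expect (mu n) g)).
have := ler_normD (expect nu g - expect (mu n) g) (expect (mu n) g - expect (mu n) f).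
rewrite [`|expect (mu n) g - _|]distrC; lra.
Qed.

Hypothesis cvg_pos : forall k, cvgE (fun x => pos x ^+ k).
Variable d : R.
Hypothesis d_gt0 : 0 < d.
(* The Taylor series at 0 of the Laplace transform of the positive part
   under [nu] converges at distance [d]; this is what makes the moments
   determine the law. *)
Hypothesis pos_growth : forall k,
  expect nu (fun x => pos x ^+ (k + J)) * (d ^+ J / J`!%:R) @[J --> \oo] --> 0.

(** These functions interpolate between the powers ([th = 0]), whose
    expectations are known to converge, and the powers of [expR (- (d * pos
    x))], which generate the continuous functions on a compact interval. *)
Definition damped (th : R) k x := pos x ^+ k * expR (- (th * pos x)).

Lemma continuous_damped th k : continuous (damped th k).
Proof.
move=> x; rewrite /damped; apply: cvgM.
  apply: (@continuous_comp _ _ _ pos (fun y => y ^+ k)); first exact: continuous_pos.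
  exact: exprn_continuous.
apply: (@continuous_comp _ _ _ (fun y => - (th * pos y)) expR).
  by apply: cvgN; apply: cvgMr; exact: continuous_pos.
exact: continuous_expR.
Qed.

Lemma damped_le th k x : 0 <= th -> 0 <= damped th k x <= pos x ^+ k.
Proof.
move=> th0; have p0 := pos_ge0 x.
rewrite /damped mulr_ge0 ?exprn_ge0 ?expR_ge0//= ler_piMr ?exprn_ge0//.
by rewrite -expR0 ler_expR oppr_le0 mulr_ge0.
Qed.

Lemma tame_damped th k : 0 <= th -> tame W (damped th k).
Proof.
move=> th0; have mf := continuous_measurable_fun (@continuous_damped th k).
apply: (tame_le mf (tame_posX k)) => x; have /andP[h0 h1] := damped_le k x th0.
by rewrite !ger0_norm// exprn_ge0 ?pos_ge0.
Qed.

(** Raising the damping from [n d] to [(n + 1) d] multiplies by [expR (- (d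
    * pos x))]. Its Taylor polynomials involve powers damped by [n d] only,
    and the remainder is at most a moment times [d ^+ J / J`!], which is
    small under [nu] by the growth condition and therefore under [mu n] for
    large [n]. Steps of the fixed length [d] reach every damping, though
    the Taylor series at 0 may diverge far from 0. *)
Lemma cvg_damped n k : cvgE (damped (n%:R * d) k).
Proof.
elim: n k => [|n IH] k.
  rewrite (_ : damped _ k = fun x => pos x ^+ k)//.
  by apply/funext => x; rewrite /damped !mul0r oppr0 expR0 mulr1.
have th0 : 0 <= n%:R * d by rewrite mulr_ge0// ltW.
have th1 : 0 <= n.+1%:R * d by rewrite mulr_ge0// ltW.
apply: cvgE_approx; first exact: tame_damped.
move=> e e0.
pose c j : R := (- d) ^+ j / j`!%:R.
pose g J x := \sum_(j < J) c j * damped (n%:R * d) (k + j) x.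
have tc j : tame W (fun x => c j * damped (n%:R * d) (k + j) x).
  by apply: (tameM W1); [exact: tame_cst|exact: tame_damped].
have tg J : tame W (g J).
  exact: (tame_sum W1 (index_enum 'I_J) (fun j : 'I_J => tc j)).
have cg J : cvgE (g J).
  apply: (@cvgE_sum J (fun j x => c j * damped (n%:R * d) (k + j) x)) => // j.
  by apply: cvgEZ; [exact: tame_damped|exact: IH].
have diff J x : `|damped (n.+1%:R * d) k x - g J x| <=
    pos x ^+ (k + J) * (d ^+ J / J`!%:R).
  have p0 := pos_ge0 x.
  have dp0 : 0 <= d * pos x by rewrite mulr_ge0// ltW.
  have -> : damped (n.+1%:R * d) k x - g J x =
      damped (n%:R * d) k x * ((-1) ^+ J * expN_rem J (d * pos x)).
    have gE : g J x = damped (n%:R * d) k x *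
        \sum_(j < J) (- (d * pos x)) ^+ j / j`!%:R.
      rewrite mulr_sumr; apply: eq_bigr => j _.
      have -> : (- (d * pos x)) ^+ j = (- d) ^+ j * pos x ^+ j.
        by rewrite -mulNr exprMn.
      by rewrite /damped /c exprD; ring.
    have -> : damped (n.+1%:R * d) k x =
        damped (n%:R * d) k x * expR (- (d * pos x)).
      by rewrite /damped -natr1 mulrDl mul1r mulrDl opprD expRD mulrA.
    by rewrite gE (expN_remE J); ring.
  rewrite normrM normrMsign ger0_norm; last by have /andP[] := damped_le k x th0.
  rewrite ger0_norm ?expN_rem_ge0//.
  apply: (@le_trans _ _ (pos x ^+ k * ((d * pos x) ^+ J / J`!%:R))).
    rewrite ler_pM ?expN_rem_ge0 ?expN_rem_le//; by have /andP[] := damped_le k x th0.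
  by rewrite exprMn exprD le_eqVlt; apply/orP; left; apply/eqP; ring.
have [J nuJ] : exists J, expect nu (fun x => pos x ^+ (k + J)) * (d ^+ J / J`!%:R) < e.
  have /cvgrPdist_lt/(_ _ e0)[J _ /(_ _ (leqnn J))] := pos_growth k.
  rewrite sub0r normrN => h; exists J; exact: le_lt_trans (ler_norm _) h.
exists (g J); split => //.
- rewrite (le_trans _ (ltW nuJ))// [leRHS]mulrC -(expectZ W1 nu_int); last exact: tame_posX.
  apply: (expect_le W1 nu_int).
  + by apply: (tame_norm); apply: (tameB W1) => //; exact: tame_damped.
  + by apply: (tameM W1); [exact: tame_cst|exact: tame_posX].
  + by move=> x; rewrite [leRHS]mulrC diff.
- have : expect (mu m) (fun x => pos x ^+ (k + J)) * (d ^+ J / J`!%:R)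
      @[m --> \oo] --> expect nu (fun x => pos x ^+ (k + J)) * (d ^+ J / J`!%:R).
    by apply: cvgMl.
  move=> /cvgr_lt/(_ _ nuJ); apply: filterS => m mJ.
  rewrite (le_trans _ (ltW mJ))// [leRHS]mulrC -(expectZ W1 (mu_int m)); last exact: tame_posX.
  apply: (expect_le W1 (mu_int m)).
  + by apply: (tame_norm); apply: (tameB W1) => //; exact: tame_damped.
  + by apply: (tameM W1); [exact: tame_cst|exact: tame_posX].
  + by move=> x; rewrite [leRHS]mulrC diff.
Qed.

Let u x := expR (- (d * pos x)).

Let u_itv x : 0 <= u x <= 1.
Proof.
rewrite expR_ge0/= -expR0 ler_expR oppr_le0.
by rewrite mulr_ge0 ?pos_ge0// ltW.
Qed.

Let uX a x : u x ^+ a = damped (a%:R * d) 0 x.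
Proof. by rewrite /damped expr0 mul1r /u -expRM_natl -mulrA mulrN. Qed.

Let tame_uX a : tame W (fun x => u x ^+ a).
Proof.
rewrite (_ : (fun x => _) = damped (a%:R * d) 0); last exact/funext/uX.
by apply: tame_damped; rewrite mulr_ge0// ltW.
Qed.

Let tame_u : tame W u.
Proof. by have := tame_uX 1; under eq_fun do rewrite expr1. Qed.

Lemma tame_bern n g : tame W (fun x => bern n g (u x)).
Proof.
elim: n g => [|n IH] g /=; first exact: tame_cst.
apply: (tameD W1); apply: (tameM W1) => //.
by apply: (tameB W1) => //; exact: tame_cst.
Qed.

(** A polynomial in [u x] is a combination of damped powers; the factor [u
    x ^+ a] lets the induction follow the recursion of [bern]. *)
Lemma cvg_bern n g a : cvgE (fun x => u x ^+ a * bern n g (u x)).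
Proof.
elim: n g a => [|n IH] g a.
  rewrite (_ : (fun x => _) = fun x => g 0%N * damped (a%:R * d) 0 x).
    by apply: cvgEZ; [apply: tame_damped; rewrite mulr_ge0// ltW|exact: cvg_damped].
  by apply/funext => x; rewrite /= uX mulrC.
pose B f b x := u x ^+ b * bern n f (u x).
have tB f b : tame W (B f b) by apply: (tameM W1) => //; exact: tame_bern.
have -> : (fun x => u x ^+ a * bern n.+1 g (u x)) =
    fun x => (B (g \o S) a.+1 x + B g a x) + (- 1) * B g a.+1 x.
  by apply/funext => x; rewrite /B /= exprS; ring.
apply: cvgED; [by apply: (tameD W1)| |by apply: cvgED; do ?exact: IH|].
- by apply: (tameM W1) => //; exact: tame_cst.
- by apply: cvgEZ => //; exact: IH.
Qed.

Let expect_bound (P : probability R R) (f : R -> R) (e : R) :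
  (forall k, P.-integrable setT (EFin \o (fun x => W x ^+ k))) ->
  tame W f -> (forall x, f x <= e) -> expect P f <= e.
Proof.
move=> iP tf fe; rewrite -[leRHS](expect_cst P e).
by apply: (expect_le W1 iP) => //; exact: tame_cst.
Qed.

(** A function of [pos x] that vanishes beyond [M] is a continuous function
    [psi] of [u x], which lies in [0, 1]; Bernstein polynomials in [u x]
    approximate it uniformly. *)
Lemma cvg_compact_support (F : R -> R) M : continuous F -> 0 <= M ->
  (forall x, M <= x -> F x = 0) -> tame W (F \o pos) -> cvgE (F \o pos).
Proof.
move=> cF M0 FM tF; pose v0 := expR (- (d * M)).
have v00 : 0 < v0 by exact: expR_gt0.
(* below [v0] the logarithm is frozen: this only concerns points beyond
   [M], where [F] vanishes *)
pose psi v := F (- d^-1 * ln (Num.max v v0)).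
have cpsi : continuous psi.
  move=> v; apply: (@continuous_comp _ _ _ (fun v => - d^-1 * ln (Num.max v v0)) F);
    last exact: cF.
  apply: cvgMr; apply: (@continuous_comp _ _ _ (fun v => Num.max v v0) (@ln R)).
    by apply: continuous_max => //; exact: cvg_cst.
  by apply: continuous_ln; rewrite lt_max v00 orbT.
have psiE x : F (pos x) = psi (u x).
  have p0 := pos_ge0 x; have dn0 : d != 0 by rewrite gt_eqF.
  rewrite /psi; case: (leP (pos x) M) => [pM|Mp].
    rewrite (max_idPl _) ?ler_expR ?lerN2 ?ler_pM2l// expRK.
    by congr F; rewrite mulrNN mulKf.
  rewrite (max_idPr _); last by rewrite ler_expR lerN2 ler_pM2l// ltW.
  by rewrite expRK mulrNN mulKf// !FM// ltW.
apply: (cvgE_approx tF) => e e0; have [n nP] := bern_approx cpsi e0.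
pose g x := bern n (fun i => psi (i%:R / n%:R)) (u x).
have tg : tame W g by exact: tame_bern.
have tdiff : tame W (fun x => `|(F \o pos) x - g x|).
  by apply: tame_norm; exact: (tameB W1).
have diff x : `|(F \o pos) x - g x| <= e by rewrite /= psiE nP.
exists g; split => //.
- have := @cvg_bern n (fun i => psi (i%:R / n%:R)) 0.
  by under [X in expect _ X]eq_fun do rewrite expr0 mul1r;
     under [X in X @ _ --> _]eq_fun do (under [X in expect _ X]eq_fun do rewrite expr0 mul1r).
- exact: expect_bound.
- by apply: nearW => m; exact: expect_bound.
Qed.

Lemma cvg_pos_weight k j : cvgE (fun x => (1 + pos x) ^+ k * pos x ^+ j).
Proof.
have t a b : tame W (fun x => (1 + pos x) ^+ a * pos x ^+ b).
  apply: (tameM W1); last exact: tame_posX.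
  by apply: (tameX W1); apply: (tameD W1); [exact: tame_cst|exact: tame_pos].
elim: k j => [|k IH] j.
  rewrite (_ : (fun x => _) = fun x => pos x ^+ j)//.
  by apply/funext => x; rewrite expr0 mul1r.
rewrite (_ : (fun x => _) = fun x => (1 + pos x) ^+ k * pos x ^+ j +
    (1 + pos x) ^+ k * pos x ^+ j.+1); first exact: cvgED.
by apply/funext => x; rewrite !exprS; ring.
Qed.

Let continuous_cutoff M : continuous (fun x : R => pos (Num.min 1 (M + 1 - x))).
Proof.
move=> x; apply: (@continuous_comp _ _ _ (fun x => Num.min 1 (M + 1 - x)) pos);
  last exact: continuous_pos.
apply: continuous_min; first exact: cvg_cst.
by apply: cvgB => //; exact: cvg_cst.
Qed.

(** Cut [f] off beyond a level [M]. By Markov's inequality the error is at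
    most [1 / M] times the expectation of a polynomial in [pos x], which
    converges and hence stays bounded. *)
Lemma cvg_pos_continuous (f : R -> R) C k : continuous f ->
  (forall x, `|f x| <= C * W x ^+ k) -> cvgE (f \o pos).
Proof.
move=> cf fC.
have fpos x : `|f (pos x)| <= C * (1 + pos x) ^+ k.
  by rewrite (le_trans (fC _))// /W ger0_norm// pos_ge0.
have tpw : tame W (fun x => (1 + pos x) ^+ k).
  by apply: (tameX W1); apply: (tameD W1); [exact: tame_cst|exact: tame_pos].
have tCpw : tame W (fun x => C * (1 + pos x) ^+ k).
  by apply: (tameM W1) => //; exact: tame_cst.
have tfp (h : R -> R) : continuous h -> (forall x, `|h x| <= `|f x|) ->
    tame W (h \o pos).
  move=> ch hf; have mh : measurable_fun setT (h \o pos).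
    apply: continuous_measurable_fun => x.
    by apply: continuous_comp; [exact: continuous_pos|exact: ch].
  apply: (tame_le mh tCpw) => x.
  by rewrite (le_trans (hf _))// (le_trans (fpos x))// ler_norm.
have tf := tfp f cf (fun x => lexx _).
apply: (cvgE_approx tf) => e e0.
have C0 : 0 <= C.
  have := fC 0; rewrite /W normr0 addr0 expr1n mulr1.
  exact: le_trans.
pose K x := C * ((1 + pos x) ^+ k * pos x ^+ 1).
have tK0 : tame W (fun x => (1 + pos x) ^+ k * pos x ^+ 1).
  by apply: (tameM W1) => //; exact: tame_posX.
have tK : tame W K by apply: (tameM W1) => //; exact: tame_cst.
have cK : cvgE K by apply: cvgEZ => //; exact: cvg_pos_weight.
have K0 x : 0 <= K x.
  by rewrite mulr_ge0// mulr_ge0// exprn_ge0// ?addr_ge0// pos_ge0.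
pose M := expect nu K / e + 1.
have eK0 : 0 <= expect nu K by exact: expect_ge0.
have M0 : 0 < M by rewrite ltr_wpDl// divr_ge0// ltW.
have KM : expect nu K < e * M.
  by rewrite /M mulrDr mulr1 mulrC divfK ?gt_eqF// ltrDl.
pose F x := f x * pos (Num.min 1 (M + 1 - x)).
have chi01 x : 0 <= pos (Num.min 1 (M + 1 - x)) <= 1.
  by rewrite pos_ge0/= ge_max ler01 andbT ge_min lexx.
have cF : continuous F by move=> x; apply: cvgM; [exact: cf|exact: continuous_cutoff].
have Ff x : `|F x| <= `|f x|.
  have /andP[c0 c1] := chi01 x.
  by rewrite normrM [X in _ * X]ger0_norm// ler_piMr.
have tF := tfp F cF Ff.
have tdiff : tame W (fun x => `|(f \o pos) x - (F \o pos) x|).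
  by apply: tame_norm; exact: (tameB W1).
have diff x : `|(f \o pos) x - (F \o pos) x| <= M^-1 * K x.
  have p0 := pos_ge0 x.
  rewrite /= /F -{1}[f (pos x)]mulr1 -mulrBr normrM.
  case: (leP (pos x) M) => [pM|Mp].
    rewrite (_ : pos (Num.min _ _) = 1) ?subrr ?normr0 ?mulr0.
      by rewrite mulr_ge0// invr_ge0 ltW.
    rewrite (min_idPl _); last by lra.
    by rewrite /pos_part (max_idPl _).
  have /andP[c0 c1] := chi01 (pos x).
  rewrite (@le_trans _ _ `|f (pos x)|)//.
    by rewrite ler_piMr// ger0_norm ?subr_ge0// gerBl.
  rewrite (le_trans (fpos x))// /K expr1.
  rewrite (_ : M^-1 * _ = C * (1 + pos x) ^+ k * (M^-1 * pos x)); last by ring.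
  rewrite -[leLHS]mulr1 ler_wpM2l ?mulr_ge0 ?exprn_ge0 ?addr_ge0//.
  by rewrite ler_pdivlMl// mulr1 ltW.
have tMK : tame W (fun x => M^-1 * K x) by apply: (tameM W1) => //; exact: tame_cst.
exists (F \o pos); split => //.
- apply: (@cvg_compact_support F (M + 1)) => //; first by rewrite addr_ge0// ltW.
  move=> x Mx; rewrite /F (_ : pos _ = 0) ?mulr0//.
  by rewrite /pos_part (max_idPr _)// ge_min subr_le0 Mx orbT.
- rewrite (le_trans (expect_le W1 nu_int tdiff tMK diff))//.
  by rewrite (expectZ W1 nu_int)// ler_pdivrMl// mulrC ltW.
- move/cvgr_lt : cK => /(_ _ KM); apply: filterS => n nK.
  rewrite (le_trans (expect_le W1 (mu_int n) tdiff tMK diff))//.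
  by rewrite (expectZ W1 (mu_int n))// ler_pdivrMl// mulrC ltW.
Qed.

Hypothesis cvg_neg : forall k,
  expect (mu n) (fun x => neg x ^+ k.+1) @[n --> \oo] --> 0.
Hypothesis nu_neg : forall k, expect nu (fun x => neg x ^+ k.+1) = 0.

(** Since every moment of the negative part vanishes in the limit, [f x]
    may be exchanged for [f (pos x)]: close to 0 by continuity of [f] at 0,
    and at negative [x] away from 0 because a multiple of a power of [neg
    x] dominates the growth bound. *)
Lemma moments_cvg (f : R -> R) C k : continuous f ->
  (forall x, `|f x| <= C * W x ^+ k) -> cvgE f.
Proof.
move=> cf fC; have tf : tame W f by exact: tame_continuous fC.
apply: (cvgE_approx tf) => e e0.
have C0 : 0 <= C.
  have := fC 0; rewrite /W normr0 addr0 expr1n mulr1.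
  exact: le_trans.
have /cvgrPdist_le/(_ (e / 2)) := cf 0.
rewrite divr_gt0// => /(_ isT)[t /= t0 ft].
pose D := 2 * C * (t^-1 + 1) ^+ k / t.
have D0 : 0 <= D.
  rewrite divr_ge0 ?(ltW t0)// mulr_ge0 ?mulr_ge0// exprn_ge0// addr_ge0//.
  by rewrite invr_ge0 ltW.
have diff x : `|f x - f (pos x)| <= e / 2 + D * neg x ^+ k.+1.
  have n0 := neg_ge0 x; have e20 : 0 <= e / 2 by rewrite divr_ge0// ltW.
  have rhs0 : 0 <= D * neg x ^+ k.+1 by rewrite mulr_ge0// exprn_ge0.
  case: (leP 0 x) => [x0|x0].
    by rewrite /pos_part (max_idPl x0) subrr normr0 addr_ge0.
  rewrite /pos_part (max_idPr (ltW x0)).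
  have nx : neg x = - x by rewrite /neg_part (max_idPl _)// oppr_ge0 ltW.
  have absx : `|x| = - x by rewrite ltr0_norm.
  case: (ltP (- x) t) => [xt|tx].
    rewrite distrC (le_trans (ft x _)) ?lerDl//.
    by rewrite /ball_/= sub0r normrN absx.
  have h1 : `|f x - f 0| <= 2 * (C * W x ^+ k).
    rewrite (le_trans (ler_normB _ _))// mulr_natl mulr2n lerD//.
    rewrite (le_trans (fC 0))// ler_wpM2l// lerXn2r ?nnegrE//.
    by rewrite /W normr0 lerD2l.
  rewrite (le_trans h1)// -[leLHS]add0r lerD// nx /D.
  have x1 : 1 <= t^-1 * - x by rewrite ler_pdivlMl// mulr1.
  have Wx : W x <= (t^-1 + 1) * - x by rewrite /W absx mulrDl mul1r lerD2r.
  have -> : 2 * C * (t^-1 + 1) ^+ k / t * (- x) ^+ k.+1 =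
      2 * (C * ((t^-1 + 1) * - x) ^+ k) * (t^-1 * - x).
    by rewrite exprSr exprMn; move: ((- x) ^+ k) ((t^-1 + 1) ^+ k) => a b; ring.
  rewrite -[leLHS]mulr1 ler_pM// ?mulr_ge0 ?exprn_ge0//.
  by rewrite ler_wpM2l// ler_wpM2l// lerXn2r ?nnegrE// (le_trans (W0 x)).
have tn : tame W (fun x => neg x ^+ k.+1) by exact: (tameX W1 k.+1 tame_neg).
have tDn : tame W (fun x => D * neg x ^+ k.+1).
  by apply: (tameM W1) => //; exact: tame_cst.
have tb : tame W (fun x => e / 2 + D * neg x ^+ k.+1).
  by apply: (tameD W1) => //; exact: tame_cst.
have tfp : tame W (f \o pos).
  have cfp : continuous (f \o pos).
    by move=> x; apply: continuous_comp; [exact: continuous_pos|exact: cf].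
  apply: (@tame_continuous _ C k cfp) => x; rewrite (le_trans (fC _))//.
  rewrite ler_wpM2l// lerXn2r ?nnegrE// /W lerD2l ger0_norm ?pos_ge0//.
  by rewrite ge_max ler_norm normr_ge0.
have tdiff : tame W (fun x => `|f x - (f \o pos) x|).
  by apply: tame_norm; exact: (tameB W1).
have Eb (P : probability R R) :
    (forall k, P.-integrable setT (EFin \o (fun x => W x ^+ k))) ->
    expect P (fun x => e / 2 + D * neg x ^+ k.+1) =
    e / 2 + D * expect P (fun x => neg x ^+ k.+1).
  move=> iP; rewrite (expectD W1 iP)//; last exact: tame_cst.
  by rewrite expect_cst (expectZ W1 iP).
exists (f \o pos); split => //.
- exact: cvg_pos_continuous fC.
- rewrite (le_trans (expect_le W1 nu_int tdiff tb diff))// Eb// nu_neg mulr0.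
  by rewrite addr0; lra.
- have : D * expect (mu n) (fun x => neg x ^+ k.+1) @[n --> \oo] --> D * 0.
    exact: cvgMr.
  rewrite mulr0 => /cvgr_le/(_ (e / 2) (divr_gt0 e0 (ltr0n R 2))).
  apply: filterS => n h.
  rewrite (le_trans (expect_le W1 (mu_int n) tdiff tb diff))// Eb//.
  by lra.
Qed.

End method_of_moments.

(** * Integration against a density, and the Gamma integral *)

Section density.
Context d (T : measurableType d) (R : realType).
Variables (nu : {finite_measure set T -> \bar R})
  (mu : {sigma_finite_measure set T -> \bar R}) (h : T -> R).
Hypothesis mh : measurable_fun setT h.
Hypothesis nuE : forall A, measurable A -> nu A = (\int[mu]_(x in A) (h x)%:E)%E.

(** The density agrees almost everywhere with the Radon-Nikodym derivative,
    for which the change of measure is known. *)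
Lemma ge0_integral_density (f : T -> R) :
  (forall x, 0 <= f x) -> measurable_fun setT f ->
  (\int[nu]_x (f x)%:E = \int[mu]_x (f x * h x)%:E)%E.
Proof.
move=> f0 mf.
have mhE A : measurable_fun A (fun x => (h x)%:E).
  by apply/measurable_funTS/measurable_EFinP.
have dom : nu `<< mu.
  apply/null_content_dominatesP => A mA A0; rewrite nuE//.
  exact: null_set_integral.
have f0' x : (0 <= (EFin \o f) x)%E by rewrite lee_fin.
have mf' : measurable_fun setT (EFin \o f) by exact/measurable_EFinP.
have cov := Radon_Nikodym_SigmaFinite.change_of_variables dom f0' measurableT mf'.
rewrite -[LHS]cov.
have irn := Radon_Nikodym_SigmaFinite.f_integrable dom.
apply: ae_eq_integral => //.
- apply: emeasurable_funM; first exact/measurable_EFinP.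
  exact: measurable_int irn.
- by apply/measurable_EFinP; exact: measurable_funM.
- have : ae_eq mu setT (Radon_Nikodym_SigmaFinite.f nu mu) (fun x => (h x)%:E).
    apply: integral_ae_eq => // E _ mE.
    by rewrite -Radon_Nikodym_SigmaFinite.f_integral// nuE.
  by apply: filterS => x + _ => /(_ I) ->; rewrite EFinM.
Qed.

End density.

Section gamma_function.
Context {R : realType}.
Notation mu := (@lebesgue_measure R).

(** Only the point 0 is delicate: there [x `^ p] tends to 0 from the right
    because [p > 0]. *)
Lemma continuous_pos_powR (p : R) : 0 < p -> continuous (fun x : R => pos_part x `^ p).
Proof.
move=> p0 x; have [x0|x0|->] := ltgtP x 0.
- rewrite /continuous_at (_ : pos_part x `^ p = 0); last first.
    by rewrite /pos_part (max_idPr (ltW x0)) powR0// gt_eqF.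
  apply: cvg_near_cst; near=> y; rewrite /pos_part (max_idPr _) ?powR0 ?gt_eqF//.
  by apply: ltW; near: y; exact: lt_nbhsl.
- rewrite /continuous_at (_ : pos_part x = x); last by rewrite /pos_part (max_idPl (ltW x0)).
  have c : {for x, continuous (fun y : R => y `^ p)}.
    apply: differentiable_continuous; apply/derivable1_diffP.
    by apply: derivable_powR; rewrite in_itv/= x0.
  apply: cvg_trans c; apply: near_eq_cvg; near=> y.
  rewrite /pos_part (max_idPl _)//.
  by apply: ltW; near: y; exact: lt_nbhsr.
- apply/left_right_continuousP; rewrite [pos_part 0](_ : _ = 0); last first.
    by rewrite /pos_part max_r.
  rewrite powR0 ?gt_eqF//; split.
    apply: cvg_near_cst; near=> y; rewrite /pos_part (max_idPr _) ?powR0 ?gt_eqF//.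
  apply: cvg_trans (powR_cvg0 p0); apply: near_eq_cvg; near=> y.
  by rewrite /pos_part (max_idPl _)//.
Unshelve. all: by end_near. Qed.

Lemma cvg_exprn_expRN n : (x : R) ^+ n * expR (- x) @[x --> +oo] --> (0 : R).
Proof.
have lim2 : (n`!%:R * 2 ^+ n) * expR (- (2^-1 * x)) @[x --> +oo] --> (0 : R).
  rewrite -[X in _ --> X](mulr0 (n`!%:R * 2 ^+ n)).
  apply: cvgMr; apply: (@cvg_comp _ _ _ (fun x => 2^-1 * x)
    (fun x => expR (- x)) _ (pinfty_nbhs R)); last exact: cvgr_expR.
  exact: gt0_cvgMry.
apply: (squeeze_cvgr _ (cvg_cst 0) lim2); near=> x.
have x0 : 0 <= x by near: x; apply: nbhs_pinfty_ge; rewrite num_real.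
rewrite mulr_ge0 ?exprn_ge0 ?expR_ge0//=.
have -> : expR (- x) = expR (- (2^-1 * x)) * expR (- (2^-1 * x)).
  by rewrite -expRD; congr expR; field.
rewrite mulrA ler_wpM2r ?expR_ge0//.
rewrite expRN ler_pdivrMr ?expR_gt0//.
case: (n) => [|k].
  by rewrite expr0 fact0 expr0 !mul1r -expR0 ler_expR mulr_ge0.
have := @expR_ge1Dxn R (2^-1 * x) k (mulr_ge0 (ltW _) x0).
rewrite invr_gt0 => /(_ (ltr0n R 2)) h.
have : (2^-1 * x) ^+ k.+1 / k.+1`!%:R <= expR (2^-1 * x).
  by apply: le_trans h; rewrite lerDr.
rewrite ler_pdivrMr ?ltr0n ?fact_gt0// exprMn exprVn ler_pdivrMl ?exprn_gt0//.
by move=> /le_trans; apply; rewrite le_eqVlt; apply/orP; left; apply/eqP; ring.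
Unshelve. all: by end_near. Qed.

(** Integration by parts gives this primitive of [x ^+ n * expR (- x)], the
    one that vanishes at infinity. *)
Fixpoint gamma_prim (n : nat) (x : R) : R :=
  if n is n'.+1 then n%:R * gamma_prim n' x - x ^+ n * expR (- x) else - expR (- x).

Lemma is_derive_gamma_prim n (x : R) :
  is_derive x (1 : R) (gamma_prim n) (x ^+ n * expR (- x)).
Proof.
have he (y : R) : is_derive y (1 : R) (fun y : R => expR (- y)) (- expR (- y)).
  have h1 : is_derive y 1 (fun y : R => - y) (-1) by apply: is_derive_eq.
  rewrite -mulrN1.
  exact: (@is_derive1_comp R expR (fun y => - y) y _ _ (is_derive_expR _) h1).
elim: n => [|n IH].
  rewrite (_ : gamma_prim 0 = - (fun y => expR (- y)))//.
  by apply: is_derive_eq; rewrite expr0 mul1r opprK.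
have hX : is_derive x 1 (fun y : R => y ^+ n.+1) (n.+1%:R * x ^+ n).
  have := derivableP (@exprn_derivable R n.+1 x 1).
  by rewrite exp_derive /GRing.scale/= mulr1.
rewrite (_ : gamma_prim n.+1 = n.+1%:R \*: gamma_prim n -
  (fun y : R => y ^+ n.+1) * (fun y => expR (- y))).
  2: by apply/funext => y.
by apply: is_derive_eq; rewrite /GRing.scale/=; ring.
Qed.

Lemma gamma_prim0 n : gamma_prim n 0 = - n`!%:R.
Proof.
elim: n => [|n IH] /=; first by rewrite oppr0 expR0.
by rewrite IH expr0n/= mul0r subr0 factS natrM mulrN.
Qed.

Lemma gamma_prim_cvg n : gamma_prim n x @[x --> +oo] --> (0 : R).
Proof.
elim: n => [|n IH] /=; first by rewrite -oppr0; apply: cvgN; exact: cvgr_expR.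
rewrite -[X in _ --> X](subr0 (0 : R)); apply: cvgB; last exact: cvg_exprn_expRN.
by rewrite -[X in _ --> X](mulr0 n.+1%:R); apply: cvgMr.
Qed.

Lemma integral_exprn_expRN n :
  (\int[mu]_(x in `[0%R, +oo[) (x ^+ n * expR (- x))%:E = (n`!%:R)%:E)%E.
Proof.
have dF (x : R) : derivable (gamma_prim n) x (1 : R) by case: (is_derive_gamma_prim n x).
rewrite (@ge0_continuous_FTC2y _ _ (gamma_prim n) _ 0).
- by rewrite gamma_prim0 EFinN oppeK add0e.
- by move=> x x0; rewrite mulr_ge0 ?exprn_ge0 ?expR_ge0.
- apply: continuous_subspaceT => x; apply: cvgM; first exact: exprn_continuous.
  by apply: continuous_comp; [exact: continuousN|exact: continuous_expR].
- exact: gamma_prim_cvg.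
- by [].
- apply: cvg_at_right_filter; apply: differentiable_continuous.
  exact/derivable1_diffP.
- by move=> x _; rewrite derive1E (@derive_val _ _ _ _ _ _ _ (is_derive_gamma_prim n x)).
Qed.

End gamma_function.

(** * Moments of the Gamma(2, beta) law *)

(** The Borel sets of [R] come with two measurable structures, only one of
    which carries Lebesgue measure; pushing a law forward along this
    identity map transports it there. *)
Definition to_borel (R : realType) (x : R) : measurableTypeR R := x.

Lemma measurable_to_borel (R : realType) : measurable_fun setT (@to_borel R).
Proof. by move=> _ A mA; rewrite setTI. Qed.

HB.instance Definition _ (R : realType) :=
  @isMeasurableFun.Build _ _ R (measurableTypeR R) (@to_borel R)
    (@measurable_to_borel R).

Section gamma2_moments.
Context {R : realType} (beta : R).
Hypothesis beta_gt0 : 0 < beta.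
Notation mu := (@lebesgue_measure R).
Local Notation nu := (gamma2_distribution beta_gt0).
Local Notation pos := (@pos_part R).
Local Notation neg := (@neg_part R).
Local Notation W := (@abs_weight R).

Lemma integral_gamma2 (f : R -> R) : (forall x, 0 <= f x) ->
  measurable_fun setT f ->
  (\int[nu]_x (f x)%:E =
   \int[mu]_(x in `[0%R, +oo[) (f x * (beta ^+ 2 * x * expR (- beta * x)))%:E)%E.
Proof.
move=> f0 mf.
pose nu' : probability (measurableTypeR R) R := distribution nu (@to_borel R).
have mf' : measurable_fun [set: measurableTypeR R] f by exact: mf.
have -> : (\int[nu]_x (f x)%:E = \int[nu']_x (f x)%:E)%E.
  rewrite /nu' /distribution ge0_integral_pushforward//.
    exact/measurable_EFinP.
  by move=> y _; rewrite lee_fin.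
have nuE A : measurable A -> nu' A = (\int[mu]_(x in A) (gamma2_pdf beta x)%:E)%E.
  by [].
have mh : measurable_fun [set: measurableTypeR R] (gamma2_pdf beta).
  exact: measurable_gamma2_pdf.
rewrite (ge0_integral_density mh nuE f0 mf').
rewrite [RHS]integral_mkcond; apply: eq_integral => x _.
rewrite /gamma2_pdf patchE mem_setE in_itv/= andbT le_eqVlt.
by case: (ltgtP 0 x) => [| |<-] //=; rewrite ?mulr0 ?mul0r ?mulr0.
Qed.

(** The substitution [y = beta * x] reduces to rate 1; the factor [x] of
    the density raises the exponent by one. *)
Lemma gamma_scaling (p : R) : 0 <= p ->
  (\int[nu]_x (pos x `^ p)%:E =
   (beta `^ p)^-1%:E * \int[mu]_(x in `[0%R, +oo[) (x `^ (p + 1) * expR (- x))%:E)%E.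
Proof.
move=> p0; have p10 : 0 < p + 1 by rewrite ltr_wpDl.
have mpos : measurable_fun setT (fun x : R => pos x `^ p).
  apply: (@measurableT_comp _ _ _ _ _ _ (fun y : R => y `^ p)); first exact: measurable_powR.
  exact: continuous_measurable_fun (@continuous_pos R).
rewrite integral_gamma2//; last by move=> x; exact: powR_ge0.
pose F := fun y : R => beta * y.
pose G := fun x : R => pos x `^ (p + 1) * expR (- x).
have cG : continuous G.
  move=> x; apply: cvgM; first exact: continuous_pos_powR.
  by apply: continuous_comp; [exact: continuousN|exact: continuous_expR].
have dFx (x : R) : is_derive x (1 : R) F beta.
  by apply: is_derive_eq; rewrite /GRing.scale/= ?mulr1 ?mulr0 ?addr0 ?add0r.
have F'E : derive1 F = fun=> beta.
  by apply/funext => x; rewrite derive1E (@derive_val _ _ _ _ _ _ _ (dFx x)).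
have dF (x : R) : derivable F x 1 by case: (dFx x).
have sub := @increasing_ge0_integration_by_substitutiony R F G 0.
have F0 : F 0 = 0 by rewrite /F mulr0.
rewrite F0 F'E in sub.
rewrite [X in _ = (_ * X)%E](_ : _ = \int[mu]_(x in `[0%R, +oo[) (G x)%:E)%E; last first.
  by apply: eq_integral => x; rewrite inE/= in_itv/= andbT => x0; rewrite /G /pos_part (max_idPl x0).
rewrite sub; first last.
- by move=> x _; rewrite mulr_ge0 ?powR_ge0 ?expR_ge0.
- exact: continuous_subspaceT.
- exact: gt0_cvgMry.
- split=> [x _|]; first exact: dF.
  apply: cvg_at_right_filter; apply: differentiable_continuous.
  exact/derivable1_diffP.
- exact: is_cvg_cst.
- exact: is_cvg_cst.
- by move=> x _; exact: cst_continuous.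
- by move=> x y _ _ xy; rewrite /F ltr_pM2l.
rewrite -ge0_integralZl//.
- apply: eq_integral => x; rewrite inE/= in_itv/= andbT => x0; rewrite -EFinM; congr EFin.
  rewrite /G /F !fctE /pos_part (max_idPl x0) (max_idPl _) ?mulr_ge0 ?(ltW beta_gt0)//.
  have powS y : 0 <= y -> y `^ (p + 1) = y `^ p * y.
    by move=> y0; rewrite powRD ?(gt_eqF p10)// powRr1.
  rewrite powRM ?(ltW beta_gt0)// !powS ?(ltW beta_gt0)// mulNr.
  by field; rewrite gt_eqF// powR_gt0.
- apply/measurable_EFinP; apply: measurable_funTS; apply: measurable_funM => //.
  apply: continuous_measurable_fun => x; apply: continuous_comp; last exact: cG.
  by apply: cvgMr.
- move=> x _; rewrite lee_fin /= mulr_ge0 ?(ltW beta_gt0)//.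
  by rewrite mulr_ge0 ?powR_ge0 ?expR_ge0.
- by rewrite lee_fin invr_ge0 powR_ge0.
Qed.

Lemma gamma2_moment k :
  (\int[nu]_x (pos x ^+ k)%:E = (k.+1`!%:R / beta ^+ k)%:E)%E.
Proof.
have b0 := ltW beta_gt0.
have := @gamma_scaling k%:R (ler0n _ k); rewrite powR_mulrn//.
under eq_integral do rewrite powR_mulrn ?pos_ge0//.
move=> ->; rewrite [X in (_ * X)%E](_ : _ = (k.+1`!%:R)%:E); last first.
  rewrite -integral_exprn_expRN; apply: eq_integral => x.
  by rewrite inE/= in_itv/= andbT => x0; rewrite natr1 powR_mulrn.
by rewrite -EFinM mulrC.
Qed.

Let mneg k : measurable_fun setT (fun x : R => neg x ^+ k).
Proof. by apply: measurable_funX; exact: continuous_measurable_fun (@continuous_neg R). Qed.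

Let mpos k : measurable_fun setT (fun x : R => pos x ^+ k).
Proof. by apply: measurable_funX; exact: continuous_measurable_fun (@continuous_pos R). Qed.

Lemma gamma2_neg k : (\int[nu]_x (neg x ^+ k.+1)%:E = 0)%E.
Proof.
rewrite integral_gamma2//; last by move=> x; rewrite exprn_ge0// neg_ge0.
rewrite integral0_eq// => x; rewrite /= in_itv/= andbT => x0.
by rewrite /neg_part (max_idPr _) ?oppr_le0// expr0n mul0r.
Qed.

Lemma pos_neg_norm (x : R) k : `|x| ^+ k.+1 = pos x ^+ k.+1 + neg x ^+ k.+1.
Proof.
rewrite /pos_part /neg_part; case: (leP 0 x) => x0.
  by rewrite ger0_norm// (max_idPr _) ?oppr_le0// expr0n addr0.
by rewrite ltr0_norm// (max_idPl _) ?oppr_ge0 ?(ltW x0)// expr0n add0r.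
Qed.

Lemma abs_weight_le k x :
  W x ^+ k <= 2 ^+ k.+1 * (1 + (pos x ^+ k.+1 + neg x ^+ k.+1)).
Proof.
have W1 := abs_weight_ge1 x.
apply: (@le_trans _ _ (W x ^+ k.+1)); first by rewrite ler_weXn2l.
rewrite -pos_neg_norm /W; set t := `|x|; have t0 : 0 <= t by exact: normr_ge0.
have [t1|t1] := leP t 1.
  rewrite (@le_trans _ _ (2 ^+ k.+1))//.
    by rewrite lerXn2r ?nnegrE ?addr_ge0//; lra.
  by rewrite ler_peMr ?exprn_ge0// lerDl exprn_ge0.
rewrite mulrDr mulr1 -exprMn -[leLHS]add0r lerD ?exprn_ge0//.
by rewrite lerXn2r ?nnegrE ?addr_ge0 ?mulr_ge0//; lra.
Qed.

Lemma abs_weight_integrable (P : probability R R) :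
  (forall k, P.-integrable setT (EFin \o (fun x => pos x ^+ k.+1))) ->
  (forall k, P.-integrable setT (EFin \o (fun x => neg x ^+ k.+1))) ->
  forall k, P.-integrable setT (EFin \o (fun x => W x ^+ k)).
Proof.
move=> ip ineg k.
have mW : measurable_fun setT (fun x => W x ^+ k).
  apply: measurable_funX; apply: continuous_measurable_fun => x.
  by apply: cvgD; [exact: cvg_cst|exact: norm_continuous].
apply: (@le_integrable _ _ _ P setT measurableT _
   (fun x => (2 ^+ k.+1 * (1 + (pos x ^+ k.+1 + neg x ^+ k.+1)))%:E)).
- exact/measurable_EFinP.
- move=> x _ /=; rewrite lee_fin ger0_norm; last first.
    by rewrite exprn_ge0// (le_trans ler01 (abs_weight_ge1 x)).
  by rewrite (le_trans (abs_weight_le k x))// ler_norm.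
- apply: (@eq_integrable _ _ _ _ _ measurableT (fun x => (2 ^+ k.+1)%:E *
    (1%:E + ((pos x ^+ k.+1)%:E + (neg x ^+ k.+1)%:E)))%E) => //.
  apply: integrableZl => //; apply: integrableD => //.
    exact: finite_measure_integrable_cst.
  by apply: integrableD => //; [exact: ip|exact: ineg].
Qed.

Lemma gamma2_weight_integrable k : nu.-integrable setT (EFin \o (fun x => W x ^+ k)).
Proof.
apply: abs_weight_integrable => {}k; apply/integrableP; split.
- exact/measurable_EFinP.
- rewrite (@eq_integral _ _ _ _ _ (fun x => (pos x ^+ k.+1)%:E)).
    by rewrite gamma2_moment ltry.
  by move=> x _; rewrite /= ger0_norm// exprn_ge0// pos_ge0.
- exact/measurable_EFinP.
- rewrite (@eq_integral _ _ _ _ _ (fun x => (neg x ^+ k.+1)%:E)).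
    by rewrite gamma2_neg ltry.
  by move=> x _; rewrite /= ger0_norm// exprn_ge0// neg_ge0.
Qed.

Lemma expect_gamma2_pos k : expect nu (fun x => pos x ^+ k) = k.+1`!%:R / beta ^+ k.
Proof. by rewrite /expect /Rintegral gamma2_moment. Qed.

Lemma expect_gamma2_neg k : expect nu (fun x => neg x ^+ k.+1) = 0.
Proof. by rewrite /expect /Rintegral gamma2_neg. Qed.

(** [(k + J).+1`!] exceeds [J`!] by a factor polynomial in [J] only, and
    the choice [d = beta / 2] leaves [2 ^- J]. *)
Lemma gamma2_growth k :
  expect nu (fun x => pos x ^+ (k + J)) * ((beta / 2) ^+ J / J`!%:R)
    @[J --> \oo] --> 0.
Proof.
(* one power of [J] more than in the factor to be beaten, so that [1 / J]
   is left over *)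
pose q := k.+2; pose c : R := (k.+2)%:R ^+ k.+1 * (2 * q%:R) ^+ q / beta ^+ k.
have lim : c * J.+1%:R^-1 * 2 @[J --> \oo] --> (0 : R).
  rewrite [X in _ --> X](_ : 0 = c * 0 * 2); last by rewrite mulr0 mul0r.
  by apply: cvgMl; apply: cvgMr; exact: cvg_harmonic.
have b0 := ltW beta_gt0.
apply: (squeeze_cvgr _ (cvg_cst 0) lim); near=> J.
have J0 : (0 < J)%N by near: J; exact: nbhs_infty_gt.
have JR : 0 < J%:R :> R by rewrite ltr0n.
rewrite expect_gamma2_pos; apply/andP; split.
  by rewrite !mulr_ge0 ?invr_ge0 ?exprn_ge0 ?divr_ge0.
have fact_le : (k + J).+1`!%:R <= J`!%:R * (k.+2%:R * J%:R) ^+ k.+1 :> R.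
  rewrite -natrM -natrX -natrM ler_nat.
  have gen m : ((m + J)`! <= J`! * (m + J) ^ m)%N.
    elim: m => [|m IH]; first by rewrite expn0 muln1.
    rewrite addSn factS mulnC expnSr mulnA leq_mul//.
    rewrite (leq_trans IH)// leq_mul2l; apply/orP; right.
    by case: (m) => [|n]; rewrite ?expn0// leq_exp2r.
  rewrite -addSn (leq_trans (gen k.+1))// leq_mul2l leq_exp2r//.
  by rewrite mulSn addnC leq_add2l leq_pmulr// orbT.
have pow2 : (J%:R / (2 * q%:R)) ^+ q <= 2 ^+ J :> R.
  have := @expr_ge_polynomial R 1 J q; rewrite mul1r.
  by move=> /(_ _ isT); apply; rewrite ler01 /= ler1n.
have J1 : J%:R^-1 <= J.+1%:R^-1 * 2 :> R.
  rewrite -[leLHS]mul1r ler_pdivrMr// -mulrA mulrC ler_pdivlMr// mul1r.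
  by rewrite -natrM ler_nat; clear -J0; lia.
have c0 : 0 <= c.
  by apply: divr_ge0; [apply: mulr_ge0|]; apply: exprn_ge0 => //; rewrite mulr_ge0.
rewrite -mulrA; apply: le_trans (ler_wpM2l c0 J1).
have f0 : 0 < J`!%:R :> R by rewrite ltr0n fact_gt0.
have two : 0 < 2 ^+ J :> R by rewrite exprn_gt0.
have bk : 0 < beta ^+ k by rewrite exprn_gt0.
have bJ : 0 < beta ^+ J by rewrite exprn_gt0.
rewrite exprMn exprVn exprD.
have -> : (k + J).+1`!%:R / (beta ^+ k * beta ^+ J) *
    (beta ^+ J / 2 ^+ J / J`!%:R) = (k + J).+1`!%:R / J`!%:R / 2 ^+ J / beta ^+ k.
  by field; rewrite !gt_eqF.
have -> : c / J%:R = k.+2%:R ^+ k.+1 * (2 * q%:R) ^+ q / J%:R / beta ^+ k.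
  by rewrite /c; field; rewrite !gt_eqF.
rewrite ler_pM2r ?invr_gt0// ler_pdivrMr// ler_pdivrMr//.
rewrite (le_trans fact_le)// [leRHS]mulrC ler_wpM2l ?(ltW f0)//.
rewrite exprMn; move: pow2; rewrite expr_div_n [J%:R ^+ q]exprS.
have : 0 < (2 * q%:R) ^+ q :> R by rewrite exprn_gt0// mulr_gt0.
move: ((2 * q%:R) ^+ q) => Q Q0; rewrite ler_pdivrMr// => pow2.
rewrite -!mulrA ler_wpM2l ?exprn_ge0// mulrCA ler_pdivlMl//.
by rewrite [leRHS]mulrC.
Unshelve. all: by end_near. Qed.

End gamma2_moments.

Section real_power.
Context {R : realType} (p : R).
Hypothesis p_gt0 : 0 < p.
Local Notation W := (@abs_weight R).

(** Splitting by sign exhibits the continuity at 0, and leaves on the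
    negative side an integer power, whose mean is 0 under the limit law. *)
Lemma real_powE x : real_pow x p = pos_part x `^ p +
  (p == (Num.truncn p)%:R)%:R * (- 1) ^+ Num.truncn p * neg_part x ^+ Num.truncn p.
Proof.
rewrite /real_pow /pos_part /neg_part; case: (leP 0 x) => x0.
  rewrite (max_idPr (_ : - x <= 0)) ?oppr_le0// expr0n.
  case: eqP => [pn|_]; rewrite ?mul0r ?addr0// mul1r.
  case: (Num.truncn p) pn => [p0|n _]; last by rewrite mulr0 addr0.
  by move: p_gt0; rewrite p0 ltxx.
rewrite (max_idPl (_ : 0 <= - x)) ?oppr_ge0 ?(ltW x0)//.
rewrite (powR0 (lt0r_neq0 p_gt0)) add0r.
by case: eqP => [pn|_]; rewrite ?mul0r// mul1r -exprMn mulN1r opprK.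
Qed.

Lemma trunc_gt0 : p = (Num.truncn p)%:R -> (0 < Num.truncn p)%N.
Proof. by move=> pn; move: p_gt0; rewrite {1}pn ltr0n. Qed.

Lemma continuous_real_pow : continuous (fun x : R => real_pow x p).
Proof.
rewrite (_ : (fun x => _) = fun x => pos_part x `^ p +
  (p == (Num.truncn p)%:R)%:R * (- 1) ^+ Num.truncn p * neg_part x ^+ Num.truncn p).
  2: by apply/funext => x; rewrite real_powE.
move=> x; apply: cvgD; first exact: continuous_pos_powR.
apply: cvgMr; apply: (@continuous_comp _ _ _ (@neg_part R) (fun y => y ^+ _)).
  exact: continuous_neg.
exact: exprn_continuous.
Qed.

Lemma real_pow_le x : `|real_pow x p| <= 1 * W x ^+ (Num.truncn p).+1.
Proof.
rewrite mul1r /real_pow; have W1 := abs_weight_ge1 x.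
have W0 : 0 <= W x by exact: le_trans ler01 W1.
case: (leP 0 x) => x0.
  rewrite ger0_norm ?powR_ge0// -powR_mulrn//.
  apply: (@le_trans _ _ (W x `^ p)).
    apply: ge0_ler_powR; rewrite ?(ltW p_gt0) ?nnegrE//.
    by rewrite /abs_weight ger0_norm// lerDr.
  by rewrite ler_powR// ltW// truncnS_gt.
case: eqP => _; last by rewrite normr0 exprn_ge0.
rewrite normrX (@le_trans _ _ (W x ^+ Num.truncn p))//.
  by rewrite lerXn2r ?nnegrE// /abs_weight lerDr.
by rewrite ler_weXn2l.
Qed.

Lemma expect_gamma2_real_pow (beta : R) (beta_gt0 : 0 < beta) :
  expect (gamma2_distribution beta_gt0) (fun x => real_pow x p) =
  Gamma_fun (p + 2) / beta `^ p.
Proof.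
set nu := gamma2_distribution beta_gt0.
have W1 := @abs_weight_ge1 R.
have iW := gamma2_weight_integrable beta_gt0.
have tpp : tame W (fun x => pos_part x `^ p).
  have tr : tame W (fun x : R => real_pow x p).
    exact: tame_continuous continuous_real_pow real_pow_le.
  have mf := continuous_measurable_fun (continuous_pos_powR p_gt0).
  apply: (tame_le mf tr) => x; rewrite /real_pow /pos_part.
  case: (leP 0 x) => x0 //; by rewrite (powR0 (lt0r_neq0 p_gt0)) normr0.
have Epp : expect nu (fun x => pos_part x `^ p) = Gamma_fun (p + 2) / beta `^ p.
  rewrite /expect /Rintegral (gamma_scaling beta_gt0 (ltW p_gt0)).
  rewrite /Gamma_fun /Rintegral mulrC.
  rewrite (_ : p + 2 - 1 = p + 1); last by ring.
  set G := (fun x : R => (x `^ (p + 1) * expR (- x))%:E).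
  have mG : measurable_fun [set: R] G.
    apply/measurable_EFinP; apply: measurable_funM => //.
    apply: continuous_measurable_fun => x.
    by apply: continuous_comp; [exact: continuousN|exact: continuous_expR].
  rewrite (@integral_itv_obnd_cbnd R 0 (BInfty R false) G (measurable_funTS mG)).
  have b0 : 0 < beta `^ p by rewrite powR_gt0.
  have z0 : (0 < ((beta `^ p)^-1)%:E)%E by rewrite lte_fin invr_gt0.
  set X := integral _ _ _; case: X => [r| |]; first by [].
    by rewrite gt0_muley//= mulr0.
  by rewrite gt0_muleNy//= mulr0.
case: (eqVneq p (Num.truncn p)%:R) => [pn|pn]; last first.
  rewrite -Epp; congr (expect nu _); apply/funext => x.
  by rewrite real_powE (negPf pn) !mul0r addr0.
have np := trunc_gt0 pn.
have -> : (fun x : R => real_pow x p) = (fun x => pos_part x `^ p +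
    (- 1) ^+ Num.truncn p * neg_part x ^+ Num.truncn p).
  by apply/funext => x; rewrite real_powE -pn eqxx mul1r.
have tn : tame W (fun x => neg_part x ^+ Num.truncn p).
  by apply: tameX => //; exact: tame_neg.
rewrite (expectD W1 iW tpp); last exact: (tameM W1 (tame_cst _ _) tn).
rewrite (expectZ W1 iW _ tn) Epp; case: (Num.truncn p) np => // n _.
by rewrite expect_gamma2_neg mulr0 addr0.
Qed.
End real_power.

(** * Probability flow into a state under a stationary law *)

Section inflow.
Context (R : realType) d (T : measurableType d).
Hypothesis mT : forall A : set T, measurable A.
Variables (q : T -> T -> R) (P : R -> R.-pker T ~> T) (pi : probability T R).
Hypothesis Pq : ctmc_semigroup q P.
Hypothesis Ppi : ctmc_stationary P pi.

(** At a time [h > 0] stationarity says that the mass entering [y] equals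
    the mass [pi y * (1 - P h y y)] leaving it. Divide by [h] and let [h]
    tend to 0: the right side converges by assumption, and Fatou's lemma
    keeps an inequality on the left, where the convergence of [P h x y / h]
    is not uniform in [x]. *)
Lemma inflow_le (out : T -> R) y :
  (forall x y, x <> y -> 0 <= q x y) ->
  (fine (\esum_(z in [set z | z <> y]) (q y z)%:E)%E <= out y) ->
  (\int[pi]_(x in [set x | x <> y]) (q x y)%:E <= (out y)%:E * pi [set y])%E.
Proof.
move=> q0 outy; have [_ _ Pq1 Pq2] := Pq.
pose D := [set x | x <> y].
pose h n : R := n.+1%:R^-1.
have h0 n : 0 < h n by rewrite invr_gt0.
have hto : h n @[n --> \oo] --> 0^'+.
  move=> A [e /= e0 eA].
  have : \forall n \near \oo, ball 0 e (h n).
    exact: (@cvg_harmonic R (ball 0 e) (nbhsx_ballx _ _ e0)).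
  by apply: filterS => n hn; exact: eA hn (h0 n).
pose u n x := (fine (P (h n) x [set y]) / h n)%:E.
have Pfin t x A : P t x A \is a fin_num.
  exact: kernel_finite_transition (mT A).
have P0 t x A : 0 <= fine (P t x A) by rewrite fine_ge0.
have u0 n x : D x -> (0 <= u n x)%E.
  by move=> _; rewrite lee_fin divr_ge0// ltW.
have lim_u x : D x -> limn_einf (u ^~ x) = (q x y)%:E.
  move=> Dx; have c : u n x @[n --> \oo] --> (q x y)%:E.
    apply: cvg_EFin; first by apply: nearW.
    exact: (cvg_comp _ _ hto (Pq1 _ _ Dx)).
  by rewrite is_cvg_limn_einfE; [exact/cvg_lim|apply/cvg_ex; exists (q x y)%:E].
pose a := fine (pi [set y]).
have piE : pi [set y] = a%:E by rewrite /a fineK// fin_num_measure.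
have mf A (f : T -> \bar R) : measurable_fun A f by move=> _ B _; exact: mT.
have intu n : (\int[pi]_(x in D) u n x =
    (a * ((1 - fine (P (h n) y [set y])) / h n))%:E)%E.
  have st := Ppi (ltW (h0 n)) (mT [set y]).
  pose p := fine (P (h n) y [set y]).
  have int1 : (\int[pi]_(x in [set y]) P (h n) x [set y] = (p * a)%:E)%E.
    rewrite (@eq_integral _ _ _ _ [set y] (cst p%:E)); last first.
      by move=> x; rewrite inE => ->; rewrite /= /p fineK.
    by rewrite integral_cst// EFinM -piE.
  have : (\int[pi]_x P (h n) x [set y] =
     \int[pi]_(x in D) P (h n) x [set y] +
     \int[pi]_(x in [set y]) P (h n) x [set y])%E.
    rewrite -ge0_integral_setU//.
    - congr (integral _ _ _); apply/seteqP; split => x _ //=.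
      by have [->|] := pselect (x = y); [right|left].
    - by apply/disj_setPS => x [/= ? ?].
  rewrite st int1 piE => /eqP.
  rewrite -sube_eq// => [|]; last by rewrite fin_num_adde_defl.
  rewrite -EFinB => /eqP pD.
  under eq_integral do rewrite /u mulrC EFinM fineK//.
  rewrite ge0_integralZl//; last by rewrite lee_fin invr_ge0 ltW.
  by rewrite -pD -EFinM; congr EFin; rewrite -/p; move: (p) (h n)^-1 => p1 h1; ring.
have Fat := @fatou _ _ _ pi D (mT D) u (fun n => mf D (u n)) u0.
rewrite (@eq_integral _ _ _ _ D (fun x => (q x y)%:E)) in Fat; last first.
  by move=> x; rewrite inE => Dx; rewrite lim_u.
apply: (le_trans Fat); under eq_fun do rewrite intu.
have a0 : 0 <= a by rewrite fine_ge0.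
have c : (a * ((1 - fine (P (h n) y [set y])) / h n))%:E @[n --> \oo] -->
    (a * fine (\esum_(z in D) (q y z)%:E)%E)%:E.
  apply: cvg_EFin; first by apply: nearW.
  apply: cvgMr; exact: (cvg_comp _ _ hto (Pq2 _)).
rewrite is_cvg_limn_einfE; last by apply/cvg_ex; eexists; exact: c.
rewrite (cvg_lim _ c)// piE -EFinM lee_fin mulrC ler_wpM2r//.
Qed.
End inflow.

(** * Generators of jump chains and Lyapunov drift *)

Section jumps.
Context (R : realType) d (T : measurableType d).
Hypothesis mT : forall A : set T, measurable A.
Variables (enc : T -> nat) (trans : T -> seq (R * T)) (pi : probability T R).
Variable Lam : R.
Hypothesis enc_inj : injective enc.
Hypothesis trans_ge0 : forall x m, m \in trans x -> 0 <= m.1.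

(** A chain with finitely many transitions out of each state, each given
    with its rate. A transition that stays at [x] does not contribute to
    the generator at [x]. *)
Definition jump (f : T -> R) x := \sum_(m <- trans x) m.1 * f m.2.
Definition generator (f : T -> R) x := \sum_(m <- trans x) m.1 * (f m.2 - f x).
Notation tot := (jump (fun=> 1)).

Hypothesis tot_le : forall x, tot x <= Lam.
(* the link between [pi] and the chain, which a transition semigroup
   provides through [inflow_le] *)
Hypothesis inflow : forall y,
  (\int[pi]_x (jump (fun z => (enc z == enc y)%:R) x)%:E
    <= (tot y)%:E * pi [set y])%E.

Let mf A (f : T -> \bar R) : measurable_fun A f.
Proof. by move=> _ B _; exact: mT. Qed.

Let mfR A (f : T -> R) : measurable_fun A f.
Proof. by move=> _ B _; exact: mT. Qed.

Lemma jump_ge0 (f : T -> R) x : (forall z, 0 <= f z) -> 0 <= jump f x.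
Proof.
move=> f0; rewrite /jump big_seq; apply: sumr_ge0 => m mx.
by rewrite mulr_ge0// (trans_ge0 mx).
Qed.

Lemma jump_le (f g : T -> R) x : (forall z, f z <= g z) -> jump f x <= jump g x.
Proof.
move=> fg; rewrite /jump big_seq [leRHS]big_seq; apply: ler_sum => m mx.
by rewrite ler_wpM2l// (trans_ge0 mx).
Qed.

Lemma jumpD (f g : T -> R) x : jump (fun z => f z + g z) x = jump f x + jump g x.
Proof. by rewrite -big_split/=; apply: eq_bigr => m _; rewrite mulrDr. Qed.

Lemma jumpZ c (f : T -> R) x : jump (fun z => c * f z) x = c * jump f x.
Proof. by rewrite mulr_sumr; apply: eq_bigr => m _; rewrite mulrCA. Qed.

Lemma genE (f : T -> R) x : generator f x = jump f x - tot x * f x.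
Proof.
rewrite /generator /jump mulr_suml -sumrB.
by apply: eq_bigr => m _; rewrite mulr1 mulrBr.
Qed.

Lemma genD (f g : T -> R) x : generator (fun z => f z + g z) x = generator f x + generator g x.
Proof. by rewrite !genE jumpD mulrDr; ring. Qed.

Lemma jump_norm (f : T -> R) x : `|jump f x| <= jump (fun z => `|f z|) x.
Proof.
rewrite (le_trans (ler_norm_sum _ _ _))// /jump big_seq [leRHS]big_seq.
by apply: ler_sum => m mx; rewrite normrM ger0_norm// (trans_ge0 mx).
Qed.

(** Only finitely many states are within reach of one jump, so a cutoff far
    away is invisible. *)
Lemma jump_cutoff (f : T -> R) (w : T -> nat) x :
  \forall n \near \oo, jump (fun z => f z * (w z < n)%N%:R) x = jump f x.
Proof.
exists (\max_(m <- trans x) (w m.2)).+1 => // n /= ltn.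
rewrite /jump big_seq [RHS]big_seq; apply: eq_bigr => m mx.
suff -> : (w m.2 < n)%N by rewrite mulr1.
by apply: leq_trans ltn; rewrite ltnS; exact: (@leq_bigmax_seq _ _ xpredT (fun m => w m.2)) mx isT.
Qed.

Lemma inflow_point (f : T -> R) k : (forall z, 0 <= f z) ->
  (\int[pi]_x (jump (fun z => f z * (enc z == k)%:R) x)%:E
    <= \int[pi]_x (tot x * (f x * (enc x == k)%:R))%:E)%E.
Proof.
move=> f0; have [[y <-{k}]|noy] := pselect (exists y, enc y = k); last first.
  rewrite integral0_eq ?integral_ge0//.
    move=> x _; rewrite lee_fin !mulr_ge0 ?jump_ge0//.
  move=> x _; congr EFin; rewrite /jump big1// => m _.
  by case: eqP => [e|]; rewrite ?mulr0//; exfalso; apply: noy; exists m.2.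
have fE z : f z * (enc z == enc y)%:R = f y * (enc z == enc y)%:R.
  by case: eqP => [/enc_inj ->//|]; rewrite !mulr0.
under eq_integral do under eq_fun do rewrite fE.
under eq_integral do rewrite jumpZ EFinM.
rewrite ge0_integralZl; [|exact: mT|exact: mf| |by rewrite lee_fin]; last first.
  by move=> x _; rewrite lee_fin jump_ge0.
apply: (@le_trans _ _ ((f y)%:E * ((tot y)%:E * pi [set y]))%E).
  by apply: lee_wpmul2l; [rewrite lee_fin|exact: inflow].
rewrite [leRHS](@eq_integral _ _ _ _ _ (((cst (f y * tot y)%:E) \_ [set y]))).
  by rewrite -integral_mkcond (integral_cst _ (mT _)) EFinM muleA.
move=> x _; rewrite patchE fE; case: eqP => [/enc_inj ->|xy].
  by rewrite mem_set//= mulr1 mulrC.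
by rewrite memNset ?mulr0// => /= xe; apply: xy; rewrite xe.
Qed.

(** Sum the inequalities at the points over an enumeration of the states,
    and pass to the limit by monotone convergence. *)
Lemma jump_integral_le (f : T -> R) : (forall z, 0 <= f z) ->
  (\int[pi]_x (jump f x)%:E <= \int[pi]_x (tot x * f x)%:E)%E.
Proof.
move=> f0; pose fn n z := f z * (enc z < n)%N%:R.
have fn0 n z : 0 <= fn n z by rewrite mulr_ge0.
have fnS n z : fn n.+1 z = fn n z + f z * (enc z == n)%:R.
  rewrite /fn -mulrDr -natrD ltnS leq_eqVlt; congr (_ * _%:R).
  by case: ltngtP.
have leI n : (\int[pi]_x (jump (fn n) x)%:E <= \int[pi]_x (tot x * fn n x)%:E)%E.
  elim: n => [|n IH].
    rewrite integral0_eq ?integral_ge0//.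
      by move=> x _; rewrite lee_fin !mulr_ge0 ?jump_ge0.
    by move=> x _; rewrite /jump big1// => m _; rewrite /fn ltn0 !mulr0.
  have jS x : jump (fn n.+1) x =
      jump (fn n) x + jump (fun z => f z * (enc z == n)%:R) x.
    by rewrite -jumpD; congr jump; apply/funext => z; rewrite fnS.
  under eq_integral do rewrite jS EFinD.
  under [leRHS]eq_integral do rewrite fnS mulrDr EFinD.
  rewrite !ge0_integralD//.
  - by rewrite leeD// inflow_point.
  - by move=> x _; rewrite lee_fin mulr_ge0// jump_ge0.
  - by move=> x _; rewrite lee_fin !mulr_ge0// jump_ge0.
  - by move=> x _; rewrite lee_fin jump_ge0.
  - by move=> x _; rewrite lee_fin jump_ge0// => z; rewrite mulr_ge0.
have fnf n z : fn n z <= f z by rewrite ler_piMr// lern1 leq_b1.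
have /cvg_lim <-// : (\int[pi]_x (jump (fn n) x)%:E)%E @[n --> \oo] -->
    (\int[pi]_x (jump f x)%:E)%E.
  rewrite [X in _ --> X](@eq_integral _ _ _ _ _
    (fun x => limn (fun n => (jump (fn n) x)%:E) : \bar R)); last first.
    move=> x _; apply/esym/cvg_lim => //; apply: cvg_near_cst.
    by apply: filterS (jump_cutoff f enc x) => n /= ->.
  apply: cvg_monotone_convergence => //.
  - by move=> n x _; rewrite lee_fin jump_ge0.
  - move=> x _ m n mn; rewrite lee_fin; apply: jump_le => z.
    rewrite ler_wpM2l// ler_nat; case: ltnP => // zm.
    by rewrite (leq_trans zm mn).
apply: lime_le.
  apply: ereal_nondecreasing_is_cvgn => m n mn; apply: ge0_le_integral => //.
  - by move=> x _; rewrite lee_fin jump_ge0.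
  - move=> x _; rewrite lee_fin; apply: jump_le => z.
    rewrite ler_wpM2l// ler_nat; case: ltnP => // zm.
    by rewrite (leq_trans zm mn).
apply: nearW => n; apply: (le_trans (leI n)).
apply: ge0_le_integral => //.
- by move=> x _; rewrite lee_fin !mulr_ge0 ?jump_ge0.
- by move=> x _; rewrite lee_fin ler_wpM2l ?jump_ge0.
Qed.

Let W1 := (fun=> 1) : T -> R.
Let W1_ge1 x : 1 <= W1 x. Proof. by []. Qed.
Let W1_int k : pi.-integrable setT (EFin \o (fun x => W1 x ^+ k)).
Proof.
rewrite (_ : EFin \o _ = cst 1%E); last first.
  by apply/funext => x; rewrite /= expr1n.
exact: finite_measure_integrable_cst.
Qed.

Lemma jump_bounded (f : T -> R) (C : R) : (forall z, `|f z| <= C) ->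
  forall x, `|jump f x| <= Lam * C.
Proof.
move=> fC x; have C0 : 0 <= C by rewrite (le_trans _ (fC x)).
apply: (le_trans (jump_norm f x)).
apply: (le_trans (jump_le x (g := fun z => C * 1) _)) => [z|].
  by rewrite mulr1.
by rewrite jumpZ mulrC ler_wpM2r.
Qed.

(** Apply the inequality between flows to the nonnegative functions [f + C]
    and [C - f]: as the total rate is bounded the constants cancel, and the
    two opposite inequalities give equality. *)
Lemma expect_gen_bounded (f : T -> R) (C : R) : (forall z, `|f z| <= C) ->
  expect pi (generator f) = 0.
Proof.
move=> fC.
have tame_bd (g : T -> R) (D : R) : (forall z, `|g z| <= D) -> tame W1 g.
  by move=> gD; exact: tame_bounded gD.
have tjump (g : T -> R) (D : R) : (forall z, `|g z| <= D) -> tame W1 (jump g).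
  by move=> gD; apply: tame_bd; exact: jump_bounded gD.
have t1 : tame W1 tot by apply: (tjump _ 1) => z; rewrite normr1.
have ttot (g : T -> R) (D : R) : (forall z, `|g z| <= D) -> tame W1 (fun x => tot x * g x).
  by move=> gD; apply: (tameM W1_ge1) => //; exact: tame_bd gD.
have le1 (g : T -> R) (D : R) : (forall z, 0 <= g z) -> (forall z, `|g z| <= D) ->
    expect pi (jump g) <= expect pi (fun x => tot x * g x).
  move=> g0 gD; rewrite -lee_fin -!(expectE W1_ge1 W1_int)//.
  - exact: jump_integral_le.
  - exact: ttot gD.
  - exact: tjump gD.
have tf := tame_bd _ _ fC.
have tjf := tjump _ _ fC.
have ttf := ttot _ _ fC.
rewrite (_ : generator f = fun x => jump f x - tot x * f x); last first.
  by apply/funext => x; rewrite genE.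
rewrite (expectB W1_ge1 W1_int)//; apply/eqP; rewrite subr_eq0 eq_le.
have t1C : tame W1 (fun x => C * tot x).
  by apply: (tameM W1_ge1) => //; exact: tame_cst.
apply/andP; split.
- have := @le1 (fun z => f z + C) (C + C).
  rewrite (_ : jump _ = fun x => jump f x + C * tot x); last first.
    apply/funext => x; rewrite jumpD; congr (_ + _).
    by rewrite -jumpZ /jump; under [RHS]eq_bigr do rewrite mulr1.
  rewrite (_ : (fun x => tot x * _) = fun x => tot x * f x + C * tot x).
    2: by apply/funext => x; rewrite mulrDr [C * _]mulrC.
  rewrite !(expectD W1_ge1 W1_int)// lerD2r; apply => z.
    by have := fC z; rewrite ler_norml => /andP[]; lra.
  by have := fC z; rewrite ler_norml => /andP[? ?]; rewrite ler_norml; lra.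
- have := @le1 (fun z => C - f z) (C + C).
  rewrite (_ : jump _ = fun x => C * tot x - jump f x); last first.
    apply/funext => x; rewrite jumpD; congr (_ + _).
      by rewrite -jumpZ /jump; under [RHS]eq_bigr do rewrite mulr1.
    by rewrite -mulN1r -jumpZ; congr jump; apply/funext => z; rewrite mulN1r.
  rewrite (_ : (fun x => tot x * _) = fun x => C * tot x - tot x * f x).
    2: by apply/funext => x; rewrite mulrBr [C * _]mulrC.
  rewrite !(expectB W1_ge1 W1_int)// lerD2l lerN2; apply => z.
    by have := fC z; rewrite ler_norml => /andP[]; lra.
  by have := fC z; rewrite ler_norml => /andP[? ?]; rewrite ler_norml; lra.
Qed.

(** The truncation of [V] at a level [n] is bounded, so that its generator
    has mean 0; this generator is at most [K - g] where [V <= n] and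
    nonpositive elsewhere. Let [n] tend to infinity. *)
Lemma drift_bound (V g : T -> R) (K : R) : 0 <= K ->
  (forall x, 0 <= V x) -> (forall x, 0 <= g x) ->
  (forall x, generator V x <= K - g x) -> (\int[pi]_x (g x)%:E <= K%:E)%E.
Proof.
move=> K0 V0 g0 drift.
pose Vn (n : nat) x := Num.min (V x) n%:R.
pose gn (n : nat) x := g x * (V x <= n%:R)%R%:R.
have Vn_bd n x : `|Vn n x| <= n%:R.
  by rewrite ger0_norm ?le_min ?V0 ?ler0n// ge_min lexx orbT.
have genVn n x : generator (Vn n) x <= (K - g x) * (V x <= n%:R)%R%:R.
  rewrite /generator /Vn; case: (leP (V x) n%:R) => [Vx|Vx].
    rewrite mulr1 (le_trans _ (drift x))// /generator big_seq [leRHS]big_seq.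
    apply: ler_sum => m mx; rewrite ler_wpM2l ?(trans_ge0 mx)//.
    by rewrite lerD2r ge_min lexx.
  rewrite mulr0 big_seq; apply: sumr_le0 => m mx.
  by rewrite mulr_ge0_le0 ?(trans_ge0 mx)// subr_le0 ge_min lexx orbT.
have gen_bd n x : `|generator (Vn n) x| <= Lam * n%:R + Lam * n%:R.
  rewrite genE (le_trans (ler_normB _ _))// lerD//.
    exact: jump_bounded.
  have t0 : 0 <= tot x by exact: jump_ge0.
  by rewrite normrM (ger0_norm t0) ler_pM.
have tame_bd (f : T -> R) (D : R) : (forall z, `|f z| <= D) -> tame W1 f.
  by move=> fD; exact: tame_bounded fD.
have gn_bd n x : `|gn n x| <= `|K| + (Lam * n%:R + Lam * n%:R).
  rewrite ger0_norm ?mulr_ge0// /gn; have := genVn n x.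
  have := gen_bd n x; rewrite ler_norml => /andP[+ _].
  have := ler_norm K; case: (V x <= n%:R)%R; rewrite ?mulr1 ?mulr0; first lra.
  by move=> _ _ _; rewrite addr_ge0// (le_trans (normr_ge0 _) (gen_bd n x)).
have gnK n : (\int[pi]_x (gn n x)%:E <= K%:E)%E.
  rewrite (expectE W1_ge1 W1_int (tame_bd _ _ (gn_bd n))) lee_fin.
  pose kn x : R := K * (V x <= n%:R)%R%:R.
  have tkn : tame W1 kn.
    apply: (tame_bd _ `|K|) => x; rewrite normrM ler_piMr// normr_nat.
    by rewrite lern1 leq_b1.
  have : expect pi (generator (Vn n)) <= expect pi (fun x => kn x - gn n x).
    apply: (expect_le W1_ge1 W1_int); first exact: tame_bd (gen_bd n).
      by apply: (tameB W1_ge1) => //; exact: tame_bd (gn_bd n).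
    by move=> x; rewrite /kn /gn -mulrBl.
  rewrite (expect_gen_bounded (Vn_bd n)) (expectB W1_ge1 W1_int)//; last first.
    exact: tame_bd (gn_bd n).
  rewrite subr_ge0 => /le_trans; apply.
  rewrite -[leRHS](expect_cst pi K); apply: (expect_le W1_ge1 W1_int) => //.
    exact: tame_cst.
  by move=> x; rewrite /kn ler_piMr// lern1 leq_b1.
have gn_le m n x : (m <= n)%N -> gn m x <= gn n x.
  move=> mn; rewrite /gn ler_wpM2l// ler_nat.
  case: (leP (V x) m%:R) => // Vm; rewrite (le_trans Vm)//.
  by rewrite ler_nat.
have /cvg_lim <-// : (\int[pi]_x (gn n x)%:E)%E @[n --> \oo] -->
    (\int[pi]_x (g x)%:E)%E.
  rewrite [X in _ --> X](@eq_integral _ _ _ _ _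
    (fun x => limn (fun n => (gn n x)%:E) : \bar R)); last first.
    move=> x _; apply/esym/cvg_lim => //; apply: cvg_near_cst.
    near=> n; rewrite /gn (_ : V x <= n%:R) ?mulr1//.
    by near: n; exact: nbhs_infty_ger.
  apply: cvg_monotone_convergence => //.
  - by move=> n x _; rewrite lee_fin mulr_ge0.
  - by move=> x _ m n mn; rewrite lee_fin gn_le.
apply: lime_le; last exact: nearW.
apply: ereal_nondecreasing_is_cvgn => m n mn; apply: ge0_le_integral => //.
- by move=> x _; rewrite lee_fin mulr_ge0.
- by move=> x _; rewrite lee_fin gn_le.
Unshelve. all: by end_near. Qed.

Section tame_gen.
Variables (W : T -> R) (c : R).
Hypothesis W_ge1 : forall x, 1 <= W x.
Hypothesis W_int : forall k, pi.-integrable setT (EFin \o (fun x => W x ^+ k)).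
Hypothesis c_ge0 : 0 <= c.
Hypothesis W_trans : forall x m, m \in trans x -> W m.2 <= c * W x.

Lemma tame_jump (f : T -> R) : tame W f -> tame W (jump f).
Proof.
move=> tf; split; first exact: mfR.
have [C [k [C0 fC]]] := tame_bound W_ge1 tf.
exists (Lam * (C * c ^+ k)), k => x; apply: (le_trans (jump_norm f x)).
have W0 z : 0 <= W z by rewrite (le_trans ler01).
apply: (@le_trans _ _ (tot x * (C * (c * W x) ^+ k))).
  rewrite /jump mulr_suml big_seq [leRHS]big_seq; apply: ler_sum => m mx.
  rewrite mulr1 ler_wpM2l ?(trans_ge0 mx)// (le_trans (fC _))// ler_wpM2l//.
  by rewrite lerXn2r ?nnegrE ?mulr_ge0// W_trans.
rewrite exprMn mulrA mulrA -[leRHS]mulrA mulrA ler_wpM2r ?exprn_ge0//.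
by rewrite -mulrA ler_wpM2r ?tot_le// mulr_ge0// exprn_ge0.
Qed.

Lemma tame_gen (f : T -> R) : tame W f -> tame W (generator f).
Proof.
move=> tf; rewrite (_ : generator f = fun x => jump f x - tot x * f x); last first.
  by apply/funext => x; rewrite genE.
apply: (tameB W_ge1); first exact: tame_jump.
by apply: (tameM W_ge1) => //; apply: tame_jump; exact: tame_cst.
Qed.

(** Restrict [f] to the set where [W] is small to make it bounded, and pass
    to the limit by dominated convergence: a jump multiplies the weight by
    at most [c], so the generators are dominated by one tame function. *)
Lemma expect_gen (f : T -> R) : tame W f -> expect pi (generator f) = 0.
Proof.
move=> tf; have [C [k [C0 fC]]] := tame_bound W_ge1 tf.
pose w x := (Num.truncn (W x)).+1.
pose fn (n : nat) x := f x * (w x < n)%N%:R.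
have W0 z : 0 <= W z by rewrite (le_trans ler01).
have fnf n x : `|fn n x| <= `|f x|.
  by rewrite normrM ler_piMr// normr_nat lern1 leq_b1.
have fn_bd n x : `|fn n x| <= C * n%:R ^+ k.
  rewrite /fn; case: ltnP => [wn|_]; last first.
    by rewrite mulr0 normr0 mulr_ge0// exprn_ge0.
  rewrite mulr1 (le_trans (fC x))// ler_wpM2l// lerXn2r ?nnegrE//.
  rewrite (le_trans (ltW (truncnS_gt (W x))))// ler_nat ltnW//.
pose G x := jump (fun z => `|f z|) x + tot x * `|f x|.
have tG : tame W G.
  apply: (tameD W_ge1); first by apply: tame_jump; exact: tame_norm.
  apply: (tameM W_ge1); first by apply: tame_jump; exact: tame_cst.
  exact: tame_norm.
have := @dominated_convergence _ _ _ pi setT measurableT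
  (fun n x => (generator (fn n) x)%:E) (fun x => (generator f x)%:E) (fun x => (G x)%:E)
  (fun n => mf _) (mf _).
case.
- apply/aeW => x _; apply: cvg_near_cst.
  near=> n; congr EFin; rewrite !genE; congr (_ - tot x * _).
    by near: n; exact: jump_cutoff.
  by rewrite /fn (_ : (w x < n)%N) ?mulr1//; near: n; exact: nbhs_infty_gt.
- exact: tame_integrable W_ge1 W_int _ tG.
- apply/aeW => x n _; rewrite lee_fin genE (le_trans (ler_normB _ _))// lerD//.
    apply: (le_trans (jump_norm _ x)); apply: jump_le => z; exact: fnf.
  have t0 : 0 <= tot x by exact: jump_ge0.
  by rewrite normrM (ger0_norm t0) ler_wpM2l.
move=> _ _; rewrite (expectE W_ge1 W_int (tame_gen tf)).
rewrite [X in X @ _ --> _](_ : _ = fun=> 0%E); last first.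
  apply/funext => n /=; rewrite -[LHS]/(\int[pi]_x _)%E.
  have tn : tame W (fn n) by apply: (tame_le _ tf) => //; exact: mfR.
  by rewrite (expectE W_ge1 W_int (tame_gen tn)) (expect_gen_bounded (fn_bd n)).
by move=> /(cvg_lim (@ereal_hausdorff R)); rewrite lim_cst// => -[].
Unshelve. all: by end_near. Qed.

End tame_gen.
End jumps.

(** * Transitions of the occupancy chain *)

Section states.
Variable N : nat.
Implicit Types s t : jsq_state N.
Local Notation Qn s j := (nth 0%N (jsq_seq s) j).

Lemma jsq_wfP (s : seq nat) : reflect
  [/\ forall j, (j < size s)%N -> (0 < nth 0 s j)%N,
      forall j, (nth 0 s j <= N)%N &
      forall j, (nth 0 s j.+1 <= nth 0 s j)%N] (jsq_wf N s).
Proof.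
apply: (iffP andP) => [[/(sortedP 0%N) so /(all_nthP 0%N) al]|[p le so]].
  split => [j /al/andP[]//|j|j].
    have [/al/andP[]//|sj] := ltnP j (size s).
    by rewrite nth_default.
  have [/so//|sj] := ltnP j.+1 (size s).
  by rewrite nth_default.
split; first by apply/(sortedP 0%N) => j _; exact: so.
by apply/(all_nthP 0%N) => j js; rewrite p//= le.
Qed.

Lemma jsq_gt0 s j : (j < size s)%N -> (0 < Qn s j)%N.
Proof. by have /jsq_wfP[h _ _] := jsq_seqP s; apply: h. Qed.

Lemma jsq_le s j : (Qn s j <= N)%N.
Proof. by have /jsq_wfP[_ h _] := jsq_seqP s; apply: h. Qed.

Lemma jsq_geS s j : (Qn s j.+1 <= Qn s j)%N.
Proof. by have /jsq_wfP[_ _ h] := jsq_seqP s; apply: h. Qed.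

Lemma jsq_state_eq s t : (forall j, Qn s j = Qn t j) -> s = t.
Proof.
move=> st; apply: val_inj => /=.
have sz (u v : jsq_state N) : (forall j, Qn u j = Qn v j) ->
    (size u <= size v)%N.
  move=> uv; rewrite leqNgt; apply/negP => vu.
  by have := jsq_gt0 vu; rewrite uv nth_default.
apply: (@eq_from_nth _ 0%N) => [|j _]; last exact: st.
by apply/eqP; rewrite eqn_leq !sz.
Qed.

(** For [N > 0] the incremented list is a state, see [jsq_arrE], and the
    default value of [insubd] does not occur. *)
Definition jsq_arr s : jsq_state N :=
  insubd s (incr_nth s (jsq_shortest s)).

(** The lists that encode states end with their last positive term, so that
    a term equal to 1 is dropped rather than decremented to 0. *)
Definition decr_nth (s : seq nat) j :=
  if nth 0 s j == 1%N then take j s else set_nth 0%N s j (nth 0 s j).-1.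

(** The state stays put when no server has exactly [j.+1] tasks, in which
    case the rate of this transition is 0. *)
Definition jsq_dep s j : jsq_state N :=
  if (Qn s j.+1 < Qn s j)%N then insubd s (decr_nth s j) else s.

Lemma jsq_shortest_lt s : (0 < N)%N -> (Qn s (jsq_shortest s) < N)%N.
Proof.
move=> N0; rewrite /jsq_shortest; set p := fun _ => _.
have [h|h] := boolP (has p s); first exact: (nth_find 0%N h).
by rewrite nth_default// hasNfind.
Qed.

Lemma jsq_before_shortest s j : (j < jsq_shortest s)%N -> Qn s j = N.
Proof.
move=> /(before_find 0%N)/negbT; rewrite -leqNgt => h.
by apply/eqP; rewrite eqn_leq h jsq_le.
Qed.

Lemma jsq_arrE s : (0 < N)%N ->
  jsq_arr s = incr_nth s (jsq_shortest s) :> seq nat.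
Proof.
move=> N0; rewrite /jsq_arr val_insubd.
set m := jsq_shortest s; rewrite (_ : jsq_wf N _ = true)//.
apply/jsq_wfP; split => j.
- rewrite size_incr_nth nth_incr_nth.
  case: (ltnP m (size s)) => [_ js|sm]; first by rewrite addn_gt0 (jsq_gt0 js) orbT.
  rewrite ltnS leq_eqVlt => /predU1P[->|jm]; first by rewrite eqxx.
  by rewrite addn_gt0 (jsq_before_shortest jm) N0 orbT.
- rewrite nth_incr_nth; case: eqP => [<-|_]; last exact: jsq_le.
  exact: jsq_shortest_lt.
- rewrite !nth_incr_nth; case: (m =P j.+1) => [mj|_].
    have Qj : Qn s j = N by apply: jsq_before_shortest; rewrite -/m mj ltnSn.
    rewrite Qj (leq_trans _ (leq_addl _ _))//.
    by have := jsq_shortest_lt s N0; rewrite -/m mj.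
  by rewrite (leq_trans (jsq_geS s j))// leq_addl.
Qed.

Lemma jsq_depE s j : (Qn s j.+1 < Qn s j)%N ->
  incr_nth (jsq_dep s j) j = s.
Proof.
move=> lt; have js : (j < size s)%N.
  by rewrite ltnNge; apply/negP => sj; rewrite (nth_default _ sj) in lt.
rewrite /jsq_dep lt val_insubd.
have nthd k : nth 0 (decr_nth s j) k = (nth 0 s k - (j == k))%N.
  rewrite /decr_nth; case: eqP => [s1|_].
    rewrite s1 in lt; have /eqP sz : size s == j.+1.
      rewrite eqn_leq js andbT leqNgt; apply/negP => /jsq_gt0.
      by case: (Qn s j.+1) lt.
    case: (ltngtP k j) => kj; first by rewrite nth_take// subn0.
      by rewrite !nth_default// ?sz// size_take js ltnW.
    by rewrite kj s1 nth_default// size_take js.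
  rewrite nth_set_nth/= eq_sym; case: eqP => [->|_]; last by rewrite subn0.
  by rewrite subn1.
have szd : size (decr_nth s j) = if Qn s j == 1%N then j else size s.
  rewrite /decr_nth; case: eqP => _; first by rewrite size_take js.
  by rewrite size_set_nth; apply/maxn_idPr.
rewrite (_ : jsq_wf N _ = true).
  apply: (@eq_from_nth _ 0%N) => [|k _].
    rewrite size_incr_nth szd; case: eqP => [s1|_]; last by rewrite js.
    rewrite ltnn; apply/eqP; rewrite eqn_leq js/= leqNgt.
    by apply/negP => /jsq_gt0; rewrite s1 in lt; case: (Qn s j.+1) lt.
  rewrite nth_incr_nth nthd; case: eqP => [<-|_]; last by rewrite subn0.
  by rewrite addnC subnK// (leq_trans _ lt).
apply/jsq_wfP; split => k; rewrite ?nthd.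
- rewrite szd; case: eqP => [_ kj|s1 ks].
    by rewrite (gtn_eqF kj) subn0 jsq_gt0// (ltn_trans kj).
  case: eqP => [<-|_]; last by rewrite subn0 jsq_gt0.
  by have := jsq_gt0 js; case: (Qn s j) s1 => [|[|n]].
- by rewrite (leq_trans (leq_subr _ _))// jsq_le.
- case: (j =P k) => [<-|_].
    by rewrite subn1 -ltnS (ltn_predK lt) (leq_ltn_trans (leq_subr _ _)).
  by rewrite subn0 (leq_trans (leq_subr _ _))// jsq_geS.
Qed.

End states.

Section rates.
Context (R : realType) (N : nat) (lam : R).
Hypothesis N_gt0 : (0 < N)%N.
Hypothesis lam_ge0 : 0 <= lam.
Implicit Types s t : jsq_state N.
Local Notation Qn s j := (nth 0%N (jsq_seq s) j).

(** The transitions behind [jsq_rate]: an arrival, and a departure from the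
    servers with exactly [j.+1] tasks for each [j]. *)
Definition jsq_trans s : seq (R * jsq_state N) :=
  (N%:R * lam, jsq_arr s) ::
  [seq ((Qn s j - Qn s j.+1)%N%:R, jsq_dep s j) | j <- index_iota 0 (size s)].

Lemma jsq_trans_ge0 s m : m \in jsq_trans s -> 0 <= m.1.
Proof.
rewrite inE => /predU1P[->|/mapP[j _ ->]]; last by rewrite /= ler0n.
by rewrite /= mulr_ge0.
Qed.

Lemma jump_jsqE f s : jump jsq_trans f s = N%:R * lam * f (jsq_arr s) +
  \sum_(0 <= j < size s) (Qn s j - Qn s j.+1)%N%:R * f (jsq_dep s j).
Proof. by rewrite /jump big_cons big_map. Qed.

Lemma gen_jsqE f s :
  generator jsq_trans f s = N%:R * lam * (f (jsq_arr s) - f s) +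
  \sum_(0 <= j < size s) (Qn s j - Qn s j.+1)%N%:R * (f (jsq_dep s j) - f s).
Proof. by rewrite /generator big_cons big_map. Qed.

Lemma sum_diffQ s k : (k <= size s)%N ->
  \sum_(k <= j < size s) (Qn s j - Qn s j.+1)%N%:R = (Qn s k)%:R :> R.
Proof.
move=> ks; rewrite (telescope_sumr_eq (fun j => - (Qn s j)%:R : R) _ ks).
  by rewrite [Qn s (size s)]nth_default// oppr0 add0r opprK.
by move=> j _; rewrite natrB ?jsq_geS// opprK addrC.
Qed.

Lemma jsq_tot s : jump jsq_trans (fun=> 1) s = N%:R * lam + (Qn s 0)%:R.
Proof.
rewrite jump_jsqE mulr1; congr (_ + _); rewrite -sum_diffQ//.
by apply: eq_bigr => j _; rewrite mulr1.
Qed.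

Lemma jsq_tot_le s : jump jsq_trans (fun=> 1) s <= N%:R * lam + N%:R.
Proof. by rewrite jsq_tot lerD2l ler_nat jsq_le. Qed.

Lemma jsq_rateE s t : jsq_rate lam s t =
  N%:R * lam * (t == incr_nth s (jsq_shortest s) :> seq nat)%:R +
  \sum_(0 <= j < size s)
    (Qn s j - Qn s j.+1)%N%:R * (s == incr_nth t j :> seq nat)%:R.
Proof. by rewrite /jsq_rate big_add1. Qed.

Lemma jsq_rate_ge0 s t : 0 <= jsq_rate lam s t.
Proof.
rewrite jsq_rateE addr_ge0 ?mulr_ge0//.
by apply: sumr_ge0 => j _; rewrite mulr_ge0.
Qed.

(** Each transition of the list is counted by one term of the rate. *)
Lemma jump_indic_le s t : s <> t ->
  jump jsq_trans (fun z => (z == t)%:R) s <= jsq_rate lam s t.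
Proof.
move=> st; rewrite jump_jsqE jsq_rateE lerD//.
  rewrite ler_wpM2l ?mulr_ge0// ler_nat; case: eqP => // <-.
  by rewrite jsq_arrE// eqxx.
apply: ler_sum => j _; have [lt|ge] := ltnP (Qn s j.+1) (Qn s j).
  rewrite ler_wpM2l// ler_nat; case: eqP => // <-.
  by rewrite jsq_depE// eqxx.
by move: ge; rewrite -subn_eq0 => /eqP ->; rewrite !mul0r.
Qed.

Lemma jump_indic_diag s : jump jsq_trans (fun z => (z == s)%:R) s = 0.
Proof.
rewrite jump_jsqE [jsq_arr s == s](_ : _ = false); last first.
  apply/eqP => /(congr1 (fun t : jsq_state N => Qn t (jsq_shortest s))).
  by rewrite jsq_arrE// nth_incr_nth eqxx => /esym/n_Sn.
rewrite mulr0 add0r big1// => j _.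
have [lt|ge] := ltnP (Qn s j.+1) (Qn s j).
  rewrite [jsq_dep s j == s](_ : _ = false) ?mulr0//.
  apply/eqP => e; have := jsq_depE lt.
  move=> /(congr1 (fun t : seq nat => nth 0%N t j)).
  by rewrite nth_incr_nth eqxx e => /esym/n_Sn.
by move: ge; rewrite -subn_eq0 => /eqP ->; rewrite !mul0r.
Qed.

Lemma sum_indic_uniq (r : seq (jsq_state N)) (p : pred (jsq_state N)) (c : R) :
  uniq r -> 0 <= c -> (forall s t, p s -> p t -> s = t) ->
  \sum_(z <- r) c * (p z)%:R <= c.
Proof.
move=> + c0 pu; elim: r => [|z r IH /= /andP[zr ur]]; first by rewrite big_nil.
rewrite big_cons; have [pz|_] := boolP (p z); last by rewrite mulr0 add0r IH.
rewrite mulr1 big1_seq ?addr0// => t /andP[_ tr].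
case: (boolP (p t)) => [pt|]; rewrite ?mulr0//.
by move: zr; rewrite (pu _ _ pz pt) tr.
Qed.

(** As a function of the target, each term of the rate is a multiple of the
    indicator of at most one state, so that summing over any finite set of
    targets gives at most the total rate of the transitions. *)
Lemma jsq_exit_le s :
  fine (\esum_(t in [set t | t <> s]) (jsq_rate lam s t)%:E)%E <=
  jump jsq_trans (fun=> 1) s.
Proof.
have t0 : 0 <= jump jsq_trans (fun=> 1) s.
  by apply: (jump_ge0 jsq_trans_ge0).
suff : (\esum_(t in [set t | t <> s]) (jsq_rate lam s t)%:E <=
    (jump jsq_trans (fun=> 1) s)%:E)%E.
  by case: (\esum_(_ in _) _)%E.
apply: ge_ereal_sup => _ [A [finA _] <-].
rewrite fsbig_finite//= sumEFin lee_fin.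
under eq_bigr do rewrite jsq_rateE.
rewrite big_split/= jump_jsqE mulr1 lerD//.
  apply: sum_indic_uniq; [exact: finmap.fset_uniq|exact: mulr_ge0|].
  by move=> t u /eqP tE /eqP uE; apply: val_inj; rewrite /= tE uE.
rewrite exchange_big/=; apply: ler_sum => j _; rewrite mulr1.
apply: sum_indic_uniq; [exact: finmap.fset_uniq|by []|] => t u /eqP tE /eqP uE.
apply: jsq_state_eq => k.
have : nth 0%N (incr_nth t j) k = nth 0%N (incr_nth u j) k by rewrite -tE -uE.
by rewrite !nth_incr_nth => /addnI.
Qed.

Section stationary.
Variables (P : R -> R.-pker (jsq_state N) ~> (jsq_state N)).
Variable pi : probability (jsq_state N) R.
Hypothesis P_jsq : ctmc_semigroup (jsq_rate lam) P.
Hypothesis pi_stationary : ctmc_stationary P pi.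

Lemma jsq_measurable (A : set (jsq_state N)) : measurable A.
Proof. by []. Qed.

Lemma jsq_inflow t :
  (\int[pi]_s (jump jsq_trans (fun z => (pickle z == pickle t)%:R) s)%:E
    <= (jump jsq_trans (fun=> 1) t)%:E * pi [set t])%E.
Proof.
have e : (fun z : jsq_state N => (pickle z == pickle t)%:R : R) =
    fun z => (z == t)%:R.
  by apply/funext => z; rewrite (inj_eq (pcan_inj pickleK)).
rewrite e.
have := inflow_le jsq_measurable P_jsq pi_stationary
  (fun s t _ => jsq_rate_ge0 s t) (jsq_exit_le t).
apply: le_trans; rewrite [leRHS]integral_mkcond.
apply: ge0_le_integral => //.
- by move=> s _; rewrite lee_fin (jump_ge0 jsq_trans_ge0).
- move=> s _; rewrite patchE; case: ifPn => [|/negP].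
    by rewrite inE => st; rewrite lee_fin jump_indic_le.
  by rewrite inE => /contrapT ->; rewrite jump_indic_diag.
Qed.

End stationary.
End rates.

(** * The idle servers and the excess tasks *)

Section statistics.
Context (R : realType) (N : nat) (lam : R).
Hypothesis N_gt0 : (0 < N)%N.
Implicit Types s t : jsq_state N.
Local Notation Qn s j := (nth 0%N (jsq_seq s) j).
Local Notation gen := (generator (@jsq_trans R N lam)).

Definition idle s : nat := (N - Qn s 0)%N.

(** The waiting tasks, that is, all but the first task of each server;
    [above2] counts those in third position or later. *)
Definition excess s : nat := sumn (behead s).
Definition above2 s : nat := sumn (drop 2 s).

Lemma excessE s : excess s = (Qn s 1 + above2 s)%N.
Proof. by rewrite /excess /above2; case: (jsq_seq s) => [|a [|b r]]//=; rewrite drop0. Qed.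

Lemma idle_le s : (idle s <= N)%N.
Proof. exact: leq_subr. Qed.

Lemma idleQ2_le s : (idle s + Qn s 1 <= N)%N.
Proof. by rewrite /idle -leq_subRL ?leq_subr// subKn ?jsq_le// jsq_geS. Qed.

Lemma jsq_SE s : (jsq_S s + idle s = N + excess s)%N.
Proof.
rewrite /jsq_S /idle /excess; case: s => -[|a r] /= w.
  by rewrite subn0 addnC.
have /jsq_wfP[_ /(_ 0%N)/= aN _] := w.
by rewrite addnAC addnC; clear -aN; lia.
Qed.

Lemma sumn_incr_nth (s : seq nat) j : sumn (incr_nth s j) = (sumn s).+1.
Proof.
elim: s j => [|a r IH] [|j] //=; last by rewrite IH addnS.
by elim: j.
Qed.

Lemma sumn_behead_incr (s : seq nat) j :
  sumn (behead (incr_nth s j)) = (sumn (behead s) + (0 < j))%N.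
Proof.
case: s j => [|a r] [|j] //=; rewrite ?addn0// ?sumn_incr_nth ?addn1//.
by elim: j.
Qed.

Lemma shortest_gt0 s : (0 < jsq_shortest s)%N = (idle s == 0%N).
Proof.
rewrite /idle subn_eq0; apply/idP/idP => [/jsq_before_shortest ->//|].
have := jsq_shortest_lt s N_gt0; case: (jsq_shortest s) => [|m]//.
by rewrite ltnNge => /negP.
Qed.

Lemma idle_arr s : idle (jsq_arr s) = (idle s).-1.
Proof.
rewrite /idle jsq_arrE// nth_incr_nth -[_ == 0%N]negbK -lt0n shortest_gt0.
rewrite -/(idle s); case: eqP => [i0|/eqP]; rewrite ?add0n/= ?add1n ?subnS//.
by rewrite -/(idle s) i0.
Qed.

Lemma excess_arr s : excess (jsq_arr s) = (excess s + (idle s == 0%N))%N.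
Proof. by rewrite /excess jsq_arrE// sumn_behead_incr shortest_gt0. Qed.

Lemma idle_dep s j : (Qn s j.+1 < Qn s j)%N ->
  idle (jsq_dep s j) = (idle s + (j == 0%N))%N.
Proof.
move=> lt; have /(congr1 (fun t : seq nat => nth 0%N t 0)) := jsq_depE lt.
rewrite nth_incr_nth /idle; have := jsq_le s 0; case: eqP => _; lia.
Qed.

Lemma excess_dep s j : (Qn s j.+1 < Qn s j)%N ->
  (excess (jsq_dep s j) + (0 < j) = excess s)%N.
Proof.
move=> lt; have /(congr1 (fun t : seq nat => sumn (behead t))) := jsq_depE lt.
by rewrite sumn_behead_incr.
Qed.

(** An arrival takes an idle server if there is one and waits otherwise; a
    departure leaves its server idle if it had one task and removes a
    waiting task if it had more. Only the departure rates see more of the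
    state than the pair (idle, excess), and only through the number of
    servers with at least two tasks. *)
Lemma gen_idle_excess (F : nat -> nat -> R) s :
  gen (fun s => F (idle s) (excess s)) s =
  N%:R * lam * (F (idle s).-1 (excess s + (idle s == 0))%N - F (idle s) (excess s))
  + (N%:R - (idle s)%:R - (Qn s 1)%:R)
      * (F (idle s).+1 (excess s) - F (idle s) (excess s))
  + (Qn s 1)%:R * (F (idle s) (excess s).-1 - F (idle s) (excess s)).
Proof.
rewrite gen_jsqE idle_arr excess_arr -addrA; congr (_ + _).
have Q1 : N%:R - (idle s)%:R = (Qn s 0)%:R :> R.
  by rewrite /idle natrB ?jsq_le// subKr.
rewrite Q1; have [s0|s0] := posnP (size s).
  by rewrite s0 big_geq// !nth_default ?s0// subrr !mul0r addr0.
rewrite big_ltn//; congr (_ + _).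
  have [lt|ge] := ltnP (Qn s 1) (Qn s 0).
    rewrite idle_dep// addn1 natrB ?jsq_geS//.
    by have := excess_dep lt; rewrite addn0 => ->.
  have -> : Qn s 0 = Qn s 1 by apply/eqP; rewrite eqn_leq ge jsq_geS.
  by rewrite subnn subrr !mul0r.
rewrite -sum_diffQ// mulr_suml; apply: eq_big_nat => j /andP[j0 _].
have [lt|ge] := ltnP (Qn s j.+1) (Qn s j).
  rewrite idle_dep//; have := excess_dep lt; rewrite (gtn_eqF j0) j0 addn0.
  by rewrite addn1 => <-.
by move: ge; rewrite -subn_eq0 => /eqP ->; rewrite !mul0r.
Qed.

Definition wsum (w : nat -> R) (s : seq nat) : R :=
  \sum_(0 <= j < size s) w j * (nth 0%N s j)%:R.

Lemma wsum_widen w (s : seq nat) n : (size s <= n)%N ->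
  wsum w s = \sum_(0 <= j < n) w j * (nth 0%N s j)%:R.
Proof.
move=> sn; rewrite [RHS](@big_cat_nat _ _ _ (size s))//=.
rewrite [X in _ + X]big_nat_cond [X in _ + X]big1 ?addr0// => j.
by move=> /andP[/andP[sj _] _]; rewrite nth_default// mulr0.
Qed.

Lemma wsum_incr w (s : seq nat) j : wsum w (incr_nth s j) = wsum w s + w j.
Proof.
set n := maxn (size (incr_nth s j)) (maxn (size s) j.+1).
rewrite !(@wsum_widen _ _ n) ?leq_max ?leqnn ?orbT//.
have jn : (j < n)%N by rewrite !leq_max leqnn !orbT.
rewrite !big_mkord (bigD1 (Ordinal jn))//=.
rewrite [X in _ = X + _](bigD1 (Ordinal jn))//= nth_incr_nth eqxx natrD mulrDr mulr1.
rewrite [RHS]addrC -!addrA; congr (_ + (_ + _)); apply: eq_bigr => k kj.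
by rewrite nth_incr_nth (_ : (j == k) = false)//; apply: contraNF kj => /eqP e; apply/eqP/val_inj.
Qed.

Lemma gen_wsum (w : nat -> R) s :
  gen (fun s => wsum w s) s = N%:R * lam * w (jsq_shortest s)
  - \sum_(0 <= j < size s) (Qn s j - Qn s j.+1)%N%:R * w j.
Proof.
rewrite gen_jsqE jsq_arrE// wsum_incr [_ + w _]addrC addrK; congr (_ + _).
rewrite -[RHS]sumrN; apply: eq_bigr => j _.
have [lt|ge] := ltnP (Qn s j.+1) (Qn s j).
  by rewrite -[in wsum w s](jsq_depE lt) wsum_incr opprD addrA subrr add0r mulrN.
by move: ge; rewrite -subn_eq0 => /eqP ->; rewrite !mul0r oppr0.
Qed.

End statistics.

(** * A Lyapunov function for queues of length at least three *)

Section lyapunov.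
Context (R : realType) (N : nat) (tau : R).
Hypothesis N_gt0 : (0 < N)%N.
Hypothesis tau_gt0 : 0 < tau.
Hypothesis tau_le : tau <= 8^-1.
Hypothesis Ntau : 16 <= N%:R * tau.
Implicit Types s t : jsq_state N.
Local Notation Qn s j := (nth 0%N (jsq_seq s) j).
Local Notation gen := (generator (@jsq_trans R N (1 - tau))).

Let delta := tau / 8.
Let r := 1 + delta.
Let a := 1 - tau / 2.
Let M := (N %/ 4)%N.

Hypothesis rM : 16 * N%:R / tau <= r ^+ (2 * M).

(** The first part of the Lyapunov function increases exponentially with
    the excess and is smaller, by a factor in [3/4, 1], when many servers
    are idle. It decreases in mean as soon as a quarter of the servers have
    a waiting task, see [lyap_rate_neg]. *)
Definition lyap_main i y : R := r ^+ y * (3 / 4 + a ^+ i / 4).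

(** The second part charges the tasks in third position or later. It
    increases only at an arrival that finds two tasks at every server, and
    then the first part decreases enough to pay for it. *)
Definition lyap_weight j : R :=
  if (j < 2)%N then 0 else tau ^+ 2 / 64 * r ^+ (j.-1 * N).
Definition lyap s := lyap_main (idle s) (excess s) + wsum lyap_weight s.

Let tau_lt1 : tau < 1. Proof. by move: tau_le; lra. Qed.
Let delta_gt0 : 0 < delta. Proof. by rewrite divr_gt0. Qed.
Let r_ge1 : 1 <= r. Proof. by rewrite lerDl ltW. Qed.
Let r_gt0 : 0 < r. Proof. exact: lt_le_trans r_ge1. Qed.
Let a_ge0 : 0 <= a. Proof. by move: tau_lt1; rewrite /a; lra. Qed.
Let a_le1 : a <= 1. Proof. by move: tau_gt0; rewrite /a; lra. Qed.
Let rX_gt0 n : 0 < r ^+ n. Proof. exact: exprn_gt0. Qed.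

(** By Bernoulli's inequality [a ^- i >= (1 + tau / 2) ^+ i >= 1 + i * tau
    / 2]. *)
Lemma idle_decay i : i%:R * a ^+ i * tau <= 2 * (1 - a ^+ i).
Proof.
have x0 : 0 <= tau / 2 by rewrite divr_ge0// ltW.
have h : a ^+ i * (1 + i%:R * (tau / 2)) <= 1.
  apply: (@le_trans _ _ (a ^+ i * (1 + tau / 2) ^+ i)).
    by rewrite ler_wpM2l ?exprn_ge0// bernoulli.
  rewrite -exprMn exprn_ile1// /a; first by rewrite mulr_ge0// addr_ge0.
  by nra.
by lra.
Qed.

Let a_Xle1 i : a ^+ i <= 1. Proof. exact: exprn_ile1. Qed.
Let a_Xge0 i : 0 <= a ^+ i. Proof. exact: exprn_ge0. Qed.

(** An upper bound for the generator of the first part divided by [delta *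
    r ^+ y], where [i] is the number of idle servers and [q] the number of
    servers with a waiting task. *)
Definition lyap_rate i (q : R) : R :=
  if i is i'.+1 then
    N%:R * (1 - tau) * a ^+ i' - (N%:R - i%:R - q) * a ^+ i
    - q * (3 / 4 + a ^+ i / 4) * (1 - delta)
  else q * delta - N%:R * tau.

(** Equality up to the departures of waiting tasks, which decrease [r ^+ y]
    by [delta / r] relatively; this is replaced by the smaller [delta * (1
    - delta)]. *)
Lemma gen_lyap_main s :
  gen (fun s => lyap_main (idle s) (excess s)) s <=
  delta * r ^+ excess s * lyap_rate (idle s) (Qn s 1)%:R.
Proof.
rewrite gen_idle_excess//; move: (idle s) => i; set y := excess s.
set q : R := (Qn s 1)%:R.
have q0 : 0 <= q by rewrite ler0n.
have down (phi : R) : 0 <= phi ->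
    q * (r ^+ y.-1 * phi - r ^+ y * phi) <= - (q * phi * (1 - delta)) * (delta * r ^+ y).
  move=> phi0; rewrite -mulrBl; case: (posnP y) => [y0|y0].
    have -> : q = 0.
      by apply/eqP; rewrite pnatr_eq0; move: y0; rewrite /y excessE; clear; lia.
    by rewrite !mul0r oppr0 mul0r.
  rewrite -[in r ^+ y](prednK y0) exprS.
  set z := r ^+ y.-1; have z0 : 0 < z by exact: rX_gt0.
  rewrite -subr_ge0 [X in 0 <= X](_ : _ = q * phi * z * delta ^+ 3); last first.
    by rewrite /r; ring.
  by rewrite !mulr_ge0// ?exprn_ge0// ltW.
case: i => [|i]; rewrite /lyap_main /= ?addn1 ?addn0.
- have /= := down 1 ler01.
  rewrite expr0 expr1 (_ : 3 / 4 + 1 / 4 = 1); last by field.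
  move=> h; rewrite (le_trans (lerD (lexx _) h))// exprS.
  by rewrite le_eqVlt; apply/orP; left; apply/eqP; rewrite /r /a /delta; field.
- have h := down (3 / 4 + a ^+ i.+1 / 4).
rewrite (le_trans (lerD (lexx _) (h _)))//.
  by rewrite addr_ge0// divr_ge0.
rewrite le_eqVlt; apply/orP; left; apply/eqP.
rewrite ![a ^+ _.+1]exprS; move: (r ^+ y) (a ^+ i) => ry ai.
by rewrite /a /delta; field.
Qed.

Lemma lyap_rate_le i (q : nat) : (i + q <= N)%N -> lyap_rate i q%:R <= N%:R.
Proof.
move=> iqN; have qN : q%:R <= N%:R :> R by rewrite ler_nat (leq_trans _ iqN)// leq_addl.
have q0 : 0 <= q%:R :> R by [].
have N0 : 0 <= N%:R :> R by [].
have qt : q%:R * tau <= N%:R * tau by rewrite ler_wpM2r// ltW.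
have Nt : 0 <= N%:R * tau by rewrite mulr_ge0// ltW.
case: i iqN => [|i] iqN /=; first by rewrite /delta; lra.
have iq : i.+1%:R + q%:R <= N%:R :> R by rewrite -natrD ler_nat.
have h1 : 0 <= q%:R * (3 / 4 + a ^+ i.+1 / 4) * (1 - delta).
  have d1 : 0 <= 1 - delta by move: tau_le; rewrite /delta; lra.
  by rewrite mulr_ge0// mulr_ge0// addr_ge0// divr_ge0.
have h2 : (i.+1%:R + q%:R) * a ^+ i.+1 <= N%:R.
  by rewrite (le_trans _ iq)// ler_piMr ?addr_ge0.
have h3 : 0 <= N%:R * (tau / 2) * a ^+ i.
  by rewrite !mulr_ge0// ?divr_ge0// ltW.
move: h1 h2 h3; rewrite exprS; set ai := a ^+ i; rewrite /a; lra.
Qed.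

(** Without idle servers, the arrivals at rate [N * (1 - tau)] are
    outweighed by the departures at rate [N]: each event changes the first
    part by about [delta * r ^+ y], through the excess or through the
    factor [a]. With [i] idle servers, the departures of waiting tasks gain
    [3/4 * q * (1 - a ^+ i)], which exceeds the loss [i * a ^+ i] by
    [idle_decay] because [N * tau >= 16]; what remains is [- N * tau / 2 *
    a ^+ i]. *)
Lemma lyap_rate_neg i (q : nat) : (i + q <= N)%N -> (N <= 4 * q)%N ->
  lyap_rate i q%:R <= - (3 / 8) * (N%:R * tau).
Proof.
move=> iqN Nq; have qN : q%:R <= N%:R :> R by rewrite ler_nat (leq_trans _ iqN)// leq_addl.
have q4 : N%:R / 4 <= q%:R :> R.
  by rewrite ler_pdivrMr// -natrM ler_nat mulnC.
have q0 : 0 <= q%:R :> R by [].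
have N0 : 0 <= N%:R :> R by [].
have Nt0 : 0 <= N%:R * tau by rewrite mulr_ge0// ltW.
case: i iqN => [|i] iqN /=.
  by rewrite /delta; have := ler_wpM2r (ltW tau_gt0) qN; lra.
set A := a ^+ i.+1; have A0 : 0 <= A by exact: a_Xge0.
have A1 : A <= 1 by exact: a_Xle1.
have dec : i.+1%:R * A <= N%:R / 8 * (1 - A).
  have := idle_decay i.+1; rewrite -/A => h.
  rewrite -(ler_pM2r tau_gt0) (le_trans h)//.
  have : 0 <= (1 - A) * (N%:R * tau - 16) by rewrite mulr_ge0 ?subr_ge0.
  by lra.
have AE : A = a ^+ i * (1 - tau / 2) by rewrite /A exprS mulrC.
have Ale : A <= a ^+ i by rewrite AE ler_piMr// /a; move: tau_gt0; lra.
have e1 : N%:R * (1 - tau) * a ^+ i - N%:R * A <= - (N%:R * tau / 2) * A.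
  have : 0 <= N%:R * tau / 2 * (a ^+ i - A) by rewrite mulr_ge0 ?subr_ge0// divr_ge0.
  have : N%:R * A = N%:R * (a ^+ i * (1 - tau / 2)) by rewrite -AE.
  by lra.
have e2 : q%:R * delta * (3 / 4 + A / 4) <= N%:R * tau / 8.
  rewrite (@le_trans _ _ (q%:R * delta))//; last first.
    by rewrite /delta mulrA ler_pM2r ?invr_gt0// ler_wpM2r// ltW.
  by rewrite ler_piMr//; [rewrite mulr_ge0// ltW|lra].
have e3 : N%:R / 4 * (3 / 4 * (1 - A)) <= q%:R * (3 / 4 * (1 - A)).
  by rewrite ler_wpM2r// mulr_ge0 ?subr_ge0.
have e4 : N%:R * tau / 2 * (1 - A) <= N%:R / 16 * (1 - A).
  rewrite ler_wpM2r ?subr_ge0//.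
  by have := ler_wpM2l N0 tau_le; lra.
by move: e1 e2 e3 e4 dec; lra.
Qed.

Lemma sumn_ge (c k : nat) (u : seq nat) :
  (forall j, (j < k)%N -> nth 0%N u j = c) -> (k * c <= sumn u)%N.
Proof.
elim: k u => [|k IH] u uc; first by rewrite mul0n.
case: u uc => [|x u] uc.
  by rewrite -(uc 0%N)//= muln0.
rewrite mulSn /= (uc 0%N isT : x = c) leq_add2l; apply: IH => j jk.
exact: (uc j.+1).
Qed.

Lemma sumn_le (c : nat) (u : seq nat) :
  (forall j, nth 0%N u j <= c)%N -> (sumn u <= size u * c)%N.
Proof.
elim: u => [|x u IH] uc //=; rewrite mulSn leq_add//; first exact: (uc 0%N).
by apply: IH => j; exact: (uc j.+1).
Qed.

Lemma jsq_leQ2 s j : (Qn s j.+1 <= Qn s 1)%N.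
Proof. by elim: j => // j IH; rewrite (leq_trans (jsq_geS s _)). Qed.

Lemma excess_ge s : ((jsq_shortest s).-1 * N <= excess s)%N.
Proof.
rewrite /excess; apply: sumn_ge => j jm; rewrite nth_behead.
by apply: jsq_before_shortest; clear -jm; lia.
Qed.

Lemma excess_le s : (excess s <= (size s).-1 * Qn s 1)%N.
Proof.
rewrite /excess -size_behead; apply: sumn_le => j.
by rewrite nth_behead jsq_leQ2.
Qed.

(** Half of the rate at which departures from the longest queues decrease
    the second part: there is at least one such queue, and it has length
    [size s]. *)
Definition lyap_drain s : R :=
  if (2 < size s)%N then tau ^+ 2 / 128 * r ^+ ((size s - 2) * N) else 0.

Lemma lyap_drain_ge0 s : 0 <= lyap_drain s.
Proof.
by rewrite /lyap_drain; case: ifP => // _; rewrite mulr_ge0// ?divr_ge0 ?exprn_ge0// ltW.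
Qed.

Lemma lyap_weight_ge0 j : 0 <= lyap_weight j.
Proof.
by rewrite /lyap_weight; case: ifP => // _; rewrite mulr_ge0// ?divr_ge0 ?exprn_ge0// ltW.
Qed.

Lemma drain_le s : 2 * lyap_drain s <=
  \sum_(0 <= j < size s) (Qn s j - Qn s j.+1)%N%:R * lyap_weight j.
Proof.
have pos j : 0 <= (Qn s j - Qn s j.+1)%N%:R * lyap_weight j.
  by rewrite mulr_ge0// lyap_weight_ge0.
rewrite /lyap_drain; case: ifP => [s2|_]; last by rewrite mulr0 sumr_ge0.
have sE : size s = (size s).-1.+1 by clear -s2; lia.
have s1 : ((size s).-1 < 2)%N = false by clear -s2; lia.
have s3 : (size s).-1.-1 = (size s - 2)%N by clear -s2; lia.
rewrite [in X in _ <= X]sE big_nat_recr//= -[leLHS]add0r lerD ?sumr_ge0//.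
rewrite -sE [nth _ _ (size s)]nth_default// subn0.
have Q1 : 1 <= (Qn s (size s).-1)%:R :> R.
  by rewrite ler1n jsq_gt0// [in ltnRHS]sE.
rewrite -[leLHS]mul1r ler_pM//.
  by rewrite mulr_ge0// mulr_ge0 ?exprn_ge0// ?divr_ge0 ?exprn_ge0// ltW.
rewrite /lyap_weight s1 s3.
by rewrite le_eqVlt; apply/orP; left; apply/eqP; field.
Qed.

(** Three cases. If every server has two tasks, the decrease of the first
    part pays for an arrival in third position. If at least a quarter of
    the servers, but not all, have a waiting task, the first part decreases
    and no arrival charges the second. Otherwise the excess is at most [(L
    - 1) * N / 4], where [L] is the length of the longest queue: for [L <=
    2] the increase of the first part is below the constant, and for [L >=
    3] the drain, of order [r ^+ ((L - 2) * N)], outweighs it, as the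
    exponents differ by at least [N / 2]. *)
Lemma lyap_drift s : gen lyap s <= N%:R * r ^+ M - lyap_drain s.
Proof.
have N0 : 0 < N%:R :> R by rewrite ltr0n.
have y0 := rX_gt0 (excess s).
rewrite /lyap genD gen_wsum//.
have D0 := lyap_drain_ge0 s.
have := drain_le s; set D := \sum_(_ <= _ < _) _ => hD.
have := gen_lyap_main s; set G := generator _ _ _ => hG.
have c0 : 0 <= delta * r ^+ excess s by rewrite mulr_ge0 ?ltW.
have rM0 : 0 <= N%:R * r ^+ M by rewrite mulr_ge0 ?ltW.
have iq := idleQ2_le s.
have hG1 : G <= delta * r ^+ excess s * N%:R.
  by rewrite (le_trans hG)// ler_wpM2l// lyap_rate_le.
have hG2 : (N <= 4 * Qn s 1)%N ->
    G <= - (3 / 64 * (tau ^+ 2 * N%:R * r ^+ excess s)).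
  move=> Nq; rewrite (le_trans hG)//.
  rewrite (le_trans (ler_wpM2l c0 (lyap_rate_neg iq Nq)))//.
  by rewrite le_eqVlt; apply/orP; left; apply/eqP; rewrite /delta; field.
have T0 : 0 <= tau ^+ 2 * N%:R * r ^+ excess s.
  by rewrite !mulr_ge0 ?exprn_ge0// ltW.
case: (ltnP (jsq_shortest s) 2) => [m2|m2]; last first.
  have qN : Qn s 1 = N by apply: jsq_before_shortest.
  have {}hG2 : G <= - (3 / 64 * (tau ^+ 2 * N%:R * r ^+ excess s)).
    by apply: hG2; rewrite qN leq_pmull.
  have w_le : lyap_weight (jsq_shortest s) <= tau ^+ 2 / 64 * r ^+ excess s.
    rewrite /lyap_weight ltnNge m2/= ler_wpM2l ?divr_ge0 ?exprn_ge0//; last first.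
      by rewrite ler_weXn2l// excess_ge.
    by rewrite ltW.
  have : N%:R * (1 - tau) * lyap_weight (jsq_shortest s) <=
      N%:R * (tau ^+ 2 / 64 * r ^+ excess s).
    apply: ler_pM => //; rewrite ?lyap_weight_ge0//.
      by rewrite mulr_ge0// ?subr_ge0 ltW.
    by rewrite ler_piMr ?(ltW N0)// gerBl ltW.
  move: hG2 hD; rewrite mulrA mulrA; lra.
rewrite {1}/lyap_weight m2 mulr0 sub0r.
case: (leqP (Qn s 1) M) => [qM|Mq]; last first.
  have Nq : (N <= 4 * Qn s 1)%N by move: Mq; rewrite /M; clear; lia.
  by have := hG2 Nq; lra.
have delta1 : delta <= 1 by move: tau_le; rewrite /delta; lra.
have := excess_le s; case: (leqP (size s) 2) => [s2|s2] yle.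
  have yM : (excess s <= M)%N.
    by rewrite (leq_trans yle)// -[leqRHS]mul1n leq_mul//; clear -s2; lia.
  have : delta * r ^+ excess s * N%:R <= N%:R * r ^+ M.
    rewrite mulrC ler_wpM2l ?(ltW N0)// -[leRHS]mul1r.
    by rewrite ler_pM ?(ltW delta_gt0) ?(ltW y0)// ler_weXn2l.
  have : lyap_drain s = 0 by rewrite /lyap_drain ltnNge s2.
  by lra.
suff : delta * r ^+ excess s * N%:R <= lyap_drain s by lra.
rewrite /lyap_drain s2.
set k := (size s - 2)%N; have k0 : (0 < k)%N by rewrite /k; clear -s2; lia.
have y_le : (excess s <= k * (2 * M))%N.
  by rewrite (leq_trans yle)// mulnA leq_mul//; rewrite /k; clear -s2; lia.
have kN : (2 * M + k * (2 * M) <= k * N)%N.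
  have M4 : (4 * M <= N)%N by rewrite /M; clear; lia.
  have := leq_mul (leqnn k) M4; have := leq_mul k0 (leqnn (2 * M)%N).
  by clear; lia.
have w0 : 0 <= tau ^+ 2 / 128 by rewrite divr_ge0// exprn_ge0// ltW.
apply: (@le_trans _ _ (tau ^+ 2 / 128 * (r ^+ (2 * M) * r ^+ (k * (2 * M))))).
  apply: (@le_trans _ _ (tau ^+ 2 / 128 * (16 * N%:R / tau * r ^+ (excess s)))).
    rewrite le_eqVlt; apply/orP; left; apply/eqP; rewrite /delta; field.
    by rewrite gt_eqF.
  rewrite ler_wpM2l// ler_pM ?(ltW y0)//; last by rewrite ler_weXn2l.
  by rewrite ltW// divr_gt0// mulr_gt0.
by rewrite ler_wpM2l// -exprD ler_weXn2l.
Qed.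

End lyapunov.

Section above2_moments.
Context (R : realType) (N : nat) (tau : R).
Hypothesis N_gt0 : (0 < N)%N.
Hypothesis tau_gt0 : 0 < tau.
Hypothesis tau_le : tau <= 8^-1.
Hypothesis Ntau : 16 <= N%:R * tau.
Implicit Types s t : jsq_state N.
Local Notation r := (1 + tau / 8).
Local Notation M := (N %/ 4)%N.
Hypothesis rM : 16 * N%:R / tau <= r ^+ (2 * M).
Variables (P : R -> R.-pker (jsq_state N) ~> (jsq_state N)).
Variable pi : probability (jsq_state N) R.
Hypothesis P_jsq : ctmc_semigroup (jsq_rate (1 - tau)) P.
Hypothesis pi_stationary : ctmc_stationary P pi.

Let tau_lam : 0 <= 1 - tau. Proof. by move: tau_le; lra. Qed.

Lemma drain_integral :
  (\int[pi]_s (lyap_drain tau s)%:E <= (N%:R * r ^+ M)%:E)%E.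
Proof.
have r0 : 0 <= r by rewrite addr_ge0// divr_ge0// ltW.
apply: (drift_bound (@jsq_measurable N) (pcan_inj pickleK)
  (jsq_trans_ge0 tau_lam) (jsq_tot_le _)
  (jsq_inflow N_gt0 tau_lam P_jsq pi_stationary)
  (V := lyap tau)).
- by rewrite mulr_ge0// exprn_ge0.
- move=> s; rewrite addr_ge0//.
    rewrite /lyap_main mulr_ge0 ?exprn_ge0// addr_ge0// divr_ge0// exprn_ge0//.
    by move: tau_le; lra.
  by rewrite sumr_ge0// => j _; rewrite mulr_ge0// lyap_weight_ge0.
- by move=> s; exact: lyap_drain_ge0.
- by move=> s; exact: lyap_drift.
Qed.

Lemma above2_le s : (above2 s <= (size s - 2) * N)%N.
Proof.
rewrite /above2 -size_drop; apply: sumn_le => j.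
by rewrite nth_drop jsq_le.
Qed.

(** For fixed [p] this is smaller than any given negative power of [N] once
    [q] is large, since [N * tau] grows like a power of [N]. *)
Definition above2_bound p q : R :=
  N%:R ^+ p * (32 * q%:R / (N%:R * tau)) ^+ q * (128 * N%:R / tau ^+ 2).

(** When the longest queue has length [L >= 3] the drain is [r ^+ ((L - 2)
    * N)] up to a constant, whereas its mean is at most [N * r ^+ (N / 4)].
    The quotient of the two powers of [r] beats any power of [(L - 2) * N],
    which bounds [above2]. *)
Lemma above2_moment p q : (0 < p <= q)%N ->
  (\int[pi]_s ((above2 s)%:R ^+ p)%:E <= (above2_bound p q)%:E)%E.
Proof.
move=> /andP[p0 pq]; have q0 := leq_trans p0 pq.
have NR : 0 < N%:R :> R by rewrite ltr0n.
have qR : 0 < q%:R :> R by rewrite ltr0n.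
have r0 : 0 < r by rewrite addr_gt0// divr_gt0.
pose c : R := N%:R ^+ p * (32 * q%:R / (N%:R * tau)) ^+ q * (128 / tau ^+ 2 / r ^+ M).
have b0 : 0 <= N%:R ^+ p * (32 * q%:R / (N%:R * tau)) ^+ q.
  by rewrite mulr_ge0 ?exprn_ge0 ?(ltW NR)// divr_ge0 ?mulr_ge0 ?(ltW NR) ?(ltW tau_gt0).
have c0 : 0 <= c.
  by rewrite mulr_ge0// divr_ge0 ?exprn_ge0 ?(ltW r0)// divr_ge0 ?exprn_ge0 ?(ltW tau_gt0).
have -> : above2_bound p q = c * (N%:R * r ^+ M).
  rewrite /above2_bound /c; field.
  by rewrite !gt_eqF ?exprn_gt0 ?ltr0n//.
rewrite EFinM; apply: le_trans (lee_wpmul2l _ drain_integral); last first.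
  by rewrite lee_fin.
have d0 := lyap_drain_ge0 tau_gt0.
rewrite -ge0_integralZl//; last by move=> s _; rewrite lee_fin d0.
apply: ge0_le_integral => //.
move=> s _; rewrite -EFinM lee_fin.
have [s2|s2] := leqP (size s) 2.
  have -> : above2 s = 0%N by have := above2_le s; clear -s2; lia.
  by rewrite expr0n -(prednK p0)/= mulr_ge0.
rewrite /lyap_drain s2; set k := (size s - 2)%N.
have k1 : (0 < k)%N by rewrite /k; clear -s2; lia.
have kR : 1 <= k%:R :> R by rewrite ler1n.
apply: (@le_trans _ _ ((k%:R * N%:R) ^+ p)).
  by rewrite lerXn2r ?nnegrE ?mulr_ge0// -natrM ler_nat above2_le.
have MkN : (M <= k * N)%N.
  by rewrite (leq_trans (leq_div N 4))// leq_pmull.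
have kNM : (k * N = M + (k * N - M))%N by rewrite subnKC.
have z_ge : k%:R * N%:R / 2 <= (k * N - M)%N%:R :> R.
  rewrite ler_pdivrMr// -!natrM ler_nat mulnBl leq_subRL; last first.
    by rewrite leq_pmul2r.
  rewrite [leqRHS]muln2 -addnn leq_add2r (leq_trans _ (leq_pmull N k1))//.
  by clear; lia.
have := @expr_ge_polynomial R (tau / 8) (k * N - M) q.
rewrite divr_ge0 ?(ltW tau_gt0)//= => /(_ _ q0) h.
have {h} h : (tau * (k%:R * N%:R) / (32 * q%:R)) ^+ q <= r ^+ (k * N - M).
  apply: le_trans (h _); last by move: tau_le; lra.
  rewrite lerXn2r ?nnegrE ?divr_ge0 ?mulr_ge0 ?(ltW tau_gt0)//.
  have -> : tau * (k%:R * N%:R) / (32 * q%:R) = tau / 8 * (k%:R * N%:R / 2) / (2 * q%:R).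
    by field; rewrite pnatr_eq0 -lt0n.
  by rewrite ler_pM2r ?invr_gt0 ?mulr_gt0// ler_wpM2l// divr_ge0// ltW.
rewrite [leRHS](_ : _ = N%:R ^+ p * (32 * q%:R / (N%:R * tau)) ^+ q * r ^+ (k * N - M)).
  2: { rewrite [in r ^+ (k * N)]kNM exprD /c; field.
       by rewrite !gt_eqF ?exprn_gt0 ?ltr0n//. }
apply: (@le_trans _ _ (N%:R ^+ p * (32 * q%:R / (N%:R * tau)) ^+ q *
   (tau * (k%:R * N%:R) / (32 * q%:R)) ^+ q)); last first.
  by rewrite ler_wpM2l.
rewrite -mulrA -[X in _ <= _ * X]exprMn [leLHS]exprMn [leLHS]mulrC.
rewrite ler_wpM2l ?exprn_ge0//.
rewrite (_ : _ * _ = k%:R).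
  by rewrite ler_weXn2l.
by field; rewrite !gt_eqF ?ltr0n.
Qed.

End above2_moments.

(** * Moment identities for the excess *)

Section rising.
Context (R : realType).
(** The rising factorial [n (n + 1) ... (n + k - 1)]. Its differences are
    again rising factorials, so that the differences in a generator produce
    no lower order terms. *)
Definition rising (k n : nat) : R := \prod_(0 <= i < k) (n + i)%:R.

Lemma rising0 n : rising 0 n = 1.
Proof. by rewrite /rising big_geq. Qed.

Lemma risingSr k n : rising k.+1 n = rising k n * (n + k)%:R.
Proof. by rewrite /rising big_nat_recr. Qed.

Lemma risingSl k n : rising k.+1 n = n%:R * rising k n.+1.
Proof.
rewrite /rising big_nat_recl// addn0; congr (_ * _).
by apply: eq_bigr => i _; rewrite addnS addSn.
Qed.

Lemma rising_ge0 k n : 0 <= rising k n.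
Proof. by rewrite /rising prodr_ge0. Qed.

Lemma rising_diff k n : rising k.+1 n.+1 - rising k.+1 n = k.+1%:R * rising k n.+1.
Proof. by rewrite risingSr risingSl -natr1 natrD -natr1; ring. Qed.

Lemma rising_homo k : {homo rising k : m n / (m <= n)%N >-> m <= n}.
Proof.
move=> m n mn; elim: k => [|k IH]; first by rewrite !rising0.
by rewrite !risingSr ler_pM ?rising_ge0// ler_nat leq_add2r.
Qed.

Lemma rising_le k n : rising k n <= (n + k)%:R ^+ k.
Proof.
elim: k => [|k IH]; first by rewrite rising0 expr0.
rewrite risingSr exprSr ler_pM ?rising_ge0//; last by rewrite ler_nat leq_add2l.
by rewrite (le_trans IH)// lerXn2r ?nnegrE// ler_nat leq_add2l.
Qed.

Lemma expr_le_rising k n : n%:R ^+ k <= rising k n.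
Proof.
elim: k => [|k IH]; first by rewrite rising0 expr0.
by rewrite risingSr exprSr ler_pM ?exprn_ge0// ler_nat leq_addr.
Qed.

End rising.

Section jsq_expectation.
Context (R : realType) (N : nat) (tau : R).
Hypothesis N_gt0 : (0 < N)%N.
Hypothesis tau_gt0 : 0 < tau.
Hypothesis tau_le : tau <= 8^-1.
Hypothesis Ntau : 16 <= N%:R * tau.
Implicit Types s t : jsq_state N.
Local Notation r := (1 + tau / 8).
Local Notation M := (N %/ 4)%N.
Hypothesis rM : 16 * N%:R / tau <= r ^+ (2 * M).
Variables (P : R -> R.-pker (jsq_state N) ~> (jsq_state N)).
Variable pi : probability (jsq_state N) R.
Hypothesis P_jsq : ctmc_semigroup (jsq_rate (1 - tau)) P.
Hypothesis pi_stationary : ctmc_stationary P pi.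
Local Notation Qn s j := (nth 0%N (jsq_seq s) j).
Local Notation gen := (generator (@jsq_trans R N (1 - tau))).

Definition size_weight s : R := 1 + (jsq_S s)%:R.
Local Notation W := size_weight.
Local Notation I s := ((idle s)%:R : R).
Local Notation Q2 s := ((Qn s 1)%:R : R).
Local Notation RR s := ((above2 s)%:R : R).
Local Notation b := (N%:R * tau).

Let tau_lam : 0 <= 1 - tau. Proof. by move: tau_le; lra. Qed.

Lemma size_weight_ge1 s : 1 <= W s.
Proof. by rewrite lerDl. Qed.

Lemma jsq_S_le s : (jsq_S s <= 2 * N + above2 s)%N.
Proof.
have := jsq_SE s; rewrite excessE; have := jsq_le s 1; clear; lia.
Qed.

Lemma above2_integrable p : pi.-integrable setT (EFin \o (fun s => RR s ^+ p)).
Proof.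
case: p => [|p].
  rewrite (_ : EFin \o _ = cst 1%E); first exact: finite_measure_integrable_cst.
  by apply/funext => s; rewrite /= expr0.
apply/integrableP; split; first by [].
rewrite (@eq_integral _ _ _ _ _ (fun s => (RR s ^+ p.+1)%:E)); last first.
  by move=> s _; rewrite /= ger0_norm// exprn_ge0.
have := above2_moment N_gt0 tau_gt0 tau_le Ntau rM P_jsq pi_stationary
  (p := p.+1) (q := p.+1).
by rewrite leqnn => /(_ isT) /le_lt_trans; apply; exact: ltry.
Qed.

(** The number of tasks is at most [2 * N + above2], and every moment of
    [above2] is finite. *)
Lemma size_weight_integrable k :
  pi.-integrable setT (EFin \o (fun s => W s ^+ k)).
Proof.
pose c : R := (2 * N + 2)%N%:R ^+ k.+1.
apply: (@le_integrable _ _ _ pi setT measurableT _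
   (fun s => (c * (1 + RR s ^+ k.+1))%:E)) => //.
  move=> s _ /=; rewrite lee_fin ger0_norm; last first.
    by rewrite exprn_ge0// (le_trans ler01 (size_weight_ge1 s)).
  rewrite (le_trans _ (ler_norm _))//.
  rewrite (@le_trans _ _ (W s ^+ k.+1))//.
    by rewrite ler_weXn2l ?size_weight_ge1.
  have Wle : W s <= (2 * N + 1 + above2 s)%N%:R.
    rewrite /W addrC natr1 ler_nat; have := jsq_S_le s; clear; lia.
  apply: (@le_trans _ _ (((2 * N + 1 + above2 s)%N%:R) ^+ k.+1)).
    rewrite lerXn2r ?nnegrE//.
    by rewrite (le_trans ler01 (size_weight_ge1 s)).
  case: (posnP (above2 s)) => [->|R0].
    rewrite expr0n addr0 mulr1 addn0 /c lerXn2r ?nnegrE// ler_nat; clear; lia.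
  rewrite mulrDr mulr1 -[leLHS]add0r lerD ?exprn_ge0// /c -exprMn.
  rewrite lerXn2r ?nnegrE ?mulr_ge0// -natrM ler_nat; clear -R0; nia.
apply: (@eq_integrable _ _ _ _ _ measurableT
   (fun s => c%:E * (1%:E + (RR s ^+ k.+1)%:E))%E) => //.
apply: integrableZl => //; apply: integrableD => //.
  exact: finite_measure_integrable_cst.
exact: above2_integrable.
Qed.

Lemma size_weight_trans s m : m \in jsq_trans (1 - tau) s -> W m.2 <= 2 * W s.
Proof.
rewrite inE => /predU1P[->|/mapP[j _ ->]] /=.
  rewrite /W /jsq_S jsq_arrE// sumn_incr_nth -natr1.
  by have := ler0n R (sumn s); lra.
rewrite (@le_trans _ _ (W s))//; last first.
  by have := size_weight_ge1 s; lra.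
rewrite /W lerD2l ler_nat /jsq_S.
have [lt|ge] := ltnP (Qn s j.+1) (Qn s j).
  by rewrite -[in leqRHS](jsq_depE lt) sumn_incr_nth.
by rewrite /jsq_dep ltnNge ge.
Qed.

Lemma jsq_expect_gen (f : jsq_state N -> R) : tame W f -> expect pi (gen f) = 0.
Proof.
move=> tf.
exact: (expect_gen (@jsq_measurable N) (pcan_inj pickleK)
  (jsq_trans_ge0 tau_lam) (jsq_tot_le _)
  (jsq_inflow N_gt0 tau_lam P_jsq pi_stationary)
  size_weight_ge1 size_weight_integrable (ler0n _ 2) size_weight_trans tf).
Qed.

Let tD := tameD size_weight_ge1.
Let tB := tameB size_weight_ge1.
Let tM := tameM size_weight_ge1.
Let tC c : tame W (fun=> c). Proof. exact: tame_cst. Qed.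
Let eD := expectD size_weight_ge1 size_weight_integrable.
Let eB := expectB size_weight_ge1 size_weight_integrable.
Let eZ := expectZ size_weight_ge1 size_weight_integrable.
Let eL := expect_le size_weight_ge1 size_weight_integrable.
Local Notation E := (expect pi).

(** There are at most [N] idle servers, so every function of their number
    is bounded. *)
Lemma tame_fun_idle (phi : nat -> R) : tame W (fun s => phi (idle s)).
Proof.
apply: (@tame_bounded _ _ _ W _ (\sum_(i < N.+1) `|phi i|)) => // s.
have iN : (idle s < N.+1)%N by rewrite ltnS idle_le.
by rewrite (bigD1 (Ordinal iN))//= lerDl sumr_ge0.
Qed.

Lemma tame_Q2 : tame W (fun s => Q2 s).
Proof.
apply: (@tame_bounded _ _ _ W _ N%:R) => // s.
by rewrite ger0_norm// ler_nat jsq_le.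
Qed.

Lemma tame_excess : tame W (fun s => (excess s)%:R).
Proof.
apply: (tame_le _ (tameW size_weight_ge1 _)) => // s.
rewrite !ger0_norm// /W; last by rewrite addr_ge0.
rewrite addrC natr1 ler_nat ltnW// ltnS.
by have := jsq_SE s; have := idle_le s; clear; lia.
Qed.

Lemma tame_above2 : tame W (fun s => RR s).
Proof.
apply: (tame_le _ tame_excess) => // s.
by rewrite !ger0_norm// ler_nat excessE leq_addl.
Qed.

Lemma tame_rising k : tame W (fun s => rising R k (excess s)).
Proof.
elim: k => [|k IH].
  by under eq_fun do rewrite rising0; exact: tC.
under eq_fun do rewrite risingSr natrD.
by apply: tM => //; apply: tD; [exact: tame_excess|exact: tC].
Qed.

Section weighted.
Variable h : nat -> R.
Hypothesis h_ge0 : forall n, 0 <= h n.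
Hypothesis h_homo : {homo h : m n / (m <= n)%N >-> m <= n}.
Hypothesis h_tame : tame W (fun s => h (excess s)).

Let h_pred_tame : tame W (fun s => h (excess s).-1).
Proof.
apply: (tame_le _ h_tame) => // s.
by rewrite !ger0_norm// h_homo// leq_pred.
Qed.

Let diff_ge0 n : 0 <= h n - h n.-1.
Proof. by rewrite subr_ge0 h_homo// leq_pred. Qed.

(** Take the test function [G (excess) - idle * h (excess)], where [G] is
    the discrete primitive of [h]: every arrival raises it by [h (excess)],
    whether it takes an idle server or waits. This removes the boundary
    between the two regimes from the identity. *)
Lemma excess_balance :
  E (fun s => (I s - b) * h (excess s)) +
  E (fun s => (I s + 1) * Q2 s * (h (excess s) - h (excess s).-1)) = 0.
Proof.
pose G n := \sum_(0 <= j < n) h j.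
have GS n : G n.+1 = G n + h n by rewrite /G big_nat_recr.
have tG : tame W (fun s => G (excess s)).
  apply: (tame_le _ (tM tame_excess h_tame)) => // s.
  rewrite !ger0_norm ?mulr_ge0 ?sumr_ge0//.
  apply: (@le_trans _ _ (\sum_(0 <= j < excess s) h (excess s))).
    by apply: ler_sum_nat => j /andP[_ jn]; rewrite h_homo// ltnW.
  by rewrite sumr_const_nat subn0 mulr_natl.
pose F i n := G n - i%:R * h n.
have tF : tame W (fun s => F (idle s) (excess s)).
  by apply: tB => //; apply: tM => //; exact: tame_fun_idle.
rewrite -[RHS](jsq_expect_gen tF) -eD.
- congr expect; apply/funext => s; rewrite gen_idle_excess// /F.
  have [y0|y0] := posnP (excess s).
    have -> : Qn s 1 = 0%N by move: y0; rewrite excessE; clear; lia.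
    case: (idle s) => [|i]; rewrite /= ?addn1 ?addn0 ?GS -?natr1 ?y0; ring.
  have Gy : G (excess s) = G (excess s).-1 + h (excess s).-1.
    by rewrite -GS prednK.
  case: (idle s) => [|i]; rewrite /= ?addn1 ?addn0 ?GS -?natr1 ?Gy; ring.
- apply: tM => //; apply: tB; [exact: tame_fun_idle|exact: tC].
- apply: tM; last exact: tB.
  by apply: tM; [exact: (tame_fun_idle (fun i => i%:R + 1))|exact: tame_Q2].
Qed.

(** Take the test function [rising m.+2 (idle) * h (excess)]: it vanishes
    when no server is idle, so the arrivals that wait do not contribute. *)
Lemma idle_balance m :
  m.+2%:R * E (fun s => h (excess s) * (b * rising R m.+1 (idle s)
    + m.+1%:R * N%:R * rising R m (idle s).+1
    - (I s + Q2 s) * rising R m.+1 (idle s).+1)) =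
  E (fun s => Q2 s * rising R m.+2 (idle s) * (h (excess s) - h (excess s).-1)).
Proof.
pose F i n := rising R m.+2 i * h n.
have tF : tame W (fun s => F (idle s) (excess s)).
  by apply: tM => //; exact: tame_fun_idle.
have t1 : tame W (fun s => h (excess s) * (b * rising R m.+1 (idle s)
    + m.+1%:R * N%:R * rising R m (idle s).+1
    - (I s + Q2 s) * rising R m.+1 (idle s).+1)).
  apply: tM => //; apply: tB.
    exact: (tame_fun_idle (fun i => b * rising R m.+1 i
      + m.+1%:R * N%:R * rising R m i.+1)).
  apply: tM; last exact: (tame_fun_idle (fun i => rising R m.+1 i.+1)).
  by apply: tD; [exact: tame_fun_idle|exact: tame_Q2].
have t2 : tame W (fun s => Q2 s * rising R m.+2 (idle s) *
    (h (excess s) - h (excess s).-1)).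
  apply: tM; last exact: tB.
  by apply: tM; [exact: tame_Q2|exact: tame_fun_idle].
apply/eqP; rewrite -subr_eq0 -[eqbRHS](jsq_expect_gen tF) -eZ// -eB//; last first.
  by apply: tM => //; exact: tC.
apply/eqP; congr expect; apply/funext => s; rewrite gen_idle_excess// /F.
have up i : rising R m.+2 i.+1 = rising R m.+2 i + m.+2%:R * rising R m.+1 i.+1.
  by rewrite -rising_diff addrC subrK.
have up' i : rising R m.+1 i.+1 = rising R m.+1 i + m.+1%:R * rising R m i.+1.
  by rewrite -rising_diff addrC subrK.
case: (idle s) => [|i] /=; rewrite ?addn1 ?addn0.
  rewrite up up' !risingSl; ring.
rewrite [rising R m.+2 i.+2]up [rising R m.+1 i.+2]up' [rising R m.+2 i.+1]up.
by rewrite -!natr1; ring.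
Qed.

(** The rising factorial starts at [(idle s).+1] so that the recursion
    [idle_moment_rec] closes up. *)
Definition idle_moment m := E (fun s => h (excess s) * rising R m (idle s).+1).
Local Notation U := idle_moment.

Let tU (phi : nat -> R) : tame W (fun s => h (excess s) * phi (idle s)).
Proof. by apply: tM => //; exact: tame_fun_idle. Qed.

Lemma idle_moment0 : U 0 = E (fun s => h (excess s)).
Proof. by congr expect; apply/funext => s; rewrite rising0 mulr1. Qed.

Lemma idle_moment_ge0 m : 0 <= U m.
Proof. by apply: expect_ge0 => s; rewrite mulr_ge0 ?rising_ge0. Qed.

(** In [excess_balance] the second term is nonnegative, as [h] is
    nondecreasing. *)
Lemma expect_idle_le : E (fun s => h (excess s) * I s) <= b * U 0.
Proof.
have := excess_balance.
have -> : (fun s => (I s - b) * h (excess s)) =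
    fun s => h (excess s) * I s - b * h (excess s).
  by apply/funext => s; ring.
rewrite eB; [|exact: (tU (fun i => i%:R))|by apply: tM].
rewrite eZ// idle_moment0 => e.
rewrite -subr_le0 -oppr_ge0 (_ : - _ = E (fun s => (I s + 1) * Q2 s *
  (h (excess s) - h (excess s).-1))); last first.
  by apply/eqP; rewrite eq_sym -addr_eq0 addrC e.
by apply: expect_ge0 => s; rewrite mulr_ge0// mulr_ge0// addr_ge0.
Qed.

Lemma idle_moment1 : U 1 <= (b + 1) * U 0.
Proof.
rewrite mulrDl mul1r (le_trans _ (lerD expect_idle_le (lexx _)))//.
rewrite idle_moment0 -eD; [|exact: (tU (fun i => i%:R))|by []].
apply: eL; [exact: (tU (fun i => rising R 1 i.+1))| |].
  by apply: tD => //; exact: (tU (fun i => i%:R)).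
by move=> s; rewrite risingSl rising0 mulr1 -natr1 mulrDr mulr1.
Qed.

Lemma idle_moment_rec k :
  U k.+2 <= (b + k.+2%:R) * U k.+1 + k.+1%:R * N%:R * U k.
Proof.
have b0 : 0 <= b by rewrite mulr_ge0// ltW.
have := idle_balance k; set B := E (fun s => h (excess s) * _).
set D := E (fun s => Q2 s * _ * _) => BD.
have B0 : 0 <= B.
  rewrite -(@pmulr_rge0 _ k.+2%:R)// BD; apply: expect_ge0 => s.
  by rewrite !mulr_ge0// ?rising_ge0.
have : B <= b * U k.+1 + k.+1%:R * N%:R * U k -
    E (fun s => h (excess s) * (I s * rising R k.+1 (idle s).+1)).
  rewrite -!eZ; [|exact: (tU (fun i => rising R _ i.+1))..].
  rewrite -eD -?eB; try by [exact: (tU (fun i => i%:R * rising R _ i.+1))|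
    do ?apply: tD; apply: tM => //; exact: (tU (fun i => rising R _ i.+1))].
  apply: eL => [|| s].
  - apply: tM => //; apply: tB; first exact: (tame_fun_idle (fun i =>
      b * rising R k.+1 i + k.+1%:R * N%:R * rising R k i.+1)).
    apply: tM; last exact: (tame_fun_idle (fun i => rising R _ i.+1)).
    by apply: tD; [exact: tame_fun_idle|exact: tame_Q2].
  - apply: tB; last exact: (tU (fun i => i%:R * rising R _ i.+1)).
    by apply: tD; apply: tM => //; exact: (tU (fun i => rising R _ i.+1)).
  - have h0 := h_ge0 (excess s).
    have r1 : rising R k.+1 (idle s) <= rising R k.+1 (idle s).+1 by apply: rising_homo.
    have e1 : 0 <= b * (h (excess s) * (rising R k.+1 (idle s).+1 - rising R k.+1 (idle s))).
      by rewrite mulr_ge0// mulr_ge0// subr_ge0.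
    have e2 : 0 <= h (excess s) * (Q2 s * rising R k.+1 (idle s).+1).
      by rewrite mulr_ge0// mulr_ge0// rising_ge0.
    by move: e1 e2; lra.
have -> : U k.+2 = E (fun s => h (excess s) * (I s * rising R k.+1 (idle s).+1))
    + k.+2%:R * U k.+1.
  rewrite -eZ; last exact: (tU (fun i => rising R _ i.+1)).
  rewrite -eD; [|exact: (tU (fun i => i%:R * rising R _ i.+1))|
    by apply: tM => //; exact: (tU (fun i => rising R _ i.+1))].
  congr expect; apply/funext => s.
  by rewrite [rising R k.+2 _]risingSr addSnnS natrD; ring.
by move: B0; lra.
Qed.

Variable sq : R.
Hypothesis sq2 : sq ^+ 2 = N%:R.
Hypothesis b_le : b <= sq.

Let b_ge1 : 1 <= b. Proof. by move: Ntau; lra. Qed.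
Let sq_ge1 : 1 <= sq. Proof. exact: le_trans b_ge1 b_le. Qed.

(** The number of idle servers has the order [sq] of the square root of
    [N]: by [idle_moment_rec] two more factors cost at most a constant
    times [N]. *)
Lemma idle_moment_le m : U m <= 2 ^+ m * m`!%:R * sq ^+ m * U 0.
Proof.
have sq0 : 0 <= sq by exact: le_trans ler01 sq_ge1.
have U0 := idle_moment_ge0.
have stp k : U k <= 2 ^+ k * k`!%:R * sq ^+ k * U 0 ->
    U k.+1 <= 2 ^+ k.+1 * k.+1`!%:R * sq ^+ k.+1 * U 0 ->
    U k.+2 <= 2 ^+ k.+2 * k.+2`!%:R * sq ^+ k.+2 * U 0.
  move=> IH IH1; apply: (le_trans (idle_moment_rec k)).
  set c := 2 ^+ k * k`!%:R * sq ^+ k * U 0.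
  have c0 : 0 <= c by rewrite !mulr_ge0 ?exprn_ge0.
  have e1 : 2 ^+ k.+1 * k.+1`!%:R * sq ^+ k.+1 * U 0 = 2 * k.+1%:R * sq * c.
    by rewrite /c factS natrM !exprS; ring.
  have e2 : 2 ^+ k.+2 * k.+2`!%:R * sq ^+ k.+2 * U 0 =
      4 * k.+2%:R * k.+1%:R * N%:R * c.
    by rewrite /c 2!factS !natrM -sq2 !exprS; ring.
  rewrite e1 in IH1; rewrite e2.
  have h1 : (b + k.+2%:R) * U k.+1 <= k.+3%:R * sq * (2 * k.+1%:R * sq * c).
    apply: ler_pM => //; first by rewrite addr_ge0// (le_trans ler01).
    rewrite (_ : k.+3%:R = 1 + k.+2%:R); last by rewrite -natr1 addrC.
    by rewrite mulrDl mul1r lerD// -[leLHS]mulr1 ler_wpM2l.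
  have h2 : k.+1%:R * N%:R * U k <= k.+1%:R * N%:R * c.
    by rewrite ler_wpM2l// mulr_ge0.
  apply: (le_trans (lerD h1 h2)).
  have kc : 0 <= k.+1%:R * N%:R * c by rewrite mulr_ge0// mulr_ge0.
  rewrite (_ : k.+3%:R * sq * _ = 2 * k.+3%:R * (k.+1%:R * N%:R * c)); last first.
    by rewrite -sq2; ring.
  rewrite -[X in _ + X <= _]mul1r -mulrDl.
  rewrite (_ : 4 * _ * _ * _ * _ = 4 * k.+2%:R * (k.+1%:R * N%:R * c)); last by ring.
  rewrite ler_wpM2r//; rewrite -!natr1; have : 0 <= k%:R :> R by []; lra.
have b1 : U 1 <= 2 ^+ 1 * 1`!%:R * sq ^+ 1 * U 0.
  apply: (le_trans idle_moment1); rewrite ler_wpM2r// (_ : 1`! = 1%N)// !expr1 mulr1.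
  by move: b_le sq_ge1; lra.
suff : U m <= 2 ^+ m * m`!%:R * sq ^+ m * U 0 /\
    U m.+1 <= 2 ^+ m.+1 * m.+1`!%:R * sq ^+ m.+1 * U 0 by case.
elim: m => [|m [IH IH1]]; last by split => //; exact: stp.
by split => //; rewrite !expr0 fact0 !mul1r.
Qed.

(** By the inequality between arithmetic and geometric means, [2 * (I +
    1)^2 <= sq * (I + 1) + (I + 1)^3 / sq]. Passing through the first and
    third moments preserves one factor [b], much smaller than [sq], which a
    bound on the second moment alone would lose. *)
Lemma idle_moment2 :
  E (fun s => h (excess s) * (I s * (I s + 1))) <= 17 * sq * b * U 0.
Proof.
have sq0 : 0 < sq by exact: lt_le_trans ltr01 sq_ge1.
have U0 := idle_moment_ge0 0.
have bsq : b * b <= N%:R.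
  by rewrite -[leRHS]sq2 expr2 ler_pM// (le_trans ler01 b_ge1).
have U1 : U 1 <= 2 * b * U 0.
  by apply: (le_trans idle_moment1); rewrite ler_wpM2r//; move: b_ge1; lra.
have U2 : U 2 <= 7 * N%:R * U 0.
  apply: (le_trans (idle_moment_rec 0)).
  have : (b + 2) * U 1 <= 3 * b * (2 * b * U 0).
    rewrite ler_pM ?idle_moment_ge0//; move: b_ge1; lra.
  have : b * b * U 0 <= N%:R * U 0 by rewrite ler_wpM2r.
  by lra.
have U3 : U 3 <= 32 * N%:R * b * U 0.
  apply: (le_trans (idle_moment_rec 1)).
  have : (b + 3) * U 2 <= 4 * b * (7 * N%:R * U 0).
    rewrite ler_pM ?idle_moment_ge0//; move: b_ge1; lra.
  have : N%:R * U 1 <= N%:R * (2 * b * U 0) by rewrite ler_wpM2l.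
  by lra.
have -> : 17 * sq * b * U 0 =
    2^-1 * (sq * (2 * b * U 0) + sq^-1 * (32 * N%:R * b * U 0)).
  by rewrite -sq2; field; rewrite gt_eqF.
have t1 := tU (fun i => rising R 1 i.+1); have t3 := tU (fun i => rising R 3 i.+1).
apply: (@le_trans _ _ (2^-1 * (sq * U 1 + sq^-1 * U 3))); last first.
  by rewrite ler_wpM2l// lerD// ler_wpM2l// ?invr_ge0 (ltW sq0).
rewrite -!eZ// -eD; try by apply: tM.
rewrite -eZ; last by apply: tD; apply: tM.
apply: eL; first exact: (tU (fun i => i%:R * (i%:R + 1))).
  by apply: tM => //; apply: tD; apply: tM.
move=> s; have h0 := h_ge0 (excess s); set x := I s.
have x0 : 0 <= x by rewrite ler0n.
have x1 : (idle s).+1%:R = x + 1 by rewrite /x natr1.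
rewrite [rising R 1 _]risingSr rising0 addn0 x1.
have r3 : (x + 1) ^+ 3 <= rising R 3 (idle s).+1.
  by rewrite /x natr1 expr_le_rising.
have amgm : 2 * (x + 1) ^+ 2 <= sq * (x + 1) + sq^-1 * (x + 1) ^+ 3.
  rewrite -subr_ge0 (_ : _ - _ = sq^-1 * (x + 1) * (sq - (x + 1)) ^+ 2).
    by rewrite mulr_ge0 ?sqr_ge0// mulr_ge0 ?invr_ge0 ?(ltW sq0)// addr_ge0.
  by field; rewrite gt_eqF.
have r3' : sq^-1 * (x + 1) ^+ 3 <= sq^-1 * rising R 3 (idle s).+1.
  by rewrite ler_wpM2l// invr_ge0 ltW.
have key : x * (x + 1) <= 2^-1 * (sq * (x + 1) + sq^-1 * rising R 3 (idle s).+1).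
  have : (x + 1) ^+ 2 = x * (x + 1) + x + 1 by ring.
  by move: amgm r3' x0; lra.
by have := ler_wpM2l h0 key; lra.
Qed.

End weighted.

Local Notation y k := (fun s => rising R k (excess s)).

Lemma rising_pred k n : (0 < n)%N ->
  rising R k.+1 n - rising R k.+1 n.-1 = k.+1%:R * rising R k n.
Proof. by case: n => // n _; exact: rising_diff. Qed.

Definition excess_moment k := E (y k).
Local Notation e := excess_moment.

Lemma excess_moment_ge0 k : 0 <= e k.
Proof. by apply: expect_ge0 => s; exact: rising_ge0. Qed.

Variable sq : R.
Hypothesis sq2 : sq ^+ 2 = N%:R.
Hypothesis b_le : b <= sq.

(** The moment recursion of the Gamma law. With [Y] the excess, [I] the
    idle servers and [y_k] the rising factorials of [Y], [excess_balance]
    for [y_(k+1)] reads [b * E y_(k+1) = E (I * y_(k+1)) + (k + 1) * E ((I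
    + 1) * Q2 * y_k)]. As [Y = Q2 + above2], the first term is also [E ((I
    + 1) * Q2 * y_k)] up to errors, which gives the factor [k + 2]; and
    [idle_balance] with [m = 0] evaluates [E ((I + Q2) * (I + 1) * y_k)] as
    [N * E y_k] up to errors. *)
Lemma excess_moment_rec k :
  `| b * e k.+1 - k.+2%:R * N%:R * e k | <=
    (k.+2%:R * (b + 17 * k.+2%:R * sq) * b + k%:R * b) * e k + e k.+1
    + N%:R * E (fun s => RR s * y k s).
Proof.
have hg k' := @rising_ge0 R k'; have hm k' := @rising_homo R k'.
have ht := tame_rising.
pose Ih := E (fun s => y k s * I s).
pose I2 := E (fun s => y k s * (I s * (I s + 1))).
pose Q := E (fun s => Q2 s * y k s).
pose IR := E (fun s => y k s * (I s * RR s)).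
pose A := E (fun s => (I s + 1) * Q2 s * y k s).
pose D := E (fun s => Q2 s * rising R 2 (idle s) *
  (rising R k (excess s) - rising R k (excess s).-1)).
have b0 : 0 <= b by rewrite mulr_ge0// ltW.
have tphi (phi : nat -> R) : tame W (fun s => y k s * phi (idle s)).
  by apply: tM => //; exact: tame_fun_idle.
have tQ : tame W (fun s => Q2 s * y k s) by apply: tM => //; exact: tame_Q2.
have tIQ : tame W (fun s => (I s + 1) * Q2 s * y k s).
  apply: tM => //; apply: tM; last exact: tame_Q2.
  exact: (tame_fun_idle (fun i => i%:R + 1)).
have tIR : tame W (fun s => y k s * (I s * RR s)).
  by apply: tM => //; apply: tM; [exact: tame_fun_idle|exact: tame_above2].
have tI := tphi (fun i => i%:R).
have tI2 := tphi (fun i => i%:R * (i%:R + 1)).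
have U0 : idle_moment (rising R k) 0 = e k.
  by rewrite idle_moment0.
have Ih_le : Ih <= b * e k.
  by rewrite -U0; exact: expect_idle_le.
have I2_le : I2 <= 17 * sq * b * e k.
  by rewrite -U0; apply: idle_moment2.
have ge0 (f : jsq_state N -> R) : (forall s, 0 <= f s) -> 0 <= E f := @expect_ge0 _ _ _ pi f.
have Ih0 : 0 <= Ih by apply: ge0 => s; rewrite mulr_ge0.
have I20 : 0 <= I2 by apply: ge0 => s; rewrite mulr_ge0// mulr_ge0// addr_ge0.
have Q0 : 0 <= Q by apply: ge0 => s; rewrite mulr_ge0.
have IR0 : 0 <= IR by apply: ge0 => s; rewrite mulr_ge0// mulr_ge0.
have D0 : 0 <= D.
  by apply: ge0 => s; rewrite !mulr_ge0 ?hg// subr_ge0 hm// leq_pred.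
have D_le : D <= k%:R * I2.
  rewrite /I2 -eZ//; apply: eL; last first.
  - move=> s; rewrite !risingSr rising0 addn0 natrD mul1r.
    have [y0|y0] := posnP (excess s).
      have -> : Qn s 1 = 0%N by move: y0; rewrite excessE; clear; lia.
      by rewrite !mul0r mulr_ge0// mulr_ge0// mulr_ge0// addr_ge0.
    case: (k) => [|j]; first by rewrite !rising0 subrr mulr0 mul0r.
    rewrite rising_pred//.
    have Qle : Q2 s * rising R j (excess s) <= rising R j.+1 (excess s).
      rewrite risingSr mulrC ler_wpM2l// ler_nat (leq_trans _ (leq_addr _ _))//.
      by rewrite excessE leq_addr.
    have i0 : 0 <= I s * (I s + 1) * j.+1%:R by rewrite mulr_ge0// mulr_ge0// addr_ge0.
    by have := ler_wpM2l i0 Qle; lra.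
  - by apply: tM => //; exact: tC.
  - apply: tM; last apply: tB => //.
      by apply: tM; [exact: tame_Q2|exact: (tame_fun_idle (fun i => rising R 2 i))].
    apply: (tame_le _ (ht k)) => // s.
    by rewrite !ger0_norm// hm// leq_pred.
have Q_le : Q <= e k.+1.
  apply: eL => // s; rewrite risingSr mulrC ler_wpM2l// ler_nat.
  by rewrite excessE -addnA leq_addr.
have IR_le : IR <= N%:R * E (fun s => RR s * y k s).
  have t : tame W (fun s => RR s * y k s) by apply: tM => //; exact: tame_above2.
  rewrite -eZ//; apply: eL => //; first by apply: tM => //; exact: tC.
  move=> s; rewrite mulrCA [RR s * _]mulrC ler_wpM2r ?mulr_ge0//.
  by rewrite ler_nat idle_le.
have A_E : A = N%:R * e k + b * Ih - I2 - 2^-1 * D.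
  have := idle_balance (hg k) (hm k) (ht k) 0; rewrite -/D => <-.
  rewrite mulrA mulVf ?pnatr_eq0// mul1r.
  have -> : (fun s => y k s * (b * rising R 1 (idle s)
      + 1%:R * N%:R * rising R 0 (idle s).+1
      - (I s + Q2 s) * rising R 1 (idle s).+1)) =
    (fun s => (N%:R * y k s + b * (y k s * I s)
      - y k s * (I s * (I s + 1))) - (I s + 1) * Q2 s * y k s).
    by apply/funext => s; rewrite !risingSr !rising0 !addn0 -natr1; ring.
  have t1 : tame W (fun s => N%:R * y k s) by apply: tM => //; exact: tC.
  have t2 : tame W (fun s => b * (y k s * I s)) by apply: tM => //; exact: tC.
  rewrite eB; [|by apply: tB => //; apply: tD|by []].
  rewrite eB; [|by apply: tD|by []].
  rewrite eD// !eZ// -/A -/Ih -/I2 -/(e k); ring.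
have main : b * e k.+1 = k.+2%:R * A - Q + IR + k%:R * Ih.
  have := excess_balance (hg k.+1) (hm k.+1) (ht k.+1).
  have -> : (fun s => (I s + 1) * Q2 s *
      (rising R k.+1 (excess s) - rising R k.+1 (excess s).-1)) =
      fun s => k.+1%:R * ((I s + 1) * Q2 s * y k s).
    apply/funext => s; have [y0|y0] := posnP (excess s).
      have -> : Qn s 1 = 0%N by move: y0; rewrite excessE; clear; lia.
      by rewrite !mulr0 !mul0r mulr0.
    by rewrite rising_pred//; ring.
  have -> : (fun s => (I s - b) * rising R k.+1 (excess s)) =
      fun s => (I s + 1) * Q2 s * y k s - Q2 s * y k s
        + (y k s * (I s * RR s) + k%:R * (y k s * I s)) - b * y k.+1 s.
    apply/funext => s; rewrite mulrBl; congr (_ - _).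
    have -> : rising R k.+1 (excess s) = y k s * (Q2 s + RR s + k%:R).
      by rewrite risingSr natrD; congr (_ * (_ + _)); rewrite excessE natrD.
    ring.
  have t1 : tame W (fun s => b * y k.+1 s) by apply: tM => //; exact: tC.
  have t2 : tame W (fun s => k%:R * (y k s * I s)) by apply: tM => //; exact: tC.
  rewrite eB; [|by apply: tD; [apply: tB|apply: tD]|by []].
  rewrite eD; [|by apply: tB|by apply: tD].
  rewrite eB// eD// !eZ// -/A -/Q -/IR -/Ih -/(e k.+1).
  by rewrite -[k.+2%:R]natr1; lra.
have N0 : 0 <= N%:R :> R by [].
have k0 : 0 <= k%:R :> R by [].
have e0 := excess_moment_ge0.
have kk : k.+2%:R = k%:R + 2 :> R by rewrite -natrD addn2.
rewrite main A_E kk.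
have a1 : (k%:R + 2) * (b * Ih) <= (k%:R + 2) * (b * (b * e k)).
  by rewrite ler_wpM2l ?addr_ge0// ler_wpM2l.
have a2 : (k%:R + 2) * I2 <= (k%:R + 2) * (17 * sq * b * e k).
  by rewrite ler_wpM2l ?addr_ge0.
have a3 : k%:R * ((k%:R + 2) * I2) <= k%:R * ((k%:R + 2) * (17 * sq * b * e k)).
  by rewrite ler_wpM2l.
have a4 : (k%:R + 2) * D <= (k%:R + 2) * (k%:R * I2) by rewrite ler_wpM2l ?addr_ge0.
have a5 : k%:R * Ih <= k%:R * (b * e k) by rewrite ler_wpM2l.
have p1 : 0 <= (k%:R + 2) * (b * Ih) by rewrite mulr_ge0 ?addr_ge0// mulr_ge0.
have p2 : 0 <= (k%:R + 2) * I2 by rewrite mulr_ge0 ?addr_ge0.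
have p4 : 0 <= (k%:R + 2) * D by rewrite mulr_ge0 ?addr_ge0.
have p5 : 0 <= k%:R * Ih by rewrite mulr_ge0.
have p6 : 0 <= k%:R * ((k%:R + 2) * I2) by rewrite mulr_ge0.
rewrite ler_norml; apply/andP; split; lra.
Qed.

End jsq_expectation.

(** * From the excess to the rescaled number of tasks *)

Lemma rising_sub_expr (R : realType) k n :
  rising R k.+1 n - n%:R ^+ k.+1 <= k.+1%:R ^+ 2 * rising R k n.
Proof.
elim: k => [|k IH].
  by rewrite risingSr rising0 addn0 mul1r expr1 subrr mulr1.
have -> : rising R k.+2 n - n%:R ^+ k.+2 =
    (rising R k.+1 n - n%:R ^+ k.+1) * n%:R + k.+1%:R * rising R k.+1 n.
  by rewrite [rising R k.+2 n]risingSr natrD [n%:R ^+ k.+2]exprSr; ring.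
have h1 : (rising R k.+1 n - n%:R ^+ k.+1) * n%:R <= k.+1%:R ^+ 2 * rising R k.+1 n.
  apply: (le_trans (ler_wpM2r (ler0n _ n) IH)).
  rewrite -mulrA ler_wpM2l ?exprn_ge0// risingSr ler_wpM2l ?rising_ge0//.
  by rewrite ler_nat leq_addr.
apply: (le_trans (lerD h1 (lexx _))); rewrite -mulrDl ler_wpM2r ?rising_ge0//.
by rewrite -[k.+2%:R]natr1; have := ler0n R k.+1; move: (k.+1%:R : R) => x x0; lra.
Qed.

Section scaled_moments.
Context (R : realType) (N : nat) (tau : R).
Hypothesis N_gt0 : (0 < N)%N.
Hypothesis tau_gt0 : 0 < tau.
Hypothesis tau_le : tau <= 8^-1.
Hypothesis Ntau : 16 <= N%:R * tau.
Implicit Types s t : jsq_state N.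
Hypothesis rM : 16 * N%:R / tau <= (1 + tau / 8) ^+ (2 * (N %/ 4)).
Variables (P : R -> R.-pker (jsq_state N) ~> (jsq_state N)).
Variable pi : probability (jsq_state N) R.
Hypothesis P_jsq : ctmc_semigroup (jsq_rate (1 - tau)) P.
Hypothesis pi_stationary : ctmc_stationary P pi.
Local Notation W := (@size_weight R N).
Local Notation I s := ((idle s)%:R : R).
Local Notation RR s := ((above2 s)%:R : R).
Local Notation b := (N%:R * tau).
Local Notation y k := (fun s => rising R k (excess s)).
Local Notation e := (excess_moment pi).
Variables sq kap : R.
Hypothesis sq2 : sq ^+ 2 = N%:R.
Hypothesis b_le : b <= sq.
Hypothesis kap_ge0 : 0 <= kap.

Let iW := size_weight_integrable N_gt0 tau_gt0 tau_le Ntau rM P_jsq pi_stationary.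
Let W1 := @size_weight_ge1 R N.
Let tM := tameM W1.
Let tC c : tame W (fun=> c). Proof. exact: tame_cst. Qed.
Let eB := expectB W1 iW.
Let eD := expectD W1 iW.
Let eZ := expectZ W1 iW.
Let eL := expect_le W1 iW.
Local Notation E := (expect pi).
Let ty k : tame W (y k). Proof. exact: tame_rising. Qed.
Let tI (phi : nat -> R) : tame W (fun s => phi (idle s)).
Proof. exact: tame_fun_idle. Qed.

(** The excess is at most [N + above2], and [above2] is an integer, so that
    a power of the excess costs only a power of [N] once multiplied by
    [above2]. *)
Lemma above2_rising_le k q : (k < q)%N ->
  E (fun s => RR s * y k s) <= (N + 1 + k)%:R ^+ k * above2_bound N tau k.+1 q.
Proof.
move=> kq.
have tR : tame W (fun s => RR s) by exact: tame_above2.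
have -> : above2_bound N tau k.+1 q = fine (above2_bound N tau k.+1 q)%:E by [].
have := @above2_moment R N tau N_gt0 tau_gt0 tau_le Ntau rM P pi P_jsq pi_stationary k.+1 q.
rewrite kq => /(_ isT); rewrite (expectE W1 iW); last exact: (tameX W1).
rewrite lee_fin /= => le; apply: le_trans (ler_wpM2l _ le); last by rewrite exprn_ge0.
have tRk : tame W (fun s => RR s ^+ k.+1) by exact: (tameX W1).
rewrite -eZ//; apply: eL; [exact: tM|by apply: tM => //; exact: tC|].
move=> s; have [r0|r0] := posnP (above2 s).
  by rewrite r0 expr0n mul0r mulr0.
rewrite exprS mulrCA ler_wpM2l// -exprMn.
rewrite (le_trans (rising_le _ _ _))// -natrM lerXn2r ?nnegrE// ler_nat.
have : (excess s <= N + above2 s)%N by rewrite excessE leq_add2r jsq_le.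
move: r0; move: (excess s) (above2 s) => a r; clear; case: r => // r _; nia.
Qed.

Let X s : R := kap * ((jsq_S s)%:R - N%:R).

Let X_E s : X s = kap * (excess s)%:R - kap * I s.
Proof.
have := congr1 (fun n => n%:R : R) (jsq_SE s); rewrite !natrD /X => h.
by rewrite -mulrBr; congr (_ * _); lra.
Qed.

Lemma tame_scaled : tame W X.
Proof.
apply: tM; first exact: tC.
apply: (tameB W1); last exact: tC.
by apply: (tame_le _ (tameW W1 _)) => // s; rewrite !ger0_norm ?addr_ge0// lerDr.
Qed.

Let tpos : tame W (fun s => pos_part (X s)).
Proof.
apply: (tame_le _ tame_scaled) => // s; rewrite ger0_norm ?pos_ge0//.
by rewrite /pos_part ge_max ler_norm normr_ge0.
Qed.

Let tneg : tame W (fun s => neg_part (X s)).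
Proof.
apply: (tame_le _ tame_scaled) => // s; rewrite ger0_norm ?neg_ge0//.
by rewrite /neg_part ge_max normr_ge0 -normrN ler_norm.
Qed.

(** The rescaled variable is [kap * (excess - idle)]. Relative to the
    moment of order [k], replacing the rising factorial by a power costs a
    factor [kap], and dropping the idle servers a factor [kap * b] by
    [expect_idle_le]. *)
Lemma scaled_pos_moment k :
  `| kap ^+ k.+1 * e k.+1 - E (fun s => pos_part (X s) ^+ k.+1) | <=
  kap * (k.+1%:R ^+ 2 + k.+1%:R * b) * (kap ^+ k * e k).
Proof.
have tp : tame W (fun s => pos_part (X s) ^+ k.+1) by exact: (tameX W1).
have ky := tM (tC (kap ^+ k.+1)) (ty k.+1).
have tyI : tame W (fun s => y k s * I s) by apply: tM => //; exact: (tI (fun i => i%:R)).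
rewrite -eZ// -eB//.
have bnd s : 0 <= kap ^+ k.+1 * y k.+1 s - pos_part (X s) ^+ k.+1 <=
    kap ^+ k.+1 * k.+1%:R ^+ 2 * y k s + kap ^+ k.+1 * k.+1%:R * (y k s * I s).
  set x := kap * (excess s)%:R; have x0 : 0 <= x by rewrite mulr_ge0.
  have c0 : 0 <= kap * I s by rewrite mulr_ge0.
  have kk j : 0 <= kap ^+ j by rewrite exprn_ge0.
  have zx : pos_part (X s) <= x by rewrite /pos_part ge_max x0 andbT X_E lerBlDr lerDl.
  have xz : x - pos_part (X s) <= kap * I s.
    by rewrite lerBlDr -lerBlDl /pos_part le_max X_E lexx.
  have h1 := expr_sub_le k c0 (pos_ge0 (X s)) zx xz.
  have h2 := ler_wpM2l (kk k.+1) (rising_sub_expr R k (excess s)).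
  have h3 : pos_part (X s) ^+ k.+1 <= x ^+ k.+1 by rewrite lerXn2r ?nnegrE ?pos_ge0.
  have xe : x ^+ k.+1 = kap ^+ k.+1 * (excess s)%:R ^+ k.+1 by rewrite exprMn.
  have h4 := ler_wpM2l (kk k.+1) (expr_le_rising R k.+1 (excess s)).
  have h5 : k.+1%:R * x ^+ k * (kap * I s) <= kap ^+ k.+1 * k.+1%:R * (y k s * I s).
    rewrite /x exprMn exprS.
    have h := ler_wpM2l (mulr_ge0 (mulr_ge0 (mulr_ge0 (ler0n _ k.+1) (kk k)) kap_ge0)
      (ler0n R (idle s))) (expr_le_rising R k (excess s)).
    by apply: le_trans (le_trans h _); rewrite le_eqVlt; apply/orP; left; apply/eqP; ring.
  by apply/andP; split; lra.
have b1 s : 0 <= kap ^+ k.+1 * y k.+1 s - pos_part (X s) ^+ k.+1 by case/andP: (bnd s).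
rewrite ger0_norm; last exact: expect_ge0.
have t1 := tM (tC (kap ^+ k.+1 * k.+1%:R ^+ 2)) (ty k).
have t2 := tM (tC (kap ^+ k.+1 * k.+1%:R)) tyI.
apply: (@le_trans _ _ (E (fun s => kap ^+ k.+1 * k.+1%:R ^+ 2 * y k s +
    kap ^+ k.+1 * k.+1%:R * (y k s * I s)))).
  apply: eL; [exact: (tameB W1)|exact: (tameD W1)|].
  by move=> s; case/andP: (bnd s).
rewrite eD// !eZ//.
have le : E (fun s => y k s * I s) <= b * e k.
  have <- : idle_moment pi (rising R k) 0 = e k by rewrite idle_moment0.
  by apply: (expect_idle_le N_gt0 tau_gt0 tau_le Ntau rM P_jsq pi_stationary) => //;
    [exact: rising_ge0|exact: rising_homo].
have c0 : 0 <= kap ^+ k.+1 * k.+1%:R by rewrite mulr_ge0// exprn_ge0.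
have := ler_wpM2l c0 le; rewrite /excess_moment exprS; lra.
Qed.

(** The negative part is at most [kap * idle], and the number of idle
    servers has the order [sq]. *)
Lemma scaled_neg_moment m :
  E (fun s => neg_part (X s) ^+ m) <= 2 ^+ m * m`!%:R * (sq * kap) ^+ m.
Proof.
have sq0 : 0 <= sq by apply: le_trans b_le; rewrite mulr_ge0 ?(ltW tau_gt0).
have := @idle_moment_le R N tau N_gt0 tau_gt0 tau_le Ntau rM P pi P_jsq pi_stationary
  (fun=> 1) (fun=> ler01) (fun _ _ _ => lexx _) (tC 1) sq sq2 b_le m.
rewrite idle_moment0 expect_cst mulr1 => le.
rewrite exprMn [_ * kap ^+ m]mulrC mulrA [_ * kap ^+ m]mulrC -!mulrA.
have km : 0 <= kap ^+ m by rewrite exprn_ge0.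
rewrite -!mulrA in le; apply: le_trans (ler_wpM2l km le).
have tr := tI (fun i => rising R m i.+1).
have tr1 : tame W (fun s => 1 * rising R m (idle s).+1) by apply: tM => //; exact: tC.
rewrite -eZ//; apply: eL; [exact: (tameX W1)|by apply: tM => //; exact: tC|].
move=> s; rewrite mul1r.
have nX : neg_part (X s) <= kap * (idle s).+1%:R.
  rewrite /neg_part ge_max X_E; apply/andP; split; last by rewrite mulr_ge0.
  rewrite opprB lerBlDr -natr1 mulrDr mulr1 -addrA lerDl.
  by rewrite addr_ge0 ?mulr_ge0.
apply: (@le_trans _ _ ((kap * (idle s).+1%:R) ^+ m)).
  by rewrite lerXn2r ?nnegrE ?mulr_ge0 ?neg_ge0.
by rewrite exprMn ler_wpM2l ?expr_le_rising.
Qed.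

End scaled_moments.

(** * The heavy traffic scaling *)

Section scaling.
Context (R : realType) (beta eps : R).
Hypotheses (beta_gt0 : 0 < beta) (eps_gt0 : 0 < eps) (eps_lt : eps < 2^-1).

Lemma cvg_natr_powRN (a : R) : 0 < a -> (N%:R : R) `^ (- a) @[N --> \oo] --> (0 : R).
Proof.
move=> a0; apply/cvgrPdist_le => /= e e0; near=> N.
have N0 : 0 < N%:R :> R by rewrite ltr0n; near: N; exact: nbhs_infty_gt.
rewrite sub0r normrN ger0_norm ?powR_ge0// powRN invf_ple ?posrE ?powR_gt0//.
have <- : (e^-1 `^ a^-1) `^ a = e^-1.
  by rewrite -powRrM mulVf ?gt_eqF// powRr1 ?invr_ge0 ?(ltW e0).
apply: ge0_ler_powR; rewrite ?(ltW a0) ?nnegrE ?powR_ge0 ?ler0n//.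
by near: N; exact: nbhs_infty_ger.
Unshelve. all: by end_near. Qed.

Definition scale (N : nat) : R := N%:R `^ (- 2^-1 - eps).
Definition gap N : R := beta * scale N.
Local Notation kap := scale.
Local Notation tau := gap.

Lemma jsq_lambda_gap N : jsq_lambda beta eps N = 1 - gap N.
Proof. by []. Qed.

Lemma scale_gt0 N : (0 < N)%N -> 0 < kap N.
Proof. by move=> N0; rewrite powR_gt0// ltr0n. Qed.

Let powD (N : nat) (a b : R) : (0 < N)%N ->
  (N%:R : R) `^ (a + b) = N%:R `^ a * N%:R `^ b.
Proof. by move=> N0; rewrite powRD// pnatr_eq0 -lt0n N0 implybT. Qed.

Let Nkap N : (0 < N)%N -> N%:R * kap N = N%:R `^ (2^-1 - eps).
Proof.
move=> N0; rewrite -[X in X * _]powRr1// -powD//; congr (_ `^ _).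
by field.
Qed.

Lemma cvg_scale : kap N @[N --> \oo] --> (0 : R).
Proof.
have -> : kap = fun N => N%:R `^ (- (2^-1 + eps)).
  by apply/funext => N; rewrite /kap opprD.
by apply: cvg_natr_powRN; rewrite addr_gt0.
Qed.

Lemma cvg_sqrt_scale : Num.sqrt N%:R * kap N @[N --> \oo] --> (0 : R).
Proof.
apply: cvg_trans (cvg_natr_powRN eps_gt0); apply: near_eq_cvg; near=> N.
have N0 : (0 < N)%N by near: N; exact: nbhs_infty_gt.
by rewrite -powR12_sqrt// -powD//; congr (_ `^ _); ring.
Unshelve. all: by end_near. Qed.

Lemma cvg_scale2 : N%:R * kap N ^+ 2 @[N --> \oo] --> (0 : R).
Proof.
have h : (Num.sqrt N%:R * kap N) ^+ 2 @[N --> \oo] --> (0 : R).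
  rewrite [X in _ --> X](_ : 0 = 0 ^+ 2 :> R); last by rewrite expr0n.
  by rewrite [in X in _ --> X]expr2; apply: cvgM; exact: cvg_sqrt_scale.
apply: cvg_trans h; apply: near_eq_cvg; near=> N.
by rewrite exprMn sqr_sqrtr.
Unshelve. all: by end_near. Qed.

Lemma cvg_invNscale : (N%:R * kap N)^-1 @[N --> \oo] --> (0 : R).
Proof.
have d0 : 0 < 2^-1 - eps by rewrite subr_gt0.
apply: cvg_trans (cvg_natr_powRN d0); apply: near_eq_cvg; near=> N.
have N0 : (0 < N)%N by near: N; exact: nbhs_infty_gt.
by rewrite Nkap// powRN.
Unshelve. all: by end_near. Qed.

(** [N * scale N] is [N] to the positive power [1/2 - eps], so that its
    powers outgrow any given one of [N]. *)
Lemma cvg_polyNscale p : exists2 q, (p < q)%N &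
  N%:R ^+ p / (N%:R * kap N) ^+ q @[N --> \oo] --> (0 : R).
Proof.
have d0 : 0 < 2^-1 - eps by rewrite subr_gt0.
pose q := maxn p.+1 (Num.truncn (p%:R / (2^-1 - eps))).+1.
have q_ge : p%:R / (2^-1 - eps) < q%:R.
  by rewrite (lt_le_trans (truncnS_gt _))// ler_nat leq_maxr.
exists q; first exact: leq_maxl.
have a0 : 0 < (2^-1 - eps) * q%:R - p%:R.
  by rewrite subr_gt0 mulrC -ltr_pdivrMr.
apply: cvg_trans (cvg_natr_powRN a0); apply: near_eq_cvg; near=> N.
have N0 : (0 < N)%N by near: N; exact: nbhs_infty_gt.
rewrite Nkap// -!powR_mulrn ?powR_ge0// -powRrM opprB powD// powRN.
by rewrite powR_mulrn.
Unshelve. all: by end_near. Qed.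

(** The conditions under which the estimates at fixed [N] hold; they hold
    for all large [N], see [near_heavy_traffic]. *)
Definition heavy_traffic N : Prop := [/\ (0 < N)%N, tau N <= 8^-1,
  16 <= N%:R * tau N, 16 * N%:R / tau N <= (1 + tau N / 8) ^+ (2 * (N %/ 4))
  & N%:R * tau N <= Num.sqrt N%:R].

Lemma gap_gt0 N : (0 < N)%N -> 0 < tau N.
Proof. by move=> N0; rewrite mulr_gt0// scale_gt0. Qed.

(** The gap [tau] tends to 0 but [N * tau] grows like a power of [N], more
    slowly than the square root; in particular [(1 + tau / 8) ^+ (N / 2)]
    beats any power of [N]. *)
Lemma near_heavy_traffic : \forall N \near \oo, heavy_traffic N.
Proof.
have [Q Q2 cQ] := cvg_polyNscale 2.
have q0 : (0 < Q.-1)%N by move: Q2; clear; lia.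
pose q := Q.-1; pose c : R := 16 * (64 * q%:R) ^+ q / beta ^+ Q.
have c0 : 0 < c.
  apply: divr_gt0; last exact: exprn_gt0.
  by apply: mulr_gt0 => //; apply: exprn_gt0; rewrite mulr_gt0// ltr0n.
near=> N.
have N6 : (6 <= N)%N by near: N; exact: nbhs_infty_ge.
have N0 : (0 < N)%N by exact: leq_trans N6.
have NR : 0 < N%:R :> R by rewrite ltr0n.
have k0 := scale_gt0 N0; have t0 := gap_gt0 N0.
have t8 : tau N <= 8^-1.
  rewrite /gap mulrC -ler_pdivlMr//; near: N.
  by apply: cvg0_near_le; [exact: cvg_scale|rewrite divr_gt0].
have bE : N%:R * tau N = beta * (N%:R * kap N) by rewrite /gap; ring.
have z0 : 0 < N%:R * kap N by rewrite mulr_gt0.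
split => //.
- have : (N%:R * kap N)^-1 <= beta / 16.
    by near: N; apply: cvg0_near_le; [exact: cvg_invNscale|rewrite divr_gt0].
  rewrite bE -[_ / _]invrK lef_pV2 ?posrE ?invr_gt0 ?divr_gt0//.
  by rewrite invf_div ler_pdivrMr// mulrC.
- have Z : N%:R ^+ 2 / (N%:R * kap N) ^+ Q <= c^-1.
    by near: N; apply: cvg0_near_le => //; rewrite invr_gt0.
  have := @expr_ge_polynomial R (tau N / 8) (2 * (N %/ 4)) q.
  rewrite divr_ge0 ?(ltW t0)//= => /(_ _ q0) h.
  have {h} h : (N%:R * tau N / (64 * q%:R)) ^+ q <= (1 + tau N / 8) ^+ (2 * (N %/ 4)).
    apply: le_trans (h _); last by move: t8; lra.
    have qR : 0 < q%:R :> R by rewrite ltr0n.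
    have z4 : N%:R / 4 <= (2 * (N %/ 4))%:R :> R.
      by rewrite ler_pdivrMr// -natrM ler_nat; move: N6; clear; lia.
    have a0 : 0 <= N%:R * tau N / (64 * q%:R).
      by apply: divr_ge0; apply: mulr_ge0 => //; exact: ltW.
    suff le1 : N%:R * tau N / (64 * q%:R) <= tau N / 8 * (2 * (N %/ 4))%:R / (2 * q%:R).
      by rewrite lerXn2r ?nnegrE// (le_trans a0).
    have -> : N%:R * tau N / (64 * q%:R) = tau N / 8 * (N%:R / 4) / (2 * q%:R).
      by field; rewrite gt_eqF.
    by rewrite ler_pM2r ?invr_gt0 ?mulr_gt0// ler_wpM2l// divr_ge0// ltW.
  apply: le_trans h.
  have QE : Q = q.+1 by rewrite /q; move: Q2; clear; lia.
  move: Z; rewrite bE expr_div_n /c.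
  have : 0 < (64 * q%:R) ^+ q :> R by rewrite exprn_gt0// mulr_gt0// ltr0n.
  move: ((64 * q%:R) ^+ q) => K K0; rewrite invf_div QE => Z.
  have b0 : 0 < beta * (N%:R * kap N) by rewrite mulr_gt0.
  have {}Z : 16 * K * N%:R ^+ 2 <= (beta * (N%:R * kap N)) ^+ q.+1.
    by move: Z; rewrite ler_pdivrMr ?exprn_gt0// mulrAC -exprMn ler_pdivlMr ?mulr_gt0// mulrC.
  have -> : 16 * N%:R / tau N = 16 * N%:R ^+ 2 / (beta * (N%:R * kap N)).
    by rewrite /gap; field; rewrite !gt_eqF.
  by rewrite ler_pdivrMr// mulrAC -exprSr ler_pdivlMr// mulrAC.
- have sk : Num.sqrt N%:R * kap N <= beta^-1.
    by near: N; apply: cvg0_near_le; [exact: cvg_sqrt_scale|rewrite invr_gt0].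
  move: sk; set s := Num.sqrt N%:R => sk; have s0 : 0 < s by rewrite sqrtr_gt0.
  have s2 : N%:R = s * s by rewrite -expr2 sqr_sqrtr.
  rewrite bE [in leLHS]s2 -mulrA mulrCA -[leRHS]mulr1 ler_wpM2l ?(ltW s0)//.
  by rewrite mulrC -ler_pdivlMr// mul1r.
Unshelve. all: by end_near. Qed.

End scaling.

(** * Limits of the stationary moments *)

(** Once [g n <= beta / 2], the term [g n * m' n] is absorbed on the left
    and bounds [m'] by a convergent sequence; then the whole error tends to
    0. *)
Lemma cvg_perturbed_recursion (R : realType) (beta a l : R) (m m' d g r : nat -> R) :
  0 < beta -> m n @[n --> \oo] --> l ->
  d n @[n --> \oo] --> 0 -> g n @[n --> \oo] --> 0 -> r n @[n --> \oo] --> 0 ->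
  (forall n, 0 <= g n) ->
  (\forall n \near \oo, 0 <= m' n /\
     `|beta * m' n - a * m n| <= d n * m n + g n * m' n + r n) ->
  m' n @[n --> \oo] --> a * l / beta.
Proof.
move=> b0 cm cd cg cr g0 H.
pose B n := 2 / beta * (a * m n + d n * m n + r n).
pose D n := d n * m n + g n * B n + r n.
have cD : D n @[n --> \oo] --> (0 : R).
  rewrite [X in _ --> X](_ : 0 = 0 * l + 0 * (2 / beta * (a * l + 0 * l + 0)) + 0); last by ring.
  apply: cvgD => //; apply: cvgD; first exact: cvgM.
  apply: cvgM => //; apply: cvgMr; apply: cvgD => //; apply: cvgD; last exact: cvgM.
  exact: cvgMr.
have c0 : (beta * m' n - a * m n) @[n --> \oo] --> (0 : R).
  have cND : - D n @[n --> \oo] --> (0 : R) by rewrite -oppr0; exact: cvgN.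
  apply: (squeeze_cvgr _ cND cD); near=> n.
  have [m'0 Hn] : 0 <= m' n /\
     `|beta * m' n - a * m n| <= d n * m n + g n * m' n + r n by near: n; exact: H.
  have gn : g n <= beta / 2.
    by near: n; apply: cvg0_near_le => //; rewrite divr_gt0.
  have m'B : m' n <= B n.
    rewrite /B -ler_pdivrMl ?divr_gt0// invf_div.
    have := ler_wpM2r m'0 gn; move: Hn; rewrite ler_norml => /andP[_ h1] h2.
    have -> : beta / 2 * m' n = beta * m' n - beta / 2 * m' n by field.
    by move: h1 h2; lra.
  rewrite -ler_norml (le_trans Hn)// /D lerD2r lerD2l.
  by rewrite ler_wpM2l.
have -> : m' = fun n => ((beta * m' n - a * m n) + a * m n) / beta.
  by apply/funext => n; field; rewrite gt_eqF.
rewrite [X in _ --> X](_ : _ = (0 + a * l) / beta); last by rewrite add0r.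
by apply: cvgMl; apply: cvgD => //; exact: cvgMr.
Unshelve. all: by end_near. Qed.

Section stationary_limit.
Context (R : realType) (beta eps : R).
Hypotheses (beta_gt0 : 0 < beta) (eps_gt0 : 0 < eps) (eps_lt : eps < 2^-1).
Variables (P : forall N : nat, R -> R.-pker (jsq_state N) ~> (jsq_state N))
  (pi : forall N : nat, probability (jsq_state N) R).
Hypothesis P_jsq : forall N : nat, (0 < N)%N -> 0 < jsq_lambda beta eps N ->
     ctmc_semigroup (jsq_rate (jsq_lambda beta eps N)) (P N).
Hypothesis pi_stationary : forall N : nat, (0 < N)%N ->
     0 < jsq_lambda beta eps N -> ctmc_stationary (P N) (pi N).
Local Notation kap := (scale eps).
Local Notation tau := (gap beta eps).
Local Notation heavy := (heavy_traffic beta eps).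

Lemma heavy_lambda N : heavy N -> 0 < jsq_lambda beta eps N.
Proof. by case=> _ t8 _ _ _; rewrite jsq_lambda_gap; move: t8; lra. Qed.

Let P_jsq' N : heavy N -> ctmc_semigroup (jsq_rate (1 - tau N)) (P N).
Proof. by move=> h; apply: P_jsq; [case: h|exact: heavy_lambda]. Qed.

Let pi_st' N : heavy N -> ctmc_stationary (P N) (pi N).
Proof. by move=> h; apply: pi_stationary; [case: h|exact: heavy_lambda]. Qed.

Let tau0 N : heavy N -> 0 < tau N.
Proof. by case=> N0 _ _ _ _; exact: gap_gt0. Qed.

Let sq2 N : Num.sqrt N%:R ^+ 2 = N%:R :> R. Proof. by rewrite sqr_sqrtr. Qed.

Definition scaled_moment k N : R := kap N ^+ k * excess_moment (pi N) k.
Local Notation m := scaled_moment.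

(** Multiply [excess_moment_rec] by [scale N ^+ k / N]. The errors become
    multiples of [N * scale^2], of [sqrt N * scale] and of [1 / (N *
    scale)], which tend to 0, and the contribution of queues of length at
    least three is killed by a large exponent [q]. *)
Lemma scaled_moment_rec k : exists d r : nat -> R,
  [/\ d N @[N --> \oo] --> 0, r N @[N --> \oo] --> 0 &
  \forall N \near \oo, 0 <= m k.+1 N /\
    `|beta * m k.+1 N - k.+2%:R * m k N| <=
      d N * m k N + (N%:R * kap N)^-1 * m k.+1 N + r N].
Proof.
pose d N : R := k.+2%:R * (beta ^+ 2 * (N%:R * kap N ^+ 2)
  + 17 * k.+2%:R * beta * (Num.sqrt N%:R * kap N)) + k%:R * beta * kap N.
have [Q Qp cQ] := cvg_polyNscale eps_lt (2 * k + 4).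
pose q := (Q - 2)%N.
have QE : Q = q.+2 by rewrite /q; move: Qp; clear; lia.
have kq : (k < q)%N by rewrite /q; move: Qp; clear; lia.
pose c : R := k.+2%:R ^+ k * (32 * q%:R) ^+ q * 128 / beta ^+ Q.
pose r N := c * (N%:R ^+ (2 * k + 4) / (N%:R * kap N) ^+ Q).
exists d, r; split.
- rewrite [X in _ --> X](_ : 0 = k.+2%:R * (beta ^+ 2 * 0
     + 17 * k.+2%:R * beta * 0) + k%:R * beta * 0); last by ring.
  apply: cvgD; last by apply: cvgMr; exact: cvg_scale.
  apply: cvgMr; apply: cvgD; apply: cvgMr; first exact: cvg_scale2.
  exact: cvg_sqrt_scale.
- by rewrite -(mulr0 c); exact: cvgMr.
near=> N.
have h : heavy N by near: N; exact: near_heavy_traffic.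
have N0 : (0 < N)%N by case: h.
have NR : 0 < N%:R :> R by rewrite ltr0n.
have k0 : 0 < kap N by exact: scale_gt0.
have k1 : kap N <= 1.
  by near: N; apply: cvg0_near_le => //; exact: cvg_scale.
have kk0 j : 0 < kap N ^+ j by exact: exprn_gt0.
have e0 := @excess_moment_ge0 R N (pi N).
split; first by rewrite mulr_ge0// ltW.
have t0 := tau0 h.
case: (h) => _ t8 b16 rM bs.
have rec := excess_moment_rec N0 t0 t8 b16 rM (P_jsq' h) (pi_st' h) (sq2 N) bs k.
have Rle := above2_rising_le N0 t0 t8 b16 rM (P_jsq' h) (pi_st' h) kq.
set ER := expect (pi N) _ in rec Rle.
have ER_r : kap N ^+ k * ER <= r N.
  have ER0 : 0 <= ER by apply: expect_ge0 => s; rewrite mulr_ge0// rising_ge0.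
  apply: (@le_trans _ _ ER).
    by rewrite ler_piMl// exprn_ile1// ltW.
  apply: (le_trans Rle).
  have NP : 0 <= above2_bound N (tau N) k.+1 q.
    rewrite /above2_bound; apply: mulr_ge0; last by rewrite divr_ge0// exprn_ge0// ltW.
    apply: mulr_ge0; apply: exprn_ge0 => //.
    by apply: divr_ge0 => //; rewrite mulr_ge0// ltW.
  apply: (@le_trans _ _ ((k.+2%:R * N%:R) ^+ k * above2_bound N (tau N) k.+1 q)).
    apply: ler_wpM2r => //; rewrite lerXn2r ?nnegrE// -natrM ler_nat.
    by move: N0; clear; nia.
  rewrite /above2_bound /r /c QE /gap le_eqVlt; apply/orP; left; apply/eqP.
  rewrite (_ : 2 * k + 4 = k + (k.+1 + 3))%N; last by clear; lia.
  rewrite (_ : q.+2 = q + 2)%N; last by clear; lia.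
  rewrite !exprD expr_div_n (mulrCA N%:R beta) ![(k.+2%:R * _) ^+ _]exprMn.
  rewrite [(beta * _) ^+ q]exprMn.
  have : 0 < beta ^+ q by rewrite exprn_gt0.
  have : 0 < (N%:R * kap N) ^+ q by rewrite exprn_gt0// mulr_gt0.
  move: ((N%:R * kap N) ^+ q) (beta ^+ q) ((32 * q%:R) ^+ q) (N%:R ^+ k : R)
    (N%:R ^+ k.+1 : R) (k.+2%:R ^+ k : R) => u v x y z w u0 v0.
  by field; rewrite !gt_eqF.
have scl : 0 <= kap N ^+ k / N%:R by rewrite divr_ge0// ltW.
have := ler_wpM2l scl rec.
have kN : kap N ^+ k / N%:R = `|kap N ^+ k / N%:R| by rewrite ger0_norm.
rewrite {1}kN -normrM.
have -> : kap N ^+ k / N%:R * (N%:R * tau N * excess_moment (pi N) k.+1 -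
     k.+2%:R * N%:R * excess_moment (pi N) k) =
  beta * m k.+1 N - k.+2%:R * m k N.
  by rewrite /m /gap exprS; field; rewrite gt_eqF.
move=> /le_trans; apply.
have -> : kap N ^+ k / N%:R * ((k.+2%:R * (N%:R * tau N + 17 * k.+2%:R * Num.sqrt N%:R) *
     (N%:R * tau N) + k%:R * (N%:R * tau N)) * excess_moment (pi N) k +
     excess_moment (pi N) k.+1 + N%:R * ER) =
  d N * m k N + (N%:R * kap N)^-1 * m k.+1 N + kap N ^+ k * ER.
  rewrite /m /d /gap [kap N ^+ k.+1]exprS; field; rewrite !gt_eqF//.
by rewrite lerD2l.
Unshelve. all: by end_near. Qed.

Lemma cvg_scaled_moment k :
  m k N @[N --> \oo] --> (k.+1`!%:R / beta ^+ k : R).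
Proof.
elim: k => [|k IH].
  rewrite expr0 divr1 (_ : m 0 = fun=> 1); first exact: cvg_cst.
  apply/funext => N; rewrite /m expr0 mul1r /excess_moment.
  rewrite (_ : (fun s => _) = fun=> 1) ?expect_cst//.
  by apply/funext => s; rewrite rising0.
have [d [r [cd cr H]]] := scaled_moment_rec k.
have g0 N : 0 <= (N%:R * kap N)^-1 by rewrite invr_ge0 mulr_ge0 ?powR_ge0.
have := cvg_perturbed_recursion beta_gt0 IH cd (cvg_invNscale eps_lt) cr g0 H.
rewrite (_ : _ / beta = k.+2`!%:R / beta ^+ k.+1)// (factS k.+1) natrM [beta ^+ k.+1]exprS.
by field; rewrite !gt_eqF// exprn_gt0.
Qed.

Lemma cvg_pos_moment k :
  expect (pi N) (fun s => pos_part (jsq_X eps s) ^+ k) @[N --> \oo] -->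
    (k.+1`!%:R / beta ^+ k : R).
Proof.
case: k => [|k].
  have -> : (fun N => expect (pi N) (fun s => pos_part (jsq_X eps s) ^+ 0)) = fun=> 1.
    apply/funext => N; rewrite -[RHS](expect_cst (pi N)).
    by congr (expect _ _); apply/funext => s; rewrite expr0.
  by rewrite expr0 divr1; exact: cvg_cst.
pose D N := (k.+1%:R ^+ 2 * kap N + k.+1%:R * beta * (N%:R * kap N ^+ 2)) * m k N.
have cD : D N @[N --> \oo] --> (0 : R).
  rewrite [X in _ --> X](_ : 0 = (k.+1%:R ^+ 2 * 0 + k.+1%:R * beta * 0) *
    (k.+1`!%:R / beta ^+ k)); last by ring.
  apply: cvgM; last exact: cvg_scaled_moment.
  by apply: cvgD; apply: cvgMr; [exact: cvg_scale|exact: cvg_scale2].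
have cmD : (m k.+1 N - D N) @[N --> \oo] --> (k.+2`!%:R / beta ^+ k.+1 : R).
  by rewrite -[X in _ --> X]subr0; apply: cvgB => //; exact: cvg_scaled_moment.
have cpD : (m k.+1 N + D N) @[N --> \oo] --> (k.+2`!%:R / beta ^+ k.+1 : R).
  by rewrite -[X in _ --> X]addr0; apply: cvgD => //; exact: cvg_scaled_moment.
apply: (squeeze_cvgr _ cmD cpD); near=> N.
have h : heavy N by near: N; exact: near_heavy_traffic.
have N0 : (0 < N)%N by case: h.
have t0 := tau0 h.
case: (h) => _ t8 b16 rM bs.
have := scaled_pos_moment N0 t0 t8 b16 rM (P_jsq' h) (pi_st' h) (ltW (scale_gt0 eps N0)) k.
rewrite -/(m k N) -/(m k.+1 N) => H.
have -> : D N = kap N * (k.+1%:R ^+ 2 + k.+1%:R * (N%:R * tau N)) * m k N.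
  by rewrite /D /gap; ring.
by move: H; rewrite ler_norml /jsq_X -/(scale eps N) => /andP[h1 h2]; apply/andP; split; lra.
Unshelve. all: by end_near. Qed.

Lemma cvg_neg_moment k :
  expect (pi N) (fun s => neg_part (jsq_X eps s) ^+ k.+1) @[N --> \oo] --> (0 : R).
Proof.
pose D N : R := 2 ^+ k.+1 * k.+1`!%:R * (Num.sqrt N%:R * kap N) ^+ k.+1.
have cD : D N @[N --> \oo] --> (0 : R).
  rewrite -(mulr0 (2 ^+ k.+1 * k.+1`!%:R)); apply: cvgMr; clear D.
  elim: k => [|k IH]; first by under eq_fun do rewrite expr1; exact: cvg_sqrt_scale.
  under eq_fun do rewrite exprS; rewrite -(mulr0 0).
  by apply: cvgM => //; exact: cvg_sqrt_scale.
apply: (squeeze_cvgr _ (cvg_cst 0) cD); near=> N.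
have h : heavy N by near: N; exact: near_heavy_traffic.
have N0 : (0 < N)%N by case: h.
have t0 := tau0 h.
case: (h) => _ t8 b16 rM bs.
apply/andP; split; first by apply: expect_ge0 => s; rewrite exprn_ge0// neg_ge0.
exact: (scaled_neg_moment N0 t0 t8 b16 rM (P_jsq' h) (pi_st' h) (sq2 N) bs
  (ltW (scale_gt0 eps N0)) k.+1).
Unshelve. all: by end_near. Qed.

Lemma heavy_weight_integrable N k : heavy N ->
  (pi N).-integrable setT (EFin \o (fun s => @size_weight R N s ^+ k)).
Proof.
move=> h; have t0 := tau0 h; case: (h) => N0 t8 b16 rM bs.
exact: (size_weight_integrable N0 t0 t8 b16 rM (P_jsq' h) (pi_st' h)).
Qed.

End stationary_limit.

(** * Convergence of the stationary laws *)

Section law_of_X.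
Context (R : realType) (beta eps : R).
Hypotheses (beta_gt0 : 0 < beta) (eps_gt0 : 0 < eps) (eps_lt : eps < 2^-1).
Variables (P : forall N : nat, R -> R.-pker (jsq_state N) ~> (jsq_state N))
  (pi : forall N : nat, probability (jsq_state N) R).
Hypothesis P_jsq : forall N : nat, (0 < N)%N -> 0 < jsq_lambda beta eps N ->
     ctmc_semigroup (jsq_rate (jsq_lambda beta eps N)) (P N).
Hypothesis pi_stationary : forall N : nat, (0 < N)%N ->
     0 < jsq_lambda beta eps N -> ctmc_stationary (P N) (pi N).
Local Notation heavy := (heavy_traffic beta eps).
Local Notation law N := (distribution (pi N) (jsq_X eps (N := N))).
Local Notation V := (@abs_weight R).

Let iW N k (h : heavy N) := heavy_weight_integrable beta_gt0 P_jsq pi_stationary k h.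
Let V1 := @abs_weight_ge1 R.
Let V0 x : 0 <= V x. Proof. exact: le_trans ler01 (V1 x). Qed.

Lemma tame_comp_X N (f : R -> R) : tame V f ->
  tame (@size_weight R N) (fun s => f (jsq_X eps s)).
Proof.
move=> [_ [C [k fC]]].
have W1 := @size_weight_ge1 R N.
have tX : tame (@size_weight R N) (fun s => V (jsq_X eps s)).
  apply: (tameD W1); first exact: tame_cst.
  by apply: tame_norm; exact: tame_scaled.
have tg := tameM W1 (tame_cst _ C) (tameX W1 k tX).
apply: (tame_le _ tg) => // s; rewrite (le_trans (fC _))//.
exact: ler_norm.
Qed.

Lemma integral_law N (f : R -> R) : heavy N -> tame V f ->
  (\int[law N]_x (f x)%:E = (expect (pi N) (fun s => f (jsq_X eps s)))%:E)%E.
Proof.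
move=> h tf; have t := tame_comp_X N tf.
have W1 := @size_weight_ge1 R N; have iN k := iW k h.
rewrite integral_distribution; last exact: (tame_integrable W1 iN t).
  by rewrite -(expectE W1 iN t).
by apply/measurable_EFinP; case: tf.
Qed.

Lemma law_weight_integrable N k : heavy N ->
  (law N).-integrable setT (EFin \o (fun x => V x ^+ k)).
Proof.
move=> h.
have tVk : tame V (fun x => V x ^+ k).
  apply: (tameX V1); apply: (tameW V1); apply: continuous_measurable_fun => x.
  by apply: cvgD; [exact: cvg_cst|exact: norm_continuous].
have mV : measurable_fun setT (fun x : R => V x ^+ k) by case: tVk.
apply/integrableP; split; first exact/measurable_EFinP.
rewrite (@eq_integral _ _ _ _ _ (fun x => (V x ^+ k)%:E)).
  by rewrite integral_law// ltry.
by move=> x _; rewrite /= ger0_norm// exprn_ge0.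
Qed.

(** The first terms of the sequence are discarded: finite moments of the
    stationary laws are guaranteed in heavy traffic only. *)
Lemma cvg_law (f : R -> R) C k : continuous f -> (forall x, `|f x| <= C * V x ^+ k) ->
  (\int[law N]_x (f x)%:E)%E @[N --> \oo] -->
  (\int[gamma2_distribution beta_gt0]_x (f x)%:E)%E.
Proof.
move=> cf fC.
have tf : tame V f := tame_continuous cf fC.
have [N0 _ heavy0] := near_heavy_traffic beta_gt0 eps_gt0 eps_lt.
have hv n : heavy (n + N0) by apply: heavy0; rewrite /= leq_addl.
have E_law g n : tame V g -> expect (law (n + N0)) g =
    expect (pi (n + N0)) (fun s => g (jsq_X eps s)).
  by move=> tg; rewrite /expect /Rintegral integral_law.
have iG := gamma2_weight_integrable beta_gt0.
rewrite -(cvg_shiftn N0) (expectE V1 iG tf).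
have -> : (fun n => (\int[law (n + N0)]_x (f x)%:E)%E) =
    fun n => (expect (law (n + N0)) f)%:E.
  by apply/funext => n; rewrite integral_law// E_law.
apply: cvg_EFin; first by near=> n.
have b2 : 0 < beta / 2 by rewrite divr_gt0.
apply: (@moments_cvg R (fun n => law (n + N0)) (gamma2_distribution beta_gt0)
  (fun n k => law_weight_integrable k (hv n)) iG _ _ b2 _ _ _ f C k cf fC).
- move=> j; rewrite expect_gamma2_pos.
  have := cvg_pos_moment beta_gt0 eps_gt0 eps_lt P_jsq pi_stationary (k := j).
  rewrite -(cvg_shiftn N0); apply: cvg_trans; apply: near_eq_cvg.
  by apply: nearW => n; rewrite E_law//; exact: tame_posX.
- exact: gamma2_growth.
- move=> j; have := cvg_neg_moment beta_gt0 eps_gt0 eps_lt P_jsq pi_stationary j.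
  rewrite -(cvg_shiftn N0); apply: cvg_trans; apply: near_eq_cvg.
  by apply: nearW => n; rewrite E_law//; apply: (tameX V1); exact: tame_neg.
- exact: expect_gamma2_neg.
Unshelve. all: by end_near. Qed.

Lemma cvg_expectation_law (f : R -> R) C k : continuous f -> (forall x, `|f x| <= C * V x ^+ k) ->
  'E_(pi N)[fun s => f (jsq_X eps s)]%E @[N --> \oo] -->
  (\int[gamma2_distribution beta_gt0]_x (f x)%:E)%E.
Proof.
move=> cf fC; apply: cvg_trans (cvg_law cf fC).
apply: near_eq_cvg; near=> N.
have h : heavy N by near: N; exact: near_heavy_traffic.
rewrite integral_law//; last exact: tame_continuous fC.
rewrite unlock -(expectE (@size_weight_ge1 R N) (fun k => iW k h))//.
by apply: tame_comp_X; exact: tame_continuous fC.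
Unshelve. all: by end_near. Qed.

End law_of_X.

Theorem theorem2p7 (R : realType) (beta eps : R)
  (beta_gt0 : 0 < beta) (eps_gt0 : 0 < eps) (eps_lt : eps < 2^-1)
  (P : forall N : nat, R -> R.-pker (jsq_state N) ~> (jsq_state N))
  (pi : forall N : nat, probability (jsq_state N) R)
  (P_jsq : forall N : nat, (0 < N)%N -> 0 < jsq_lambda beta eps N ->
     ctmc_semigroup (jsq_rate (jsq_lambda beta eps N)) (P N))
  (pi_stationary : forall N : nat, (0 < N)%N -> 0 < jsq_lambda beta eps N ->
     ctmc_stationary (P N) (pi N)) :
  weak_cvg (fun N => distribution (pi N) (jsq_X eps (N := N)))
    (gamma2_distribution beta_gt0) /\
  (forall p : R, 0 < p ->
     'E_(pi N)[fun s => real_pow (jsq_X eps s) p]%E @[N --> \oo] -->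
       (Gamma_fun (p + 2) / beta `^ p)%:E).
Proof.
split=> [f cf [M fM]|p p0].
  have fM0 x : `|f x| <= M * abs_weight x ^+ 0 by rewrite expr0 mulr1.
  exact: (cvg_law eps_gt0 eps_lt P_jsq pi_stationary cf fM0).
rewrite -(expect_gamma2_real_pow p0 beta_gt0).
have tp := tame_continuous (continuous_real_pow p0) (real_pow_le p0).
rewrite -(expectE (@abs_weight_ge1 R) (gamma2_weight_integrable beta_gt0) tp).
exact: (cvg_expectation_law eps_gt0 eps_lt P_jsq pi_stationary
  (continuous_real_pow p0) (real_pow_le p0)).
Qed.
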